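(* Let $k\ge2$ be a fixed integer (independent of $n$). For every $p\in(0,1)$ there exists $\varepsilon>0$, not depending on $n$, such that for all sufficiently large $n$ and every list $\boldsymbol v=(v_1,\dots,v_k)$ of $k$ distinct vertices of the geometric inhomogeneous random graph on $n$ vertices: - if $k>\frac{2}{3-\tau}$, then $$\mathbb P\big(\boldsymbol v\in W^{\mathrm{NG}}(\varepsilon)\,\big|\,\mathrm{GIRG}|_{\boldsymbol v}\text{ is a }k\text{-clique}\big)\ge p;$$ - if $k<\frac{2}{3-\tau}$, then $$\mathbb P\big(\boldsymbol v\in W^{\mathrm{G}}(\varepsilon)\,\big|\,\mathrm{GIRG}|_{\boldsymbol v}\text{ is a }k\text{-clique}\big)\ge p.$$
   Context: Geometric inhomogeneous random graph (GIRG). Fix $\tau\in(2,3)$, $w_0>0$, $\gamma>1$ and an integer $d\ge1$. For $n\in\mathbb N$ the vertex set is $V=\{1,\dots,n\}$. Each vertex $i$ has a weight $\mathrm w_i$ and a position $\mathrm x_i$, all independent. The weights are i.i.d. Pareto: $\mathbb P(\mathrm w>w)=(w_0/w)^{\tau-1}$ for $w\ge w_0$, with mean $\mu=\mathbb E[\mathrm w]=\frac{\tau-1}{\tau-2}w_0$. The positions are i.i.d. uniform on the torus $\mathbb T^d=\mathbb R^d/\mathbb Z^d$ (identified with $[0,1)^d$). Conditionally on weights and positions, each pair of distinct vertices $u,v$ is joined by an edge independently with probability $$p_{uv}=\min\Big\{\Big(\frac{\mathrm w_u\mathrm w_v}{n\mu\|\mathrm x_u-\mathrm x_v\|^d}\Big)^\gamma,1\Big\},$$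 where $\|x-y\|=\max_{1\le h\le d}|x^{(h)}-y^{(h)}|_C$ and $|a-b|_C=\min\{|a-b|,1-|a-b|\}$. $\mathrm{GIRG}|_{\boldsymbol v}$ is the induced subgraph on the vertices of $\boldsymbol v$; it is a $k$-clique if all $k$ vertices are pairwise connected. For $\eta\in\mathbb R$ and $\varepsilon\in(0,1)$ put $I_\varepsilon(n^\eta)=[\varepsilon(\mu n)^\eta,(\mu n)^\eta/\varepsilon]$, so $I_\varepsilon(\sqrt n)=[\varepsilon\sqrt{\mu n},\sqrt{\mu n}/\varepsilon]$. Define the sets of lists of distinct vertices $$W^{\mathrm{NG}}(\varepsilon)=\{(v_1,\dots,v_k):\ \mathrm w_{v_i}\in I_\varepsilon(\sqrt n)\ \text{for all } 1\le i\le k\},$$ $$W^{\mathrm G}(\varepsilon)=\{(v_1,\dots,v_k):\ |\mathrm x_{v_i}^{(h)}-\mathrm x_{v_1}^{(h)}|_C\in I_\varepsilon(n^{-1/d})\ \text{for all } 2\le i\le k,\ 1\le h\le d\}.$$ *)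

(* Defs.v *)
From HB Require Import structures.
From mathcomp Require Import all_boot all_order all_algebra.
From mathcomp Require Import all_classical all_reals all_analysis.

Set Implicit Arguments.
Unset Strict Implicit.
Unset Printing Implicit Defensive.

Import Order.TTheory GRing.Theory Num.Theory.
Import numFieldNormedType.Exports.

Local Open Scope classical_set_scope.
Local Open Scope ring_scope.

Section probability_notions.
Context {R : realType} {disp : measure_display} {T : measurableType disp}.
Variable P : probability T R.

(* Elementary conditional probability; it is 0 when [P B = 0]. *)
Definition cond_pr (A B : set T) : R := fine (P (A `&` B)) / fine (P B).

(* Mutual independence of a finite family of set systems, to be used with
   sigma-algebras. *)
Definition mutually_independent (I : finType) (F : I -> set_system T) : Prop :=
  forall (J : {set I}) (A : I -> set T),
    (forall i, i \in J -> F i (A i)) ->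
    P [set t | forall i, i \in J -> A i t] =
    (\prod_(i in J) fine (P (A i)))%:E.

(* [f] is a version of the conditional probability of [E] given the
   sub-sigma-algebra [S]. *)
Definition cond_pr_version (S : set_system T) (E : set T) (f : T -> R) : Prop :=
  [/\ forall B : set R, measurable B -> S (f @^-1` B),
      P.-integrable [set: T] (EFin \o f) &
      forall A, S A -> P (A `&` E) = (\int[P]_(t in A) (f t)%:E)%E].

End probability_notions.

Section girg.
Context {R : realType}.

Definition pareto_mean (tau w0 : R) : R := (tau - 1) / (tau - 2) * w0.

Definition circle_dist (a b : R) : R := Num.min `|a - b| (1 - `|a - b|).

Definition torus_dist (dim : nat) (x y : dim.-tuple R) : R :=
  \big[Num.max/0]_(h < dim) circle_dist (tnth x h) (tnth y h).

(* At distance 0 the quotient in the connection probability is +oo, hence the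
   value 1; the formula below would give 0 there because of x / 0 = 0. *)
Definition edge_pr (tau w0 gamma : R) (n dim : nat)
    (wu wv : R) (xu xv : dim.-tuple R) : R :=
  if torus_dist xu xv == 0 then 1
  else Num.min
    ((wu * wv / (n%:R * pareto_mean tau w0 * torus_dist xu xv ^+ dim))
       `^ gamma) 1.

Section sigma_algebra.
Context {disp : measure_display} {T : measurableType disp}.
Variables (P : probability T R) (n dim : nat).
Variables (weight : 'I_n -> {RV P >-> R}) (pos : 'I_n -> {RV P >-> dim.-tuple R}).

(* Indexed by [inl i] for the weight and [inr i] for the position of [i]. *)
Definition vertex_sigma (i : 'I_n + 'I_n) : set_system T :=
  match i with
  | inl u => g_sigma_algebra_preimage (weight u)
  | inr u => g_sigma_algebra_preimage (pos u)
  end.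

Definition vertices_sigma : set_system T := <<s \bigcup_i vertex_sigma i >>.

End sigma_algebra.

(* The torus is identified with [0, 1)^dim.  The law of a position is the
   dim-fold product of the Lebesgue measure on [0, 1), given by its values on
   measurable rectangles.  [girg_edges] says that, given all weights and
   positions, the edges are independent with the prescribed probabilities; an
   unordered pair of distinct vertices is encoded as (u, v) with u < v. *)
Record girg {disp : measure_display} {T : measurableType disp}
    (P : probability T R) (tau w0 gamma : R) (n dim : nat) := Girg {
  weight : 'I_n -> {RV P >-> R};
  pos : 'I_n -> {RV P >-> dim.-tuple R};
  adj : T -> rel 'I_n;
  adj_sym : forall t, symmetric (adj t);
  adj_irr : forall t, irreflexive (adj t);
  measurable_adj : forall u v, measurable [set t | adj t u v];
  weight_pareto : forall u (w : R), w0 <= w ->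
    P [set t | w < weight u t] = ((w0 / w) `^ (tau - 1))%:E;
  pos_torus : forall u t h, 0 <= tnth (pos u t) h < 1;
  pos_uniform : forall u (B : 'I_dim -> set R), (forall h, measurable (B h)) ->
    P [set t | forall h, B h (tnth (pos u t) h)] =
    (\prod_(h < dim) fine (lebesgue_measure (B h `&` `[0, 1[)))%:E;
  girg_independent : mutually_independent P (vertex_sigma weight pos);
  girg_edges : forall S : {set 'I_n * 'I_n},
    (forall e, e \in S -> (e.1 < e.2)%N) ->
    cond_pr_version P (vertices_sigma weight pos)
      [set t | forall e, e \in S -> adj t e.1 e.2]
      (fun t => \prod_(e in S)
        edge_pr tau w0 gamma n (weight e.1 t) (weight e.2 t)
                               (pos e.1 t) (pos e.2 t))
}.

(* I_eps(n^eta). *)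
Definition scale_itv (tau w0 : R) (n : nat) (eps eta : R) : set R :=
  `[eps * (pareto_mean tau w0 * n%:R) `^ eta,
    (pareto_mean tau w0 * n%:R) `^ eta / eps].

Section cliques.
Context {disp : measure_display} {T : measurableType disp}.
Context {P : probability T R} {tau w0 gamma : R} {n dim : nat}.
Variables (G : girg P tau w0 gamma n dim) (k : nat).

Definition clique (v : k.-tuple 'I_n) : set T :=
  [set t | forall i j : 'I_k, i != j -> adj G t (tnth v i) (tnth v j)].

Definition W_NG (eps : R) (t : T) : set (k.-tuple 'I_n) :=
  [set v : k.-tuple 'I_n | uniq v /\
    forall i, scale_itv tau w0 n eps 2^-1 (weight G (tnth v i) t)].

(* The index [i1] is that of the first vertex of the list. *)
Definition W_G (eps : R) (t : T) : set (k.-tuple 'I_n) :=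
  [set v : k.-tuple 'I_n | uniq v /\
    forall (i1 i : 'I_k) (h : 'I_dim), i1 = 0%N :> nat -> (0 < i)%N ->
      scale_itv tau w0 n eps (- dim%:R^-1)
        (circle_dist (tnth (pos G (tnth v i) t) h)
                     (tnth (pos G (tnth v i1) t) h))].

End cliques.
End girg.

(* Main.v *)
Require Import Defs.
From mathcomp Require Import all_boot all_order all_algebra.
From mathcomp Require Import all_classical all_reals all_analysis.
From mathcomp Require Import measurable_realfun.
From mathcomp Require Import ring lra.

(** Write [M] for [n] times the mean weight.  Let [m] be a vertex of the list
    of smallest weight.  A clique contains the star of the [k - 1] edges at
    [m], and unless [k = 2 / (3 - tau)] this star already has the probability of
    a clique up to a constant factor, so that the upper bounds below only use
    this star.

    Given the weights, an edge between [m] and a vertex of weight [w'] has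
    probability at most [C * w * w' / M], since [1 < gamma] makes the
    connection probability integrable in the position of the second vertex.
    Integrating over [w' >= w], where [2 < tau], gives a factor
    [C * w ^ (3 - tau) / M] for each edge, and there remains a truncated moment
    of order [(k - 1) * (3 - tau)] of the Pareto weight of [m].  This order
    exceeds [tau - 1] exactly when [2 / (3 - tau) < k].

    If the order is larger than [tau - 1], then the moment is dominated by the
    largest weights that are allowed.  The bound for [w < eps * sqrt M] is
    [eps] to a positive power times [M ^ (- k * (tau - 1) / 2)]
    ([small_weight_bound]).  If the smallest weight is at most [sqrt M] and
    another one exceeds [sqrt M / eps], the factor of that edge gains
    [eps ^ (tau - 2)] ([large_weight_bound]); if all weights exceed [sqrt M],
    then a product of tails is enough ([huge_weight_bound]).  On the other
    hand, vertices of weight above [sqrt M] are joined with probability one,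
    so that a clique has probability at least a constant times
    [M ^ (- k * (tau - 1) / 2)] ([clique_pr_ge_hubs]).

    If the order is smaller than [tau - 1], then the moment is finite and the
    star has probability of order [M ^ (- (k - 1))].  Requiring in addition
    that two vertices be closer than [eps * M ^ (- 1 / dim)] in some direction
    gains a factor [eps] ([near_bound]).  Requiring that [m] be farther than
    [M ^ (- 1 / dim) / (2 * eps)] from some vertex gains a positive power of
    [eps]: [gamma] is first lowered to some [s > 1] close to [1] so that all
    moments stay finite ([far_bound]).  Conversely, [k] vertices in the same
    cube of side a small multiple of [M ^ (- 1 / dim)] form a clique, and this
    has probability at least a constant times [M ^ (- (k - 1))]
    ([clique_pr_ge_near]).

    The integrals over the star are computed by integrating out one vertex at
    a time ([integral_resample_le], [integral_star_le]), which rests on the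
    independence of the generated sigma-algebras
    ([mutually_independent_blocks]).  All moments are bounded by splitting a
    variable dyadically and summing a geometric series ([dyadic_moment]). *)

Set Implicit Arguments.
Unset Strict Implicit.
Unset Printing Implicit Defensive.
Import Order.TTheory GRing.Theory Num.Theory.
Local Open Scope classical_set_scope.
Local Open Scope ring_scope.

(** * Independence and independent copies *)

Lemma measurable_forall (disp : measure_display) (T : measurableType disp)
    (I : finType) (D : pred I) (Q : I -> set T) :
  (forall i, D i -> measurable (Q i)) ->
  measurable [set t | forall i, D i -> Q i t].
Proof.
move=> mQ; rewrite (_ : [set t | _] = \big[setI/setT]_(i | D i) Q i).
  exact: bigsetI_measurable.
rewrite -bigcap_seq_cond; apply/seteqP; split => t /= h i.
  by move=> /andP[_]; exact: h.
by move=> Di; apply: h; rewrite /= mem_index_enum.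
Qed.

Section level_sets.
Context (R : realType) (disp : measure_display) (T : measurableType disp).
Variables (f : T -> R) (a b : R).
Hypothesis mf : measurable_fun [set: T] f.

Let measurable_preimage_itv (i : interval R) : measurable (f @^-1` [set` i]).
Proof. by rewrite -[X in measurable X]setTI; apply: mf. Qed.

Lemma measurable_set_gt : measurable [set t | a < f t].
Proof.
have -> : [set t | a < f t] = f @^-1` `]a, +oo[.
  by apply/seteqP; split => t /=; rewrite in_itv/= andbT.
exact: measurable_preimage_itv.
Qed.

Lemma measurable_set_ge : measurable [set t | a <= f t].
Proof.
have -> : [set t | a <= f t] = f @^-1` `[a, +oo[.
  by apply/seteqP; split => t /=; rewrite in_itv/= andbT.
exact: measurable_preimage_itv.
Qed.

Lemma measurable_set_lt : measurable [set t | f t < b].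
Proof.
have -> : [set t | f t < b] = f @^-1` `]-oo, b[.
  by apply/seteqP; split => t /=; rewrite in_itv.
exact: measurable_preimage_itv.
Qed.

Lemma measurable_set_le : measurable [set t | f t <= b].
Proof.
have -> : [set t | f t <= b] = f @^-1` `]-oo, b].
  by apply/seteqP; split => t /=; rewrite in_itv.
exact: measurable_preimage_itv.
Qed.

Lemma measurable_set_oc : measurable [set t | a < f t <= b].
Proof.
have -> : [set t | a < f t <= b] = f @^-1` `]a, b].
  by apply/seteqP; split => t /=; rewrite in_itv.
exact: measurable_preimage_itv.
Qed.

End level_sets.

(** Independence from one fixed event extends from a pi-system to the
    sigma-algebra that it generates, by uniqueness of finite measures. *)
Lemma indep_pi_system (R : realType) (disp : measure_display)
    (T : measurableType disp) (P : probability T R) (C : set (set T))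
    (B : set T) :
  C `<=` measurable -> C setT -> setI_closed C -> measurable B ->
  (forall A, C A -> P (A `&` B) = (P A * P B)%E) ->
  forall A, <<s C >> A -> P (A `&` B) = (P A * P B)%E.
Proof.
move=> Cm CT CI mB CB A sCA.
have PBfin : P B \is a fin_num by exact: fin_num_measure.
have PB0 : 0 <= fine (P B) by exact: fine_ge0.
pose m1 : {measure set T -> \bar R} := mrestr P mB.
pose m2 : {measure set T -> \bar R} := mscale (NngNum PB0) P.
have : m1 A = m2 A.
  apply: (g_sigma_algebra_measure_unique C Cm (fun=> setT)) => //.
  - by rewrite bigcup_const//; exists 0%N.
  - move=> X CX; transitivity (P (X `&` B)); first by [].
    by rewrite CB// muleC -[P B](fineK PBfin).
  - move=> _; apply: (@le_lt_trans _ _ 1%E); last exact: ltry.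
    by apply: probability_le1; exact: measurableI.
move=> E; transitivity (m2 A); first exact: E.
by rewrite muleC -[P B](fineK PBfin).
Qed.

(** Disjoint blocks of a mutually independent family generate independent
    sigma-algebras.  The pi-systems are those of the cylinder events. *)
Lemma mutually_independent_blocks (R : realType) (disp : measure_display)
    (T : measurableType disp) (P : probability T R) (I : finType)
    (F : I -> set_system T) (J1 J2 : {set I}) (A B : set T) :
  (forall i, sigma_algebra setT (F i)) -> (forall i, F i `<=` measurable) ->
  mutually_independent P F -> (forall i, i \in J1 -> i \notin J2) ->
  <<s \bigcup_(i in [set i | i \in J1]) F i >> A ->
  <<s \bigcup_(i in [set i | i \in J2]) F i >> B ->
  P (A `&` B) = (P A * P B)%E.
Proof.
move=> Fsig Fm FI J12.
pose cyl (J : {set I}) : set (set T) :=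
  [set A | exists2 f : I -> set T, (forall i, F i (f i)) &
     A = [set t | forall i, i \in J -> f i t]].
have FT i : F i setT.
  by have [F0 FC _] := Fsig i; rewrite -(setD0 setT); exact: FC.
have FI2 i : setI_closed (F i).
  by have /sigma_algebraP[//|_ _ _] := Fsig i.
have cylm J : cyl J `<=` measurable.
  by move=> _ [f Ff ->]; apply: measurable_forall => i _; exact: Fm.
have cylT J : cyl J setT.
  by exists (fun=> setT) => //; apply/seteqP; split.
have cylI J : setI_closed (cyl J).
  move=> _ _ [f Ff ->] [g Fg ->]; exists (fun i => f i `&` g i).
    by move=> i; exact: FI2.
  apply/seteqP; split => t /=; first by move=> [h1 h2] i iJ; split; auto.
  by move=> h; split => i /h [].
have cylS (J : {set I}) : \bigcup_(i in [set i | i \in J]) F i `<=` cyl J.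
  move=> X [i /= iJ FX]; exists (fun j => if j == i then X else setT).
    by move=> j; case: eqVneq => [->|].
  apply/seteqP; split => t /=; first by move=> Xt j jJ; case: eqP.
  by move=> /(_ i iJ); rewrite eqxx.
have cyl_indep X Y : cyl J1 X -> cyl J2 Y -> P (X `&` Y) = (P X * P Y)%E.
  move=> [f Ff ->] [g Fg ->].
  pose h i := if i \in J1 then f i else g i.
  have -> : [set t | forall i, i \in J1 -> f i t] `&`
            [set t | forall i, i \in J2 -> g i t] =
            [set t | forall i, i \in J1 :|: J2 -> h i t].
    apply/seteqP; split => t /=.
      move=> [h1 h2] i; rewrite inE /h; case: ifPn => [iJ _|_ /= iJ]; auto.
    move=> H; split => i iJ; have := H i; rewrite inE iJ ?orbT /h.
      by rewrite iJ; exact.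
    by case: ifPn => [/J12|_]; [rewrite iJ|exact].
  rewrite !FI//; last by move=> i _; rewrite /h; case: ifP.
  rewrite -EFinM; congr EFin.
  rewrite (eq_bigl [in [predU J1 & J2]]); last by move=> i; rewrite !inE.
  rewrite bigU /=.
    congr (_ * _); apply: eq_bigr => i iJ; rewrite /h ?iJ//.
    by case: ifPn => // /J12; rewrite iJ.
  by rewrite disjoint_subset; apply/fintype.subsetP => i /J12.
have sub (J : {set I}) X : <<s \bigcup_(i in [set i | i \in J]) F i >> X -> <<s cyl J >> X.
  by apply: sub_smallest2r; [exact: smallest_sigma_algebra|exact: cylS].
have sm J X : <<s cyl J >> X -> measurable X.
  by apply: smallest_sub; [exact: sigma_algebra_measurable|exact: cylm].
move=> /sub sA /sub sB.
apply: (@indep_pi_system _ _ _ _ (cyl J1)) => //; first exact: sm sB.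
move=> C cC; rewrite setIC muleC.
apply: (@indep_pi_system _ _ _ _ (cyl J2)) => //; first exact: cylm cC.
by move=> D cD; rewrite setIC muleC cyl_indep.
Qed.

(** If [U] and [Y] are independent, then [Y] may be replaced by a copy that is
    integrated separately: the law of the pair is the product of the laws, and
    the Fubini-Tonelli theorem applies. *)
Section indep_copy.
Context (R : realType) (disp d1 d2 : measure_display)
  (T : measurableType disp) (S1 : measurableType d1) (S2 : measurableType d2)
  (P : probability T R) (U : T -> S1) (Y : T -> S2).
Hypotheses (mU : measurable_fun setT U) (mY : measurable_fun setT Y).
Hypothesis indep : forall A B, measurable A -> measurable B ->
  P (U @^-1` A `&` Y @^-1` B) = (P (U @^-1` A) * P (Y @^-1` B))%E.
Variable f : S1 * S2 -> \bar R.
Hypotheses (mf : measurable_fun [set: S1 * S2] f) (f0 : forall x, (0 <= f x)%E).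

Lemma measurable_integral_copy :
  measurable_fun setT (fun t => (\int[P]_s f (U t, Y s))%E).
Proof.
have := measurable_fun_fubini_tonelli_F (m2 := P) (fun z : S1 * T => f (z.1, Y z.2)).
move=> H.
have mF : measurable_fun [set: S1] (fun x : S1 => (\int[P]_y f (x, Y y))%E).
  apply: H => //; apply: measurableT_comp => //.
  by apply: measurable_fun_pair => //; exact: measurableT_comp.
exact: (measurableT_comp mF mU).
Qed.

Lemma integral_indep_copy :
  (\int[P]_t f (U t, Y t) = \int[P]_t \int[P]_s f (U t, Y s))%E.
Proof.
have mUY : measurable_fun setT (fun t => (U t, Y t)).
  exact: measurable_fun_pair.
pose UY : {mfun T >-> (S1 * S2)%type} := mfun_Sub (mem_set mUY).
pose mU' : {mfun T >-> S1} := mfun_Sub (mem_set mU).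
pose mY' : {mfun T >-> S2} := mfun_Sub (mem_set mY).
pose PU := distribution P mU'.
pose PY := distribution P mY'.
pose PUY := distribution P UY.
have E : forall X, measurable X -> (PU \x PY)%E X = PUY X.
  apply: product_measure_unique => A B mA mB.
  exact: indep.
transitivity (\int[PUY]_z f z)%E.
  by rewrite ge0_integral_distribution.
transitivity (\int[PU \x PY]_z f z)%E.
  by apply: eq_measure_integral => A mA _; exact/esym/E.
rewrite fubini_tonelli1//.
transitivity (\int[P]_t (fubini_F PY f \o mU') t)%E.
  apply: ge0_integral_distribution; first exact: measurable_fun_fubini_tonelli_F.
  by move=> x; exact: integral_ge0.
apply: eq_integral => t _ /=.
apply: (ge0_integral_distribution mY' (f := fun y => f (U t, y))) => //.
exact: measurableT_comp.
Qed.
End indep_copy.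

(** * Integrating out the coordinates of a random tuple *)

Section resampling.
Context (R : realType) (disp d : measure_display)
  (T : measurableType disp) (S : measurableType d) (P : probability T R).
Context (k : nat).

(** The tuple [u] with its [j]-th coordinate replaced by [y]. *)
Definition upd (j : 'I_k) (u : k.-tuple S) (y : S) : k.-tuple S :=
  [tuple if i == j then y else tnth u i | i < k].

Lemma tnth_upd j u y i : tnth (upd j u y) i = if i == j then y else tnth u i.
Proof. by rewrite tnth_mktuple. Qed.

Lemma upd_upd j u x y : upd j (upd j u x) y = upd j u y.
Proof. by apply: eq_from_tnth => i; rewrite !tnth_upd; case: eqP. Qed.

Lemma upd_tnth j u : upd j u (tnth u j) = u.
Proof. by apply: eq_from_tnth => i; rewrite tnth_upd; case: eqP => [->|]. Qed.

Lemma measurable_upd j :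
  measurable_fun [set: k.-tuple S * S] (fun z => upd j z.1 z.2).
Proof.
apply/measurable_fun_tnthP => i.
have [->|ij] := eqVneq i j.
  rewrite [X in measurable_fun _ X](_ : _ = snd); first exact: measurable_snd.
  by apply/funext => z /=; rewrite tnth_upd eqxx.
rewrite [X in measurable_fun _ X](_ : _ = (fun u => tnth u i) \o fst); last first.
  by apply/funext => z /=; rewrite tnth_upd (negbTE ij).
apply: measurableT_comp; last exact: measurable_fst.
exact: measurable_tnth.
Qed.

Variable Z : T -> k.-tuple S.
Hypothesis mZ : measurable_fun [set: T] Z.
(* [upd j (Z t) point] masks the coordinate [j], so that it carries exactly the
   information on the other coordinates. *)
Hypothesis indepZ : forall j A B, measurable A -> measurable B ->
  P ((fun t => upd j (Z t) point) @^-1` A `&` (fun t => tnth (Z t) j) @^-1` B) =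
  (P ((fun t => upd j (Z t) point) @^-1` A) *
   P ((fun t => tnth (Z t) j) @^-1` B))%E.

Let mask_meas j : measurable_fun [set: T] (fun t => upd j (Z t) point).
Proof.
have mZp : measurable_fun [set: T] (fun t => (Z t, point : S)).
  exact: measurable_fun_pair.
exact: (measurableT_comp (measurable_upd j) mZp).
Qed.

Let coord_meas j : measurable_fun [set: T] (fun t => tnth (Z t) j).
Proof. exact: (measurableT_comp (measurable_tnth j) mZ). Qed.

Let upd_meas (F : k.-tuple S -> R) j : measurable_fun setT F ->
  measurable_fun [set: k.-tuple S * S] (fun z => (F (upd j z.1 z.2))%:E).
Proof.
move=> mF; apply/measurable_EFinP.
exact: (measurableT_comp mF (measurable_upd j)).
Qed.

Lemma integral_resample j (F : k.-tuple S -> R) :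
  measurable_fun setT F -> (forall u, 0 <= F u) ->
  (\int[P]_t (F (Z t))%:E =
   \int[P]_t \int[P]_s (F (upd j (Z t) (tnth (Z s) j)))%:E)%E.
Proof.
move=> mF F0.
rewrite (eq_integral (fun t => (F (upd j (upd j (Z t) point)
    (tnth (Z t) j)))%:E)); last by move=> t _; rewrite upd_upd upd_tnth.
rewrite (integral_indep_copy (mask_meas j) (coord_meas j) (@indepZ j) (upd_meas j mF)) //=.
- by apply: eq_integral => t _; apply: eq_integral => s _; rewrite upd_upd.
- by move=> z; rewrite lee_fin.
Qed.

(** One coordinate is integrated out: the factor [F] is replaced by a bound for
    its integral over the coordinate [j], the factor [Phi] not depending on it. *)
Lemma integral_resample_le j (Phi F h : k.-tuple S -> R) :
  measurable_fun setT Phi -> measurable_fun setT F -> measurable_fun setT h ->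
  (forall u, 0 <= Phi u) -> (forall u, 0 <= F u) -> (forall u, 0 <= h u) ->
  (forall u y, Phi (upd j u y) = Phi u) ->
  (forall t, \int[P]_s (F (upd j (Z t) (tnth (Z s) j)))%:E <= (h (Z t))%:E)%E ->
  (\int[P]_t (Phi (Z t) * F (Z t))%:E <= \int[P]_t (Phi (Z t) * h (Z t))%:E)%E.
Proof.
move=> mPhi mF mh Phi0 F0 h0 PhiE Fh.
rewrite (@integral_resample j (fun u => Phi u * F u)); last 2 first.
- exact: measurable_funM.
- by move=> u; exact: mulr_ge0.
have mFs t : measurable_fun [set: T] (fun s => (F (upd j (Z t) (tnth (Z s) j)))%:E).
  have mZp : measurable_fun [set: T] (fun s => (Z t, tnth (Z s) j)).
    by apply: measurable_fun_pair => //; exact: coord_meas.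
  exact: (measurableT_comp (upd_meas j mF) mZp).
have E t : (\int[P]_s ((Phi (upd j (Z t) (tnth (Z s) j)) *
      F (upd j (Z t) (tnth (Z s) j))))%:E =
    (Phi (Z t))%:E * \int[P]_s (F (upd j (Z t) (tnth (Z s) j)))%:E)%E.
  under eq_integral do rewrite PhiE EFinM.
  by rewrite ge0_integralZl//= => *; rewrite lee_fin.
under eq_integral do rewrite E.
apply: ge0_le_integral => //=.
- by move=> t _; apply: mule_ge0; rewrite ?lee_fin//; apply: integral_ge0 => s _; rewrite lee_fin.
- apply: emeasurable_funM.
    by apply/measurable_EFinP; exact: (measurableT_comp mPhi mZ).
  have -> : (fun t => \int[P]_s (F (upd j (Z t) (tnth (Z s) j)))%:E)%E =
     (fun t => \int[P]_s (fun z => (F (upd j z.1 z.2))%:E)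
                (upd j (Z t) point, tnth (Z s) j))%E.
    by apply/funext => t; apply: eq_integral => s _ /=; rewrite upd_upd.
  apply: (measurable_integral_copy P (mask_meas j) (coord_meas j) (upd_meas j mF)).
  by move=> z; rewrite lee_fin.
- apply/measurable_EFinP; apply: (@measurable_funM _ _ _ _ (Phi \o Z)).
    exact: (measurableT_comp mPhi mZ).
  exact: (measurableT_comp mh mZ).
- move=> t _; rewrite EFinM; apply: lee_pmul => //; rewrite ?lee_fin//.
  by apply: integral_ge0 => s _; rewrite lee_fin.
Qed.

(** Integrating out, one after the other, the coordinates of [s] in a product
    of factors that each involve the coordinate [m] and one element of [s]. *)
Lemma integral_star_le (m : 'I_k) (s : seq 'I_k) (g h : S -> R)
    (f : S * S -> R) :
  uniq s -> m \notin s ->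
  measurable_fun setT g -> measurable_fun setT h ->
  measurable_fun [set: S * S] f ->
  (forall x, 0 <= g x) -> (forall x, 0 <= h x) -> (forall z, 0 <= f z) ->
  (forall j t, j \in s ->
    \int[P]_t' (f (tnth (Z t) m, tnth (Z t') j))%:E <= (h (tnth (Z t) m))%:E)%E ->
  (\int[P]_t (g (tnth (Z t) m) *
      \prod_(j <- s) f (tnth (Z t) m, tnth (Z t) j))%:E <=
   \int[P]_t (g (tnth (Z t) m) * h (tnth (Z t) m) ^+ size s)%:E)%E.
Proof.
move=> + + mg mh mf g0 h0 f0.
have mcoord i : measurable_fun [set: k.-tuple S] (fun u => tnth u i).
  exact: measurable_tnth.
elim: s g mg g0 => [|j s ih] g mg g0 /=.
  by move=> _ _ _; under eq_integral do rewrite big_nil.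
rewrite inE negb_or => /andP[js us] /andP[mj ms] fh.
pose Phi (u : k.-tuple S) :=
  g (tnth u m) * \prod_(j <- s) f (tnth u m, tnth u j).
pose F (u : k.-tuple S) := f (tnth u m, tnth u j).
have mff i : measurable_fun [set: k.-tuple S] (fun u => f (tnth u m, tnth u i)).
  have mp : measurable_fun [set: k.-tuple S] (fun u => (tnth u m, tnth u i)).
    by apply: measurable_fun_pair; exact: mcoord.
  exact: (measurableT_comp mf mp).
apply: (@le_trans _ _ (\int[P]_t (Phi (Z t) * F (Z t))%:E)%E).
  rewrite le_eqVlt; apply/orP; left; apply/eqP/eq_integral => t _.
  by rewrite big_cons /Phi /F [f _ * _]mulrC mulrA.
apply: le_trans (@integral_resample_le j Phi F (fun u => h (tnth u m)) _ _ _ _ _ _ _ _) _.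
- apply: measurable_funM; first exact: (measurableT_comp mg (mcoord m)).
  by apply: measurable_prod => i _; exact: mff.
- exact: mff.
- exact: (measurableT_comp mh (mcoord m)).
- by move=> u; apply: mulr_ge0 => //; exact: prodr_ge0.
- by move=> u; exact: f0.
- by move=> u.
- move=> u y; rewrite /Phi tnth_upd (negbTE mj); congr (_ * _).
  apply: eq_big_seq => i si; rewrite tnth_upd; case: eqP => // ij.
  by move: js; rewrite -ij si.
- move=> t; apply: le_trans (fh j t _); last by rewrite inE eqxx.
  rewrite le_eqVlt; apply/orP; left; apply/eqP/eq_integral => t' _.
  by rewrite /F !tnth_upd eqxx (negbTE mj).
apply: le_trans (le_trans (ih (fun x => g x * h x) _ _ us ms _) _).
- rewrite le_eqVlt; apply/orP; left; apply/eqP/eq_integral => t _.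
  by rewrite /Phi mulrAC.
- exact: measurable_funM.
- by move=> x; exact: mulr_ge0.
- by move=> i t si; apply: fh; rewrite inE si orbT.
- rewrite le_eqVlt; apply/orP; left; apply/eqP/eq_integral => t _.
  by rewrite exprS mulrA.
Qed.

End resampling.

(** * Truncated moments of variables with a power tail *)

Lemma nneseries_geometric_le (R : realType) (u : nat -> \bar R) (a z : R) :
  0 <= a -> 0 <= z < 1 -> (forall n, (0 <= u n)%E) ->
  (forall n, (u n <= (a * z ^+ n)%:E)%E) ->
  (\sum_(n <oo) u n <= (a / (1 - z))%:E)%E.
Proof.
move=> a0 /andP[z0 z1] u0 uaz.
apply: (@le_trans _ _ (\sum_(n <oo) (a * z ^+ n)%:E)%E).
  by apply: lee_nneseries => n *; [exact: u0|exact: uaz].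
rewrite le_eqVlt; apply/orP; left; apply/eqP.
apply/cvg_lim => //; apply: cvg_EFin.
  by apply: nearW => n; rewrite /= sumEFin.
have := @cvg_geometric_series R a z; rewrite ger0_norm// => /(_ z1).
apply: cvg_trans; apply: near_eq_cvg; apply: nearW => n.
by rewrite /= sumEFin.
Qed.

(** The scales [rho ^ l * v] cover the values of [V] on [D] up to a factor [2];
    the tail bound at each scale leaves a geometric series of ratio
    [rho ^ (s - alpha)].  It is used with [rho = 1 / 2] below a level and with
    [rho = 2] above it. *)
Lemma dyadic_moment (R : realType) (disp : measure_display)
    (T : measurableType disp) (P : probability T R) (V : T -> R)
    (E D : set T) (K alpha s rho v : R) :
  measurable_fun [set: T] V -> measurable E -> measurable D ->
  0 <= K -> 0 <= s -> 0 < rho -> 0 < v -> rho `^ (s - alpha) < 1 ->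
  (forall x, 0 < x ->
    (P (E `&` [set t | (x < V t)%R]) <= (K * x `^ (- alpha))%:E)%E) ->
  (forall t, D t -> E t /\
    exists l, (rho ^+ l * v / 2 < V t <= rho ^+ l * v)%R) ->
  (\int[P]_t (V t `^ s * \1_D t)%:E <=
   (K * 2 `^ alpha / (1 - rho `^ (s - alpha)) * v `^ (s - alpha))%:E)%E.
Proof.
move=> mV mE mD K0 s0 rho0 v0 rho1 tail DE.
pose c l : R := rho ^+ l * v.
have c0 l : 0 < c l by rewrite mulr_gt0// exprn_gt0.
pose B l := E `&` [set t | c l / 2 < V t].
have mB l : measurable (B l).
  apply: measurableI => //.
  exact: (measurable_set_gt _ mV).
have mI (A : set T) : measurable A -> measurable_fun [set: T] (\1_A : T -> R).
  by move=> mA; exact: measurable_indic.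
have f0 l t : (0 <= (c l `^ s * \1_(B l) t)%:E)%E.
  by rewrite lee_fin mulr_ge0 ?powR_ge0.
apply: (@le_trans _ _
  (\int[P]_t (\sum_(l <oo) (c l `^ s * \1_(B l) t)%:E))%E).
  apply: ge0_le_integral => //.
  - by move=> t _; rewrite lee_fin mulr_ge0 ?powR_ge0.
  - apply/measurable_EFinP; apply: measurable_funM; last exact: mI.
    exact: (measurableT_comp (measurable_powR s) mV).
  - apply: (ge0_emeasurable_sum (P := xpredT)); first by move=> l x _ _; exact: f0.
    move=> l _.
    by apply/measurable_EFinP; apply: measurable_funM => //; exact: mI.
  - move=> t _; rewrite [\1_D _]indicE; case: (boolP (t \in D)) => [/set_mem Dt|Dt]; last first.
      by rewrite mulr0; apply: nneseries_ge0 => n _ _; exact: f0.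
    have [Et [l /andP[lV Vl]]] := DE _ Dt.
    apply: (@le_trans _ _ (c l `^ s * \1_(B l) t)%:E).
      rewrite lee_fin mulr1 indicE mem_set//= mulr1 ge0_ler_powR//.
        by rewrite nnegrE (le_trans _ (ltW lV))// divr_ge0// ltW// c0.
      by rewrite nnegrE ltW.
    apply: (@le_trans _ _ (\sum_(0 <= i < l.+1) (c i `^ s * \1_(B i) t)%:E)%E).
      rewrite big_nat_recr//= leeDr//; apply: sume_ge0 => i _; exact: f0.
    by apply: nneseries_lim_ge => i _ _; exact: f0.
rewrite integral_nneseries//; last first.
  move=> l; apply/measurable_EFinP; apply: measurable_funM => //; exact: mI.
have -> : K * 2 `^ alpha / (1 - rho `^ (s - alpha)) * v `^ (s - alpha) =
  (K * 2 `^ alpha * v `^ (s - alpha)) / (1 - rho `^ (s - alpha)).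
  by rewrite mulrAC.
apply: nneseries_geometric_le.
- by rewrite !mulr_ge0 ?powR_ge0.
- by rewrite powR_ge0 rho1.
- by move=> l; apply: integral_ge0 => t _; exact: f0.
- move=> l; under eq_integral do rewrite EFinM.
  rewrite ge0_integralZl//; last 2 first.
    by apply/measurable_EFinP; exact: mI.
    by rewrite lee_fin powR_ge0.
  rewrite integral_indic// setIT.
  apply: (@le_trans _ _ ((c l `^ s)%:E * (K * (c l / 2) `^ (- alpha))%:E)%E).
    apply: lee_pmul => //; rewrite ?lee_fin ?powR_ge0//.
    by apply: tail; rewrite divr_gt0.
  rewrite -EFinM lee_fin le_eqVlt; apply/orP; left; apply/eqP.
  have -> : (rho `^ (s - alpha)) ^+ l = (rho ^+ l) `^ (s - alpha).
    by rewrite -!powR_mulrn ?powR_ge0// ?ltW// -!powRrM mulrC.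
  rewrite -mulrA [v `^ _ * _]mulrC -powRM ?exprn_ge0 ?ltW// -/(c l).
  rewrite powRM ?invr_ge0 ?ltW// -powR_inv1// -powRrM mulrN mulN1r opprK.
  have -> : c l `^ (s - alpha) = c l `^ s * c l `^ (- alpha).
    by rewrite -powRD// (gt_eqF (c0 l)) implybT.
  ring.
Qed.

Lemma exists_le_expr2 (R : realType) (a b : R) : 0 < b ->
  exists n, a <= 2 ^+ n * b.
Proof.
move=> b0; exists (Num.truncn (a / b)).+1.
rewrite -ler_pdivrMr// (le_trans (ltW (truncnS_gt _)))//.
by rewrite -natrX ler_nat ltnW// ltn_expl.
Qed.

(** The constant in the bounds for the truncated moment of order [s] under a
    tail of exponent [alpha]; it is positive as soon as [s != alpha]. *)
Definition dyadic_cst {R : realType} (alpha s : R) : R :=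
  2 `^ alpha / (1 - 2 `^ (- `|s - alpha|)).

Lemma dyadic_cst_gt0 (R : realType) (alpha s : R) :
  s != alpha -> 0 < dyadic_cst alpha s.
Proof.
move=> sa; rewrite divr_gt0 ?powR_gt0// subr_gt0 powRN invf_lt1 ?powR_gt0//.
rewrite -[ltLHS](powRr0 (2 : R)) /powR pnatr_eq0/= mul0r.
by rewrite ltr_expR mulr_gt0 ?normr_gt0 ?subr_eq0// ln_gt0// ltr1n.
Qed.

(** If the order [s] exceeds the tail exponent, then the moment below a level
    is governed by this level. *)
Lemma moment_below (R : realType) (disp : measure_display)
    (T : measurableType disp) (P : probability T R) (V : T -> R)
    (E : set T) (K alpha s v : R) :
  measurable_fun [set: T] V -> measurable E ->
  0 <= K -> 0 <= s -> alpha < s -> 0 < v ->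
  (forall x, 0 < x ->
    (P (E `&` [set t | (x < V t)%R]) <= (K * x `^ (- alpha))%:E)%E) ->
  (\int[P]_t (V t `^ s * \1_(E `&` [set t | (0 < V t <= v)%R]) t)%:E <=
   (dyadic_cst alpha s * K * v `^ (s - alpha))%:E)%E.
Proof.
move=> mV mE K0 s0 as_ v0 tail.
have sa0 : 0 < s - alpha by rewrite subr_gt0.
have rhoE : 2^-1 `^ (s - alpha) = 2 `^ (- `|s - alpha|) :> R.
  by rewrite gtr0_norm// -[2^-1](powR_inv1 (ler0n _ 2)) -powRrM mulN1r.
apply: le_trans (@dyadic_moment _ _ _ _ V E _ K alpha s 2^-1 v mV mE _ K0 s0
  _ v0 _ tail _) _.
- apply: measurableI => //.
  exact: (measurable_set_oc _ _ mV).
- by rewrite invr_gt0.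
- rewrite rhoE; have := dyadic_cst_gt0 (alpha := alpha) (s := s).
  rewrite gt_eqF// => /(_ isT).
  by rewrite /dyadic_cst pmulr_rgt0 ?powR_gt0// invr_gt0 subr_gt0.
- move=> t [Et /= /andP[V0 Vv]]; split => //.
  have ex : exists n, 2^-1 ^+ n * v / 2 < V t.
    have [n hn] := exists_le_expr2 v V0; exists n.
    have p0 : (0 : R) < 2 ^+ n by rewrite exprn_gt0.
    have : (2 ^+ n)^-1 * v <= V t by rewrite mulrC ler_pdivrMr// mulrC.
    rewrite exprVn; lra.
  case: (ex_minnP ex) => -[|m] hm min.
    by exists 0%N; rewrite hm expr0 mul1r.
  exists m.+1; rewrite hm/= exprSr -[_ * _ * v]mulrA [2^-1 * v]mulrC mulrA leNgt.
  by apply/negP => /min; rewrite ltnn.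
by rewrite rhoE lee_fin le_eqVlt /dyadic_cst; apply/orP; left; apply/eqP; ring.
Qed.

(** If the order [s] is below the tail exponent, then the moment above a level
    is governed by this level. *)
Lemma moment_above (R : realType) (disp : measure_display)
    (T : measurableType disp) (P : probability T R) (V : T -> R)
    (E : set T) (K alpha s v : R) :
  measurable_fun [set: T] V -> measurable E ->
  0 <= K -> 0 <= s -> s < alpha -> 0 < v ->
  (forall x, 0 < x ->
    (P (E `&` [set t | (x < V t)%R]) <= (K * x `^ (- alpha))%:E)%E) ->
  (\int[P]_t (V t `^ s * \1_(E `&` [set t | (v <= V t)%R]) t)%:E <=
   (dyadic_cst alpha s * K * v `^ (s - alpha))%:E)%E.
Proof.
move=> mV mE K0 s0 as_ v0 tail.
have sa0 : s - alpha < 0 by rewrite subr_lt0.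
have rhoE : 2 `^ (s - alpha) = 2 `^ (- `|s - alpha|) :> R.
  by rewrite ltr0_norm// opprK.
apply: le_trans (@dyadic_moment _ _ _ _ V E _ K alpha s 2 v mV mE _ K0 s0
  _ v0 _ tail _) _.
- apply: measurableI => //.
  exact: (measurable_set_ge _ mV).
- by [].
- rewrite rhoE; have := dyadic_cst_gt0 (alpha := alpha) (s := s).
  rewrite lt_eqF// => /(_ isT).
  by rewrite /dyadic_cst pmulr_rgt0 ?powR_gt0// invr_gt0 subr_gt0.
- move=> t [Et /= vV]; split => //.
  have ex := exists_le_expr2 (V t) v0.
  case: (ex_minnP ex) => -[|m] hm min.
    exists 0%N; rewrite hm andbT expr0 mul1r (lt_le_trans _ vV)//.
    by rewrite gtr_pMr// invf_lt1// ltr1n.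
  exists m.+1; rewrite hm andbT.
  have -> : 2 ^+ m.+1 * v / 2 = 2 ^+ m * v by rewrite exprS; field.
  rewrite ltNge.
  by apply/negP => /min; rewrite ltnn.
by rewrite rhoE lee_fin le_eqVlt /dyadic_cst; apply/orP; left; apply/eqP; ring.
Qed.

(** * The torus: measurability and distances *)

(** The inverse is written [x * (x ^ 2) ^ (- 1)], a formula that is also valid
    at [0]. *)
Lemma measurable_invr (R : realType) : measurable_fun [set: R] (@GRing.inv R).
Proof.
have -> : @GRing.inv R = (fun x => x * (x ^+ 2) `^ (-1)).
  apply/funext => x; rewrite powR_inv1 ?sqr_ge0//.
  have [->|x0] := eqVneq x 0; first by rewrite invr0 mul0r.
  by rewrite expr2 invfM mulrA divff// mul1r.
apply: measurable_funM; first exact: measurable_id.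
apply: (measurableT_comp (measurable_powR (-1))).
by apply: measurable_funX; exact: measurable_id.
Qed.

Lemma measurable_fun_bigmaxr (R : realType) (disp : measure_display)
    (T : measurableType disp) (I : Type) (s : seq I) (f : I -> T -> R) :
  (forall i, measurable_fun [set: T] (f i)) ->
  measurable_fun [set: T] (fun t => \big[Num.max/0]_(i <- s) f i t).
Proof.
move=> mf; elim: s => [|i s ih].
  by under eq_fun do rewrite big_nil; exact: measurable_cst.
by under eq_fun do rewrite big_cons; apply: measurable_maxr.
Qed.

Section measurability.
Context (R : realType) (disp : measure_display) (T : measurableType disp).

Lemma measurable_circle_dist (f g : T -> R) :
  measurable_fun [set: T] f -> measurable_fun [set: T] g ->
  measurable_fun [set: T] (fun t => circle_dist (f t) (g t)).
Proof.
move=> mf mg.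
have mn : measurable_fun [set: T] (fun t => `|f t - g t|).
  by apply: measurableT_comp => //; exact: measurable_funB.
by apply: measurable_minr => //; apply: measurable_funB => //; exact: measurable_cst.
Qed.

Lemma measurable_torus_dist (dim : nat) (x y : T -> dim.-tuple R) :
  measurable_fun [set: T] x -> measurable_fun [set: T] y ->
  measurable_fun [set: T] (fun t => torus_dist (x t) (y t)).
Proof.
move=> mx my; apply: measurable_fun_bigmaxr => h.
apply: measurable_circle_dist.
- exact: (measurableT_comp (measurable_tnth h) mx).
- exact: (measurableT_comp (measurable_tnth h) my).
Qed.

Lemma measurable_edge_pr (tau w0 gamma : R) (n dim : nat)
    (u v : T -> R) (x y : T -> dim.-tuple R) :
  measurable_fun [set: T] u -> measurable_fun [set: T] v ->
  measurable_fun [set: T] x -> measurable_fun [set: T] y ->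
  measurable_fun [set: T]
    (fun t => edge_pr tau w0 gamma n (u t) (v t) (x t) (y t)).
Proof.
move=> mu mv mx my.
have mD := measurable_torus_dist mx my.
apply: measurable_fun_ifT.
- by apply: measurable_fun_eqr => //; exact: measurable_cst.
- exact: measurable_cst.
- apply: measurable_minr; last exact: measurable_cst.
  apply: (measurableT_comp (measurable_powR gamma)).
  apply: measurable_funM; first exact: measurable_funM.
  apply: (measurableT_comp (@measurable_invr R)).
  by apply: measurable_funM; [exact: measurable_cst|exact: measurable_funX].
Qed.

End measurability.

Section distances.
Context (R : realType).
Implicit Types a b c : R.

Lemma circle_distC a b : circle_dist a b = circle_dist b a.
Proof. by rewrite /circle_dist distrC. Qed.

Lemma torus_distC (dim : nat) (x y : dim.-tuple R) :
  torus_dist x y = torus_dist y x.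
Proof. by apply: eq_bigr => h _; exact: circle_distC. Qed.

Lemma torus_dist_ge0 (dim : nat) (x y : dim.-tuple R) : 0 <= torus_dist x y.
Proof. exact: bigmax_ge_id. Qed.

Lemma circle_dist_le_torus (dim : nat) (x y : dim.-tuple R) h :
  circle_dist (tnth x h) (tnth y h) <= torus_dist x y.
Proof. exact: (le_bigmax _ (fun h => circle_dist (tnth x h) (tnth y h))). Qed.

Lemma circle_dist_le_norm a b : circle_dist a b <= `|a - b|.
Proof. by rewrite ge_min lexx. Qed.

Lemma circle_dist_triangle a b c : 0 <= a < 1 -> 0 <= b < 1 -> 0 <= c < 1 ->
  circle_dist a c <= circle_dist a b + circle_dist b c.
Proof.
move=> /andP[? ?] /andP[? ?] /andP[? ?]; rewrite /circle_dist ge_min.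
have nE (x : R) : (`|x| = x /\ 0 <= x) \/ (`|x| = - x /\ x <= 0).
  by case: (ger0P x) => hx; [left|right]; split => //; exact: ltW.
rewrite -[_ || _]negbK negb_or -!ltNge; apply/negP => /andP[].
case: (leP `|a - b| _) => _; case: (leP `|b - c| _) => _;
  case: (nE (a - b)) => -[-> ?]; case: (nE (b - c)) => -[-> ?];
  case: (nE (a - c)) => -[-> ?]; lra.
Qed.

Lemma measurable_circle_ball (c r : R) : measurable [set y | circle_dist c y <= r].
Proof.
apply: measurable_set_le; exact: measurable_circle_dist.
Qed.

(** A ball of radius [r] in [0, 1) lies in the union of an interval of length
    [2 * r] around its centre and of the two intervals of length [r] at the ends. *)
Lemma lebesgue_circle_ball_le (c r : R) : 0 <= c < 1 -> 0 <= r ->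
  fine (lebesgue_measure ([set y | circle_dist c y <= r] `&` `[0, 1[)) <= 4 * r.
Proof.
move=> /andP[c0 c1] r0.
set A := _ `&` _.
have mA : measurable A by apply: measurableI => //; exact: measurable_circle_ball.
pose I1 := (`[c - r, c + r])%classic : set R.
pose I2 := (`[0, r])%classic : set R.
pose I3 := (`[1 - r, 1])%classic : set R.
have sub : A `<=` (I1 `|` I2) `|` I3.
  move=> y [/=]; rewrite /circle_dist /I1 /I2 /I3 !in_itv/= ge_min.
  move=> /orP[|] h /andP[y0 y1].
    left; left; move: h; rewrite /= in_itv/= ler_norml; lra.
  have : 1 - r <= `|c - y| by lra.
  by rewrite ler_normr => /orP[|] h2; [left; right|right]; rewrite /= in_itv/=; lra.
have [mI1 mI2 mI3] : [/\ measurable I1, measurable I2 & measurable I3].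
  by split; exact: measurable_itv.
have le : (lebesgue_measure A <= (4 * r)%:E)%E.
  have m12 : measurable (I1 `|` I2) by exact: measurableU.
  apply: (@le_trans _ _ (lebesgue_measure ((I1 `|` I2) `|` I3))).
    by apply: le_measure; rewrite ?inE//; exact: measurableU.
  apply: (@le_trans _ _
      (lebesgue_measure I1 + lebesgue_measure I2 + lebesgue_measure I3)%E).
    apply: le_trans; first exact: measureU2.
    by apply: leeD => //; exact: measureU2.
  rewrite !lebesgue_measure_itv/= !lte_fin.
  have E (b : bool) (x : R) : 0 <= x -> ((if b then x%:E else 0) <= x%:E)%E.
    by case: b => // x0; rewrite lee_fin.
  have -> : 4 * r = (c + r - (c - r)) + (r - 0) + (1 - (1 - r)) by ring.
  rewrite !EFinD; apply: leeD; first apply: leeD.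
  - by rewrite -!EFinD; apply: E; lra.
  - by rewrite -!EFinD; apply: E; lra.
  - by rewrite -!EFinD; apply: E; lra.
rewrite -lee_fin fineK// fin_numElt (lt_le_trans _ (measure_ge0 _ _)) ?ltNyr//=.
by rewrite (le_lt_trans le)// ltry.
Qed.

End distances.

(** * Connection to a vertex with a uniform position *)

Section uniform_position.
Context (R : realType) (disp : measure_display) (T : measurableType disp)
  (P : probability T R) (dim : nat) (X : T -> dim.-tuple R).
Hypothesis dim_gt0 : (0 < dim)%N.
Hypothesis mX : measurable_fun [set: T] X.
Hypothesis X_uniform : forall B : 'I_dim -> set R, (forall h, measurable (B h)) ->
  P [set t | forall h, B h (tnth (X t) h)] =
  (\prod_(h < dim) fine (lebesgue_measure (B h `&` `[0, 1[)))%:E.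

Lemma measurable_box (B : 'I_dim -> set R) : (forall h, measurable (B h)) ->
  measurable [set t | forall h, B h (tnth (X t) h)].
Proof.
move=> mB.
rewrite (_ : [set t | _] = [set t | forall h : 'I_dim, true ->
    ((fun t => tnth (X t) h) @^-1` B h) t]).
  apply: (measurable_forall (D := xpredT)) => h _.
  rewrite -[X in measurable X]setTI.
  exact: (measurableT_comp (measurable_tnth h) mX).
by apply/seteqP; split => t /= H h; [move=> _; exact: H|exact: H].
Qed.

Lemma pr_box_le (c r : 'I_dim -> R) :
  (forall h, 0 <= c h < 1) -> (forall h, 0 <= r h) ->
  (P [set t | forall h, (circle_dist (c h) (tnth (X t) h) <= r h)%R] <=
   (\prod_(h < dim) (4 * r h))%:E)%E.
Proof.
move=> c01 r0.
rewrite (X_uniform (B := fun h => [set y | circle_dist (c h) y <= r h])).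
  rewrite lee_fin; apply: ler_prod => h _; rewrite fine_ge0//=.
  exact: lebesgue_circle_ball_le.
by move=> h; exact: measurable_circle_ball.
Qed.

Variable x : dim.-tuple R.
Hypothesis x01 : forall h, 0 <= tnth x h < 1.

Let D t := torus_dist x (X t).
Let V t := (D t ^+ dim)^-1.

Let mD : measurable_fun [set: T] D.
Proof. by apply: measurable_torus_dist => //; exact: measurable_cst. Qed.

Let mV : measurable_fun [set: T] V.
Proof.
apply: (measurableT_comp (@measurable_invr R)); exact: measurable_funX.
Qed.

Let mDlt r : measurable [set t | D t < r].
Proof.
exact: (measurable_set_lt _ mD).
Qed.

Lemma pr_torus_ball_le (r : R) : 0 < r ->
  (P ([set: T] `&` [set t | (torus_dist x (X t) < r)%R]) <= (4 ^+ dim * r `^ (dim%:R * 1))%:E)%E.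
Proof.
move=> r0; rewrite setTI mulr1 (powR_mulrn _ (ltW r0)) -exprMn.
have := @pr_box_le (tnth x) (fun=> r) x01 (fun=> ltW r0).
rewrite prodr_const card_ord => H. apply: le_trans H.
apply: le_measure; rewrite ?inE.
- exact: mDlt.
- apply: (@measurable_box (fun h => [set y | circle_dist (tnth x h) y <= r])) => h.
  exact: measurable_circle_ball.
- by move=> t /= h i; apply: (le_trans (circle_dist_le_torus _ _ i) (ltW h)).
Qed.

(** The condition in the direction [h0] replaces one of the [dim] factors of
    the volume of the ball. *)
Lemma pr_torus_ball_slab_le (h0 : 'I_dim) (c delta r : R) :
  0 <= c < 1 -> 0 <= delta -> 0 < r ->
  (P ([set t | (circle_dist c (tnth (X t) h0) <= delta)%R] `&`
      [set t | (torus_dist x (X t) < r)%R]) <=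
   (4 ^+ dim * delta * r `^ (dim%:R * (dim.-1%:R / dim%:R)))%:E)%E.
Proof.
move=> c01 d0 r0.
have dE : dim%:R * (dim.-1%:R / dim%:R) = dim.-1%:R :> R.
  by rewrite mulrCA divff ?mulr1// pnatr_eq0 -lt0n.
rewrite dE (powR_mulrn _ (ltW r0)).
pose c' h := if h == h0 then c else tnth x h.
pose r' h := if h == h0 then delta else r.
have := @pr_box_le c' r'.
rewrite (bigD1 h0)//= /r' eqxx.
rewrite (eq_bigr (fun=> 4 * r)); last by move=> h /negbTE ->.
rewrite prodr_const cardC1 card_ord => H.
have -> : 4 ^+ dim * delta * r ^+ dim.-1 = 4 * delta * (4 * r) ^+ dim.-1.
  by rewrite exprMn -[in 4 ^+ dim](prednK dim_gt0) exprS; ring.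
apply: le_trans (H _ _).
- apply: le_measure; rewrite ?inE.
  + apply: measurableI; last exact: mDlt.
    have -> : [set t | circle_dist c (tnth (X t) h0) <= delta] =
      (fun t => tnth (X t) h0) @^-1` [set y | circle_dist c y <= delta].
      by [].
    rewrite -[X in measurable X]setTI.
    apply: (measurableT_comp (measurable_tnth h0) mX) => //.
    exact: measurable_circle_ball.
  + apply: (@measurable_box (fun h => [set y | circle_dist (c' h) y <= r' h])) => h.
    exact: measurable_circle_ball.
  + move=> t /= [h1 h2] i; rewrite /c'; case: eqP => [->//|_].
    by apply: (le_trans (circle_dist_le_torus _ _ i) (ltW h2)).
- by move=> h; rewrite /c'; case: ifP.
- by move=> h; case: ifP => // _; exact: ltW.
Qed.

Let dimn0 : dim%:R != 0 :> R. Proof. by rewrite pnatr_eq0 -lt0n. Qed.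

Let D0 t : 0 <= D t. Proof. exact: torus_dist_ge0. Qed.

Let V0 t : D t != 0 -> 0 < V t.
Proof. by move=> h; rewrite invr_gt0 exprn_gt0// lt_neqAle eq_sym h D0. Qed.

Let ltroot t y : 0 < y -> (D t < y `^ dim%:R^-1) = (D t ^+ dim < y).
Proof.
move=> y0; have rootK : (y `^ dim%:R^-1) `^ dim%:R = y.
  by rewrite -powRrM mulVf// powRr1// ltW.
rewrite -(powR_mulrn _ (D0 t)) -[in RHS]rootK.
apply/idP/idP => h.
  by apply: gt0_ltr_powR; rewrite ?ltr0n// nnegrE ?D0 ?powR_ge0.
rewrite ltNge; apply/negP => h2; move: h; rewrite ltNge => /negP; apply.
by apply: ge0_ler_powR; rewrite ?ler0n// nnegrE ?D0 ?powR_ge0.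
Qed.

(** The variable whose moments are taken is the inverse of the [dim]-th power of
    the distance, so that a volume bound for balls is a tail bound. *)
Lemma inv_dist_tail (E : set T) (K alpha : R) : measurable E ->
  (forall r, 0 < r -> (P (E `&` [set t | (torus_dist x (X t) < r)%R]) <=
     (K * r `^ (dim%:R * alpha))%:E)%E) ->
  forall y, 0 < y ->
  (P (E `&` [set t | (y < (torus_dist x (X t) ^+ dim)^-1)%R]) <=
    (K * y `^ (- alpha))%:E)%E.
Proof.
move=> mE EK y y0; have yd : 0 < y^-1 by rewrite invr_gt0.
apply: (@le_trans _ _ (P (E `&` [set t | (D t < y^-1 `^ dim%:R^-1)%R]))).
  apply: le_measure; rewrite ?inE.
  - apply: measurableI => //.
    exact: (measurable_set_gt _ mV).
  - by apply: measurableI => //; exact: mDlt.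
  - move=> t /= [Et yV]; split => //.
    have [->|Dt] := eqVneq (D t) 0; first by rewrite powR_gt0.
    rewrite ltroot// -[D t ^+ dim]invrK ltf_pV2// posrE//.
    exact: V0.
apply: (le_trans (EK _ _)); first by rewrite powR_gt0.
by rewrite -powRrM mulrA mulVf// mul1r -(powR_inv1 (ltW y0)) -powRrM mulN1r.
Qed.

Section edge.
Variables (tau w0 gamma : R) (n : nat) (wu wv : R).
Let A := wu * wv / (n%:R * pareto_mean tau w0).
Hypothesis A0 : 0 < A.
Let e t := edge_pr tau w0 gamma n wu wv x (X t).

Let eE t : e t = if D t == 0 then 1 else Num.min ((A * V t) `^ gamma) 1.
Proof. by rewrite /e /edge_pr -/(D t) /A /V [(_ * _ * D t ^+ dim)^-1]invfM mulrA. Qed.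

Let e0 t : 0 <= e t.
Proof. by rewrite eE; case: ifP => // _; rewrite le_min powR_ge0 ler01. Qed.
Let e1 t : e t <= 1.
Proof. by rewrite eE; case: ifP => // _; rewrite ge_min lexx orbT. Qed.

Let e_powR s t : 0 <= s <= gamma -> D t != 0 -> e t <= A `^ s * V t `^ s.
Proof.
move=> /andP[s0 sg] Dt; rewrite eE (negbTE Dt) -(powRM _ (ltW A0) (ltW (V0 Dt))).
have AV0 : 0 < A * V t by rewrite mulr_gt0// V0.
rewrite ge_min; have [h|h] := leP (A * V t) 1.
  by rewrite ger_powR// AV0 h.
rewrite -[X in _ || (X <= _)](powRr0 (A * V t)).
by rewrite [X in _ || X]ler_powR ?orbT// ltW.
Qed.

(** Outside the ball of radius [A ^ (1 / dim)] the connection probability is at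
    most [(A / distance ^ dim) ^ s]; inside this ball it is bounded by [1], which
    also covers the distance [0]. *)
Lemma integral_edge_le (E : set T) (K alpha s : R) :
  measurable E -> 0 <= K -> 0 <= alpha -> alpha < s <= gamma ->
  (forall r, 0 < r -> (P (E `&` [set t | (torus_dist x (X t) < r)%R]) <=
     (K * r `^ (dim%:R * alpha))%:E)%E) ->
  (\int[P]_t (edge_pr tau w0 gamma n wu wv x (X t) * \1_E t)%:E <=
   (K * (1 + dyadic_cst alpha s) * A `^ alpha)%:E)%E.
Proof.
move=> mE K0 a0 /andP[as_ sg] EK.
have s0 : 0 <= s by rewrite (le_trans a0)// ltW.
pose E1 := E `&` [set t | D t < A `^ dim%:R^-1].
pose E2 := E `&` [set t | 0 < V t <= A^-1].
have mE1 : measurable E1 by exact: measurableI.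
have mE2 : measurable E2.
  apply: measurableI => //.
  exact: (measurable_set_oc _ _ mV).
have mI (B : set T) : measurable B -> measurable_fun [set: T] (\1_B : T -> R).
  by move=> mB; exact: measurable_indic.
have mVs : measurable_fun [set: T] (fun t => V t `^ s * \1_E2 t).
  apply: measurable_funM; last exact: mI.
  exact: (measurableT_comp (measurable_powR s) mV).
apply: (@le_trans _ _ (\int[P]_t ((\1_E1 t)%:E + (A `^ s)%:E * (V t `^ s * \1_E2 t)%:E))%E).
  apply: ge0_le_integral => //.
  - by move=> t _; rewrite lee_fin mulr_ge0//; exact: e0.
  - apply/measurable_EFinP; apply: measurable_funM; last exact: mI.
    by apply: measurable_edge_pr => //; exact: measurable_cst.
  - apply: emeasurable_funD; first by apply/measurable_EFinP; exact: mI.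
    by apply: emeasurable_funM => //; apply/measurable_EFinP.
  - move=> t _; rewrite -EFinM -EFinD lee_fin !indicE -/(e t).
    have [/set_mem Et|] := boolP (t \in E); last first.
      by rewrite mulr0 => _; rewrite addr_ge0// !mulr_ge0 ?powR_ge0.
    rewrite mulr1; have [h|h] := ltP (D t) (A `^ dim%:R^-1).
      rewrite mem_set; last by split.
      by rewrite (le_trans (e1 t))// lerDl !mulr_ge0 ?powR_ge0.
    have Dt : D t != 0.
      by rewrite gt_eqF// (lt_le_trans _ h)// powR_gt0.
    have -> : (t \in E1) = false.
      by apply/negbTE/negP => /set_mem[_ /=]; rewrite ltNge h.
    rewrite add0r mem_set ?mulr1; first by rewrite e_powR// s0.
    split => //=; rewrite V0//= lef_pV2 ?posrE ?exprn_gt0//; last first.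
      by rewrite lt_neqAle eq_sym Dt D0.
    by rewrite leNgt -ltroot// -leNgt.
rewrite ge0_integralD; last 5 first.
- exact: measurableT.
- by move=> t _; rewrite lee_fin.
- by apply/measurable_EFinP; exact: mI.
- by move=> t _; rewrite -EFinM lee_fin !mulr_ge0 ?powR_ge0.
- by apply: emeasurable_funM => //; apply/measurable_EFinP.
rewrite integral_indic// setIT ge0_integralZl; last 4 first.
- exact: measurableT.
- by apply/measurable_EFinP.
- by move=> t _; rewrite lee_fin !mulr_ge0 ?powR_ge0.
- by rewrite lee_fin powR_ge0.
have tail := inv_dist_tail mE EK.
have Ai : 0 < A^-1 by rewrite invr_gt0.
have M := moment_below mV mE K0 s0 as_ Ai tail.
apply: (@le_trans _ _ ((K * A `^ alpha)%:E +
    (A `^ s)%:E * (dyadic_cst alpha s * K * A^-1 `^ (s - alpha))%:E)%E).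
  apply: leeD; last by apply: lee_wpmul2l => //; rewrite lee_fin powR_ge0.
  apply: (le_trans (EK _ _)); first by rewrite powR_gt0.
  by rewrite -powRrM mulrA mulVf// mul1r.
rewrite -EFinM -EFinD lee_fin.
have -> : A^-1 `^ (s - alpha) = A `^ (alpha - s).
  by rewrite -(powR_inv1 (ltW A0)) -powRrM mulN1r opprB.
rewrite le_eqVlt; apply/orP; left; apply/eqP.
have -> : A `^ alpha = A `^ s * A `^ (alpha - s).
  rewrite -powRD; first by congr powR; ring.
  by rewrite (gt_eqF A0) implybT.
ring.
Qed.

Lemma integral_edge_far_le (L s : R) : 0 < L -> 1 < s <= gamma ->
  (\int[P]_t (edge_pr tau w0 gamma n wu wv x (X t) *
      \1_[set t | (L < torus_dist x (X t))%R] t)%:E <=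
   (4 ^+ dim * dyadic_cst 1 s * A `^ s * (L ^+ dim) `^ (1 - s))%:E)%E.
Proof.
move=> L0 /andP[s1 sg]; have s0 : 0 <= s by lra.
have Ld0 : 0 < L ^+ dim by rewrite exprn_gt0.
have Li : 0 < (L ^+ dim)^-1 by rewrite invr_gt0.
have tail := inv_dist_tail (@measurableT _ T) pr_torus_ball_le.
have K0 : 0 <= 4 ^+ dim :> R by rewrite exprn_ge0.
have M := moment_below mV measurableT K0 s0 s1 Li tail.
set F := [set t | L < _].
pose E2 := [set: T] `&` [set t | 0 < V t <= (L ^+ dim)^-1].
have mE2 : measurable E2.
  apply: measurableI => //.
  exact: (measurable_set_oc _ _ mV).
have mF : measurable F.
  have -> : F = D @^-1` `]L, +oo[.
    by apply/seteqP; split => t /=; rewrite in_itv/= andbT.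
  by rewrite -[X in measurable X]setTI; exact: mD.
have mI (B : set T) : measurable B -> measurable_fun [set: T] (\1_B : T -> R).
  by move=> mB; exact: measurable_indic.
have mVs : measurable_fun [set: T] (fun t => V t `^ s * \1_E2 t).
  apply: measurable_funM; last exact: mI.
  exact: (measurableT_comp (measurable_powR s) mV).
apply: (@le_trans _ _ (\int[P]_t ((A `^ s)%:E * (V t `^ s * \1_E2 t)%:E))%E).
  apply: ge0_le_integral => //.
  - by move=> t _; rewrite lee_fin mulr_ge0//; exact: e0.
  - apply/measurable_EFinP; apply: measurable_funM; last exact: mI.
    by apply: measurable_edge_pr => //; exact: measurable_cst.
  - by apply: emeasurable_funM => //; apply/measurable_EFinP.
  - move=> t _; rewrite -EFinM lee_fin !indicE -/(e t).
    have [/set_mem Ft|] := boolP (t \in F); last first.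
      by rewrite mulr0 => _; rewrite !mulr_ge0 ?powR_ge0.
    have Dt0 : 0 < D t by rewrite (lt_trans L0).
    have Dt : D t != 0 by rewrite gt_eqF.
    rewrite mulr1 mem_set ?mulr1; first by rewrite e_powR// s0.
    split => //=; rewrite V0//= lef_pV2 ?posrE ?exprn_gt0//.
    by rewrite lerXn2r ?nnegrE// ltW.
rewrite ge0_integralZl; last 4 first.
- exact: measurableT.
- by apply/measurable_EFinP.
- by move=> t _; rewrite lee_fin !mulr_ge0 ?powR_ge0.
- by rewrite lee_fin powR_ge0.
apply: (@le_trans _ _ ((A `^ s)%:E * (dyadic_cst 1 s * 4 ^+ dim * (L ^+ dim)^-1 `^ (s - 1))%:E)%E).
  by apply: lee_wpmul2l => //; rewrite lee_fin powR_ge0.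
rewrite -EFinM lee_fin.
have -> : (L ^+ dim)^-1 `^ (s - 1) = (L ^+ dim) `^ (1 - s).
  by rewrite -(powR_inv1 (ltW Ld0)) -powRrM mulN1r opprB.
by rewrite le_eqVlt; apply/orP; left; apply/eqP; ring.
Qed.

End edge.
End uniform_position.

Lemma pareto_mean_gt0 (R : realType) (tau w0 : R) :
  0 < w0 -> 2 < tau < 3 -> 0 < pareto_mean tau w0.
Proof.
move=> w00 /andP[t2 t3].
by rewrite /pareto_mean mulr_gt0// divr_gt0//; lra.
Qed.

Lemma edge_pr_ge0 (R : realType) (tau w0 gamma : R) n dim (u v : R)
  (x y : dim.-tuple R) : 0 <= edge_pr tau w0 gamma n u v x y.
Proof. by rewrite /edge_pr; case: ifP => // _; rewrite le_min powR_ge0 ler01. Qed.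

Lemma edge_prC (R : realType) (tau w0 gamma : R) n dim (u v : R)
  (x y : dim.-tuple R) :
  edge_pr tau w0 gamma n u v x y = edge_pr tau w0 gamma n v u y x.
Proof. by rewrite /edge_pr torus_distC [u * v]mulrC. Qed.

(** * Connection to a vertex with a random weight and position *)

Section pareto_weight.
Context (R : realType) (disp : measure_display) (T : measurableType disp)
  (P : probability T R) (tau w0 : R) (W : T -> R).
Hypotheses (w0_gt0 : 0 < w0) (tau_gt1 : 1 < tau).
Hypothesis mW : measurable_fun [set: T] W.
Hypothesis W_pareto : forall w, w0 <= w ->
  P [set t | (w < W t)%R] = ((w0 / w) `^ (tau - 1))%:E.

(** The tail bound holds at every positive level, also below [w0] where it is
    larger than [1]. *)
Lemma pareto_tail x : 0 < x ->
  (P ([set: T] `&` [set t | (x < W t)%R]) <=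
   (w0 `^ (tau - 1) * x `^ (- (tau - 1)))%:E)%E.
Proof.
move=> x0; rewrite setTI.
have E : w0 `^ (tau - 1) * x `^ (- (tau - 1)) = (w0 / x) `^ (tau - 1).
  rewrite powRM ?invr_ge0 ?(ltW x0) ?(ltW w0_gt0)//.
  by rewrite -(powR_inv1 (ltW x0)) -powRrM mulN1r.
rewrite E; have [h|h] := leP w0 x; first by rewrite W_pareto.
apply: (@le_trans _ _ 1%E).
  apply: probability_le1.
  exact: (measurable_set_gt _ mW).
have E1 : (1 : R) `^ (tau - 1) = 1 by rewrite powR1.
rewrite lee_fin -[leLHS]E1 ge0_ler_powR ?nnegrE//.
- by rewrite subr_ge0 ltW.
- by rewrite divr_ge0// ltW.
- by rewrite ler_pdivlMr// mul1r ltW.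
Qed.

Lemma pareto_moment_below s v : tau - 1 < s -> 0 < v ->
  (\int[P]_t (W t `^ s * \1_[set t | (0 < W t <= v)%R] t)%:E <=
   (dyadic_cst (tau - 1) s * w0 `^ (tau - 1) * v `^ (s - (tau - 1)))%:E)%E.
Proof.
move=> ts v0.
have s0 : 0 <= s by rewrite (le_trans _ (ltW ts))// subr_ge0 ltW.
rewrite -[X in \1_X](setTI [set t | 0 < W t <= v]).
by apply: moment_below => //; [exact: powR_ge0|exact: pareto_tail].
Qed.

Lemma pareto_moment_above s v : 0 <= s < tau - 1 -> 0 < v ->
  (\int[P]_t (W t `^ s * \1_[set t | (v <= W t)%R] t)%:E <=
   (dyadic_cst (tau - 1) s * w0 `^ (tau - 1) * v `^ (s - (tau - 1)))%:E)%E.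
Proof.
move=> /andP[s0 ts] v0.
rewrite -[X in \1_X](setTI [set t | v <= W t]).
by apply: moment_above => //; [exact: powR_ge0|exact: pareto_tail].
Qed.

End pareto_weight.

Section random_vertex.
Context (R : realType) (disp : measure_display) (T : measurableType disp)
  (P : probability T R) (tau w0 gamma : R) (n dim : nat)
  (W : T -> R) (X : T -> dim.-tuple R).
Hypotheses (w0_gt0 : 0 < w0) (tau23 : 2 < tau < 3) (gamma_gt1 : 1 < gamma)
  (dim_gt0 : (0 < dim)%N) (n_gt0 : (0 < n)%N).
Hypothesis mW : measurable_fun [set: T] W.
Hypothesis mX : measurable_fun [set: T] X.
Hypothesis W_pareto : forall w, w0 <= w ->
  P [set t | (w < W t)%R] = ((w0 / w) `^ (tau - 1))%:E.
Hypothesis X_uniform : forall B : 'I_dim -> set R, (forall h, measurable (B h)) ->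
  P [set t | forall h, B h (tnth (X t) h)] =
  (\prod_(h < dim) fine (lebesgue_measure (B h `&` `[0, 1[)))%:E.
Hypothesis WX_indep : forall A B, measurable A -> measurable B ->
  P (W @^-1` A `&` X @^-1` B) = (P (W @^-1` A) * P (X @^-1` B))%E.

Let S := (R * dim.-tuple R)%type.
Let M : R := n%:R * pareto_mean tau w0.

Let mean_gt0 : 0 < pareto_mean tau w0.
Proof. exact: pareto_mean_gt0. Qed.

Let M0 : 0 < M. Proof. by rewrite mulr_gt0// ltr0n. Qed.

Let tau_gt1 : 1 < tau. Proof. by move: tau23 => /andP[? ?]; lra. Qed.

Variables (w : R) (x : dim.-tuple R).
Hypotheses (ww0 : w0 < w) (x01 : forall h, 0 <= tnth x h < 1).

Let w_gt0 : 0 < w. Proof. exact: lt_trans ww0. Qed.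

Let ep (z : S) := edge_pr tau w0 gamma n w z.1 x z.2.

Let mep : measurable_fun [set: S] ep.
Proof.
by apply: measurable_edge_pr => //; exact: measurable_cst.
Qed.

(** From a bound for the integral over the position, for each weight above [v],
    to a bound for the integral over weight and position. *)
Lemma integral_vertex_le (E : set S) (v s c : R) :
  measurable E -> 0 < v -> 0 <= c -> 0 <= s < tau - 1 ->
  (forall w', v <= w' ->
    (\int[P]_t (edge_pr tau w0 gamma n w w' x (X t) * \1_E (w', X t))%:E <=
     (c * w' `^ s)%:E)%E) ->
  (\int[P]_t (edge_pr tau w0 gamma n w (W t) x (X t) *
      \1_([set z | (v <= z.1)%R] `&` E) (W t, X t))%:E <=
   (c * (dyadic_cst (tau - 1) s * w0 `^ (tau - 1) * v `^ (s - (tau - 1))))%:E)%E.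
Proof.
move=> mE v0 c0 s1 H.
pose F (z : S) := ep z * \1_([set z : S | v <= z.1] `&` E) z.
have mv : measurable [set z : S | v <= z.1].
  exact: (measurable_set_ge _ measurable_fst).
have mF : measurable_fun [set: S] F.
  apply: measurable_funM => //; apply: measurable_indic; exact: measurableI.
have mIE : measurable_fun [set: S] (\1_E : S -> R) by exact: measurable_indic.
have F0 z : 0 <= F z by rewrite mulr_ge0// edge_pr_ge0.
have mFE : measurable_fun [set: S] (EFin \o F) by apply/measurable_EFinP.
have F0E z : (0 <= (EFin \o F) z)%E by rewrite /= lee_fin.
have -> : (\int[P]_t (edge_pr tau w0 gamma n w (W t) x (X t) *
      \1_([set z | (v <= z.1)%R] `&` E) (W t, X t))%:E =
   \int[P]_t (EFin \o F) (W t, X t))%E by [].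
rewrite (integral_indep_copy mW mX WX_indep mFE F0E).
have mvW : measurable [set t | v <= W t].
  exact: (measurable_set_ge _ mW).
have mWs : measurable_fun [set: T] (fun t => (W t `^ s * \1_[set t | v <= W t] t)%:E).
  apply/measurable_EFinP; apply: measurable_funM; last exact: measurable_indic.
  exact: (measurableT_comp (measurable_powR s) mW).
have Ws0 t : (0 <= (W t `^ s * \1_[set t | (v <= W t)%R] t)%:E)%E.
  by rewrite lee_fin mulr_ge0 ?powR_ge0.
apply: (@le_trans _ _ (\int[P]_t (c%:E * (W t `^ s * \1_[set t | (v <= W t)%R] t)%:E))%E).
  apply: ge0_le_integral => //.
  - by move=> t _; apply: integral_ge0 => s' _; exact: F0E.
  - exact: (measurable_integral_copy P mW mX mFE F0E).
  - by apply: emeasurable_funM => //; exact: measurable_cst.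
  - move=> t _; rewrite -EFinM indicE; have [/set_mem/= vW|vW] := boolP (t \in _).
      rewrite mulr1; apply: le_trans (H _ vW); apply: ge0_le_integral => //=.
      + by move=> t' _; rewrite lee_fin.
      + apply/measurable_EFinP; apply: (measurableT_comp mF).
        exact: measurable_fun_pair.
      + apply/measurable_EFinP; apply: measurable_funM.
          by apply: measurable_edge_pr => //; exact: measurable_cst.
        apply: (measurableT_comp mIE).
        exact: measurable_fun_pair.
      + move=> t' _; rewrite lee_fin ler_wpM2l ?edge_pr_ge0//.
        by rewrite indicI/= ler_piMl// indicE lern1 leq_b1.
    rewrite !mulr0 integral0_eq// => t' _ /=.
    rewrite /F indicE memNset ?mulr0// => -[/= h _]; move: vW.
    by rewrite mem_set.
rewrite ge0_integralZl; last 4 first.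
- exact: measurableT.
- exact: mWs.
- by move=> t _; exact: Ws0.
- by rewrite lee_fin.
rewrite [leRHS]EFinM; apply: lee_wpmul2l; first by rewrite lee_fin.
exact: pareto_moment_above.
Qed.

(** The constant in the bound [edge_cst * w * w' / M] for the probability of an
    edge between vertices of weights [w] and [w']. *)
Definition edge_cst : R := 4 ^+ dim * (1 + dyadic_cst 1 gamma).

Let tau2 : 0 <= (1 : R) < tau - 1.
Proof. by move: tau23 => /andP[? ?]; rewrite ler01/=; lra. Qed.

Lemma integral_vertex_ge_le (v : R) : 0 < v ->
  (\int[P]_t (edge_pr tau w0 gamma n w (W t) x (X t) *
      \1_[set z : S | (v <= z.1)%R] (W t, X t))%:E <=
   (edge_cst / M * w * (dyadic_cst (tau - 1) 1 * w0 `^ (tau - 1) *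
      v `^ (1 - (tau - 1))))%:E)%E.
Proof.
move=> v0; rewrite -[X in \1_X]setIT.
have dc : 0 < dyadic_cst 1 gamma by rewrite dyadic_cst_gt0// gt_eqF.
have ec : 0 <= edge_cst.
  by rewrite mulr_ge0// ?exprn_ge0//; lra.
apply: integral_vertex_le => //.
  by rewrite mulr_ge0 ?(ltW w_gt0)// divr_ge0// ltW.
move=> w' vw'; have w'0 : 0 < w' by exact: lt_le_trans vw'.
have A0 : 0 < w * w' / M by rewrite divr_gt0// mulr_gt0.
have K0 : 0 <= 4 ^+ dim :> R by rewrite exprn_ge0.
have sg : 1 < gamma <= gamma by rewrite gamma_gt1 lexx.
have H := integral_edge_le dim_gt0 mX A0 (@measurableT _ T) K0 ler01 sg
  (pr_torus_ball_le mX X_uniform x01).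
rewrite (eq_integral (fun t => (edge_pr tau w0 gamma n w w' x (X t) *
    \1_[set: T] t)%:E)); last by move=> t _; rewrite !indicT.
apply: (le_trans H).
rewrite lee_fin (powRr1 (ltW A0)) (powRr1 (ltW w'0)) /edge_cst.
by rewrite le_eqVlt; apply/orP; left; apply/eqP; ring.
Qed.

(** The constant of the corresponding bound for edges between vertices that are
    close in one direction.  The exponent [1 - 1 / dim] of [w * w'] is raised to
    [1], which costs a power of [w0 * w0 <= w * w']. *)
Definition near_cst : R :=
  4 ^+ dim * (1 + dyadic_cst (dim.-1%:R / dim%:R) gamma) *
  (w0 * w0) `^ (- dim%:R^-1).

Lemma integral_vertex_near_le (h0 : 'I_dim) (c eps : R) :
  0 <= c < 1 -> 0 <= eps ->
  (\int[P]_t (edge_pr tau w0 gamma n w (W t) x (X t) *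
      \1_([set z : S | (w <= z.1)%R] `&`
          [set z : S | (circle_dist c (tnth z.2 h0) <=
            eps * (n%:R * pareto_mean tau w0) `^ (- dim%:R^-1))%R]) (W t, X t))%:E <=
   (near_cst * eps / M * w * (dyadic_cst (tau - 1) 1 * w0 `^ (tau - 1) *
      w `^ (1 - (tau - 1))))%:E)%E.
Proof.
move=> c01 eps0; rewrite -/M.
have dn0 : dim%:R != 0 :> R by rewrite pnatr_eq0 -lt0n.
have d0 : 0 < dim%:R :> R by rewrite ltr0n.
set al : R := dim.-1%:R / dim%:R.
have alE : al = 1 - dim%:R^-1.
  by rewrite /al -subn1 natrB// mulrBl divff// mul1r.
have al0 : 0 <= al by rewrite divr_ge0// ler0n.
have al1 : al < 1 by rewrite alE gtrBl invr_gt0.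
have dc : 0 < dyadic_cst al gamma.
  by rewrite dyadic_cst_gt0// gt_eqF// (lt_trans al1).
have nc : 0 <= near_cst.
  rewrite /near_cst -/al !mulr_ge0 ?exprn_ge0 ?powR_ge0//; lra.
pose delta := eps * M `^ (- dim%:R^-1).
have delta0 : 0 <= delta by rewrite mulr_ge0 ?powR_ge0.
apply: integral_vertex_le => //.
- have -> : [set z : S | circle_dist c (tnth z.2 h0) <= delta] =
      (fun z : S => tnth z.2 h0) @^-1` [set y | circle_dist c y <= delta] by [].
  rewrite -[X in measurable X]setTI.
  have m2 : measurable_fun [set: S] (fun z : S => tnth z.2 h0).
    exact: (measurableT_comp (measurable_tnth h0) measurable_snd).
  by apply: m2 => //; exact: measurable_circle_ball.
- by apply: mulr_ge0; [apply: divr_ge0; [exact: mulr_ge0|exact: ltW]|exact: ltW].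
move=> w' ww'; have w'0 : 0 < w' by exact: lt_le_trans ww'.
have A0 : 0 < w * w' / M by rewrite divr_gt0// mulr_gt0.
have K0 : 0 <= 4 ^+ dim * delta by rewrite mulr_ge0// exprn_ge0.
have sg : al < gamma <= gamma by rewrite lexx andbT (lt_trans al1).
have mN : measurable [set t | circle_dist c (tnth (X t) h0) <= delta].
  have -> : [set t | circle_dist c (tnth (X t) h0) <= delta] =
      (fun t => tnth (X t) h0) @^-1` [set y | circle_dist c y <= delta] by [].
  rewrite -[X in measurable X]setTI.
  apply: (measurableT_comp (measurable_tnth h0) mX) => //.
  exact: measurable_circle_ball.
have H := integral_edge_le dim_gt0 mX A0 mN K0 al0 sg
  (fun r r0 => pr_torus_ball_slab_le dim_gt0 mX X_uniform x01 h0 c01 delta0 r0).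
apply: (le_trans H).
rewrite lee_fin (powRr1 (ltW w'0)) /near_cst -/al.
have ww0' : w0 * w0 <= w * w' by rewrite ler_pM// ltW// (lt_le_trans ww0).
have w00 : 0 < w0 * w0 by rewrite mulr_gt0.
have ww : 0 < w * w' by rewrite mulr_gt0.
have -> : (w * w' / M) `^ al = (w * w') * (w * w') `^ (- dim%:R^-1) *
    M `^ (dim%:R^-1) / M.
  rewrite powRM ?invr_ge0 ?(ltW ww) ?(ltW M0)// alE powRD; last first.
    by rewrite (gt_eqF ww) implybT.
  rewrite powRr1 ?(ltW ww)// -!mulrA; congr (_ * (_ * _)).
  rewrite -(powR_inv1 (ltW M0)) -powRrM mulN1r opprB powRD; last first.
    by rewrite (gt_eqF M0) implybT.
  by rewrite powR_inv1// ltW.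
rewrite /delta powRN.
have Md : M `^ dim%:R^-1 != 0 by rewrite gt_eqF// powR_gt0.
have -> : 4 ^+ dim * (eps / M `^ dim%:R^-1) * (1 + dyadic_cst al gamma) *
   (w * w' * (w * w') `^ (- dim%:R^-1) * M `^ dim%:R^-1 / M) =
   4 ^+ dim * (1 + dyadic_cst al gamma) * (eps / M * w * w') *
     (w * w') `^ (- dim%:R^-1).
  by field; rewrite Md gt_eqF.
have -> : 4 ^+ dim * (1 + dyadic_cst al gamma) * (w0 * w0) `^ (- dim%:R^-1) *
     eps / M * w * w' =
   4 ^+ dim * (1 + dyadic_cst al gamma) * (eps / M * w * w') *
     (w0 * w0) `^ (- dim%:R^-1) by ring.
apply: ler_wpM2l.
  rewrite !mulr_ge0 ?exprn_ge0 ?invr_ge0 ?(ltW M0) ?(ltW w_gt0) ?(ltW w'0)//; lra.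
rewrite !powRN lef_pV2 ?posrE ?powR_gt0//.
by rewrite ge0_ler_powR// ?nnegrE ?(ltW ww) ?(ltW w00)// invr_ge0 ltW.
Qed.

Lemma integral_vertex_far_le (l s : R) : 0 < l -> 1 < s <= gamma -> s < tau - 1 ->
  (\int[P]_t (edge_pr tau w0 gamma n w (W t) x (X t) *
      \1_([set z : S | (w <= z.1)%R] `&`
          [set z : S | (l * (n%:R * pareto_mean tau w0) `^ (- dim%:R^-1) <
             torus_dist x z.2)%R]) (W t, X t))%:E <=
   (4 ^+ dim * dyadic_cst 1 s * (l ^+ dim) `^ (1 - s) / M * w `^ s *
      (dyadic_cst (tau - 1) s * w0 `^ (tau - 1) *
      w `^ (s - (tau - 1))))%:E)%E.
Proof.
move=> l0 s1 st; rewrite -/M.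
have dn0 : dim%:R != 0 :> R by rewrite pnatr_eq0 -lt0n.
have s0 : 0 <= s by move: s1 => /andP[? ?]; lra.
have dc : 0 < dyadic_cst 1 s.
  by rewrite dyadic_cst_gt0//; move: s1 => /andP[? _]; rewrite gt_eqF.
pose L := l * M `^ (- dim%:R^-1).
have L0 : 0 < L by rewrite mulr_gt0// powR_gt0.
have LE : L ^+ dim = l ^+ dim / M.
  rewrite /L exprMn -[X in _ * X](powR_mulrn _ (powR_ge0 _ _)) -powRrM mulNr mulVf//.
  by rewrite powR_inv1// ltW.
apply: integral_vertex_le => //.
- have m2 : measurable_fun [set: S] (fun z : S => torus_dist x z.2).
    by apply: measurable_torus_dist => //; exact: measurable_cst.
  exact: (measurable_set_gt _ m2).
- apply: mulr_ge0; last exact: powR_ge0.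
  apply: divr_ge0; last exact: ltW.
  apply: mulr_ge0; last exact: powR_ge0.
  by apply: mulr_ge0; [exact: exprn_ge0|exact: ltW].
- by rewrite s0.
move=> w' ww'; have w'0 : 0 < w' by exact: lt_le_trans ww'.
have A0 : 0 < w * w' / M by rewrite divr_gt0// mulr_gt0.
have H := integral_edge_far_le dim_gt0 mX X_uniform x01 A0 L0 s1.
apply: (le_trans H); rewrite lee_fin LE.
have ld : 0 < l ^+ dim by rewrite exprn_gt0.
rewrite le_eqVlt; apply/orP; left; apply/eqP.
rewrite (powRM _ (ltW (mulr_gt0 w_gt0 w'0))) ?invr_ge0 ?(ltW M0)//.
rewrite (powRM _ (ltW w_gt0) (ltW w'0)) (powRM _ (ltW ld)) ?invr_ge0 ?(ltW M0)//.
have -> : 4 ^+ dim * dyadic_cst 1 s * (w `^ s * w' `^ s * M^-1 `^ s) *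
    ((l ^+ dim) `^ (1 - s) * M^-1 `^ (1 - s)) =
  4 ^+ dim * dyadic_cst 1 s * (l ^+ dim) `^ (1 - s) * (M^-1 `^ s * M^-1 `^ (1 - s)) *
   w `^ s * w' `^ s by ring.
rewrite -powRD; last by rewrite invr_eq0 (gt_eqF M0) implybT.
rewrite (_ : s + (1 - s) = 1); last by ring.
by rewrite powRr1 ?invr_ge0 ?(ltW M0).
Qed.

End random_vertex.

(** * Weights and positions of the vertices of a list *)

Section girg_vertices.
Context (R : realType) (disp : measure_display) (T : measurableType disp)
  (P : probability T R) (tau w0 gamma : R) (n dim : nat)
  (G : girg P tau w0 gamma n dim) (k : nat) (v : k.-tuple 'I_n).

Local Notation S := (R * dim.-tuple R)%type.
Local Notation W i := (weight G (tnth v i)).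
Local Notation X i := (pos G (tnth v i)).
Local Notation VS := (vertex_sigma (weight G) (pos G)).

(** The weights and positions of the vertices of the list [v]. *)
Definition marks (t : T) : k.-tuple S := [tuple (W i t, X i t) | i < k].

Lemma tnth_marks t i : tnth (marks t) i = (W i t, X i t).
Proof. by rewrite tnth_mktuple. Qed.

Lemma vertex_sigma_sigma_algebra i : sigma_algebra setT (VS i).
Proof.
by case: i => u; apply: sigma_algebra_preimage; exact: sigma_algebra_measurable.
Qed.

Lemma vertex_sigma_measurable i : VS i `<=` measurable.
Proof.
case: i => u _ [B mB <-].
- exact: (measurable_funPT (weight G u)).
- exact: (measurable_funPT (pos G u)).
Qed.

Lemma vertices_sigma_measurable (B : set T) :
  vertices_sigma (weight G) (pos G) B -> measurable B.
Proof.
apply: smallest_sub; first exact: sigma_algebra_measurable.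
by move=> B' [i _]; exact: vertex_sigma_measurable.
Qed.

(** A random tuple, each coordinate of which is constant or consists of a weight
    and a position with indices in [D], is measurable for the sigma-algebra of
    [D]. *)
Lemma measurable_coordinates (D : set ('I_n + 'I_n)) (f : T -> k.-tuple S) :
  (forall i, (exists z, forall t, tnth (f t) i = z) \/
     [/\ D (inl (tnth v i)), D (inr (tnth v i)) &
         forall t, tnth (f t) i = (W i t, X i t)]) ->
  forall A, measurable A -> <<s \bigcup_(i in D) VS i >> (f @^-1` A).
Proof.
move=> fD A mA.
pose TD := g_sigma_algebraType (\bigcup_(i in D) VS i).
suff : measurable_fun [set: TD] (f : TD -> k.-tuple S).
  by move=> /(_ measurableT _ mA); rewrite setTI.
apply/measurable_fun_tnthP => i.
case: (fD i) => [[z fz]|[Dl Dr fi]].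
  rewrite (_ : _ \o _ = cst z); first exact: measurable_cst.
  exact/funext.
rewrite (_ : _ \o _ = fun t => (W i t, X i t)); last exact/funext.
apply: measurable_fun_pair => _ B mB; rewrite setTI;
  apply: sub_sigma_algebra.
- by exists (inl (tnth v i)) => //; exists B => //; rewrite setTI.
- by exists (inr (tnth v i)) => //; exists B => //; rewrite setTI.
Qed.

Lemma vertices_sigma_marks (A : set (k.-tuple S)) : measurable A ->
  vertices_sigma (weight G) (pos G) (marks @^-1` A).
Proof.
apply: (measurable_coordinates (D := setT)) => i; right; split => // t.
exact: tnth_marks.
Qed.

Lemma measurable_marks : measurable_fun [set: T] marks.
Proof.
apply/measurable_fun_tnthP => i.
rewrite (_ : _ \o _ = fun t => (W i t, X i t)).
  by apply: measurable_fun_pair; exact: measurable_funPT.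
by apply/funext => t /=; rewrite tnth_marks.
Qed.

Lemma weight_pos_indep (u : 'I_n) (A : set R) (B : set (dim.-tuple R)) :
  measurable A -> measurable B ->
  P (weight G u @^-1` A `&` pos G u @^-1` B) =
  (P (weight G u @^-1` A) * P (pos G u @^-1` B))%E.
Proof.
move=> mA mB.
apply: (@mutually_independent_blocks _ _ _ _ _ VS [set inl u]%SET
  [set inr u]%SET _ _ vertex_sigma_sigma_algebra vertex_sigma_measurable
  (@girg_independent _ _ _ _ _ _ _ _ _ G)).
- by move=> i; rewrite !inE => /eqP ->.
- apply: sub_sigma_algebra; exists (inl u); first by rewrite /= inE.
  by exists A => //; rewrite setTI.
- apply: sub_sigma_algebra; exists (inr u); first by rewrite /= inE.
  by exists B => //; rewrite setTI.
Qed.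

Lemma measurable_clique : measurable (clique G v).
Proof.
have -> : clique G v = [set t | forall p : 'I_k * 'I_k, p.1 != p.2 ->
    [set t | adj G t (tnth v p.1) (tnth v p.2)] t].
  by apply/seteqP; split => t /= h; [move=> [i j]|move=> i j; apply: (h (i, j))]; exact: h.
by apply: measurable_forall => p _; exact: measurable_adj.
Qed.

Hypothesis v_uniq : uniq v.

Lemma marks_indep (j : 'I_k) (A : set (k.-tuple S)) (B : set S) :
  measurable A -> measurable B ->
  P ((fun t => upd j (marks t) point) @^-1` A `&`
     (fun t => tnth (marks t) j) @^-1` B) =
  (P ((fun t => upd j (marks t) point) @^-1` A) *
   P ((fun t => tnth (marks t) j) @^-1` B))%E.
Proof.
move=> mA mB.
pose J2 : {set 'I_n + 'I_n} := [set inl (tnth v j); inr (tnth v j)]%SET.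
apply: (@mutually_independent_blocks _ _ _ _ _ VS (~: J2)%SET J2 _ _
  vertex_sigma_sigma_algebra vertex_sigma_measurable
  (@girg_independent _ _ _ _ _ _ _ _ _ G)).
- by move=> i; rewrite inE.
- apply: (@measurable_coordinates _ (fun t => upd j (marks t) point)) => // i.
  have [->|ij] := eqVneq i j.
    by left; eexists => t; rewrite tnth_upd eqxx; reflexivity.
  right; have vij : tnth v i != tnth v j.
    by apply: contra ij => /eqP /tuple_uniqP; move/(_ v_uniq) => ->.
  split; rewrite /= ?inE ?negb_or.
  + by rewrite -[_ == _]/(tnth v i == tnth v j) vij.
  + by rewrite andTb -[_ == _]/(tnth v i == tnth v j) vij.
  + by move=> t; rewrite tnth_upd (negbTE ij) tnth_marks.
- pose A' : set (k.-tuple S) := (fun u => tnth u j) @^-1` B.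
  have mA' : measurable A'.
    by rewrite -[Y in measurable Y]setTI; exact: measurable_tnth.
  have -> : (fun t => tnth (marks t) j) @^-1` B =
    (fun t => [tuple (if i == j then (W i t, X i t) else point) | i < k]) @^-1` A'.
    by apply/seteqP; split => t; rewrite /A'/= tnth_mktuple eqxx tnth_marks.
  apply: measurable_coordinates => // i; have [->|ij] := eqVneq i j.
    right; split; rewrite /= ?inE ?eqxx ?orbT//.
    by move=> t; rewrite tnth_mktuple eqxx.
  by left; eexists => t; rewrite tnth_mktuple (negbTE ij); reflexivity.
Qed.

(* the encoding of an unordered pair as an increasing pair *)
Let pr (a b : 'I_n) := if (a < b)%N then (a, b) else (b, a).

Let E (a b : 'I_n) t := edge_pr tau w0 gamma n (weight G a t) (weight G b t)
  (pos G a t) (pos G b t).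

(** A clique contains the star at [m], and the edges of this star are
    conditionally independent given the weights and positions. *)
Lemma clique_star_le (m : 'I_k) (A : set T) :
  vertices_sigma (weight G) (pos G) A ->
  (P (A `&` clique G v) <= \int[P]_(t in A)
     (\prod_(j < k | j != m) edge_pr tau w0 gamma n (W m t) (W j t) (X m t) (X j t))%:E)%E.
Proof.
move=> sA.
pose F (j : 'I_k) := pr (tnth v m) (tnth v j).
pose St : {set 'I_n * 'I_n} := [set F j | j in [set~ m]]%SET.
have vI i j : i != j -> tnth v i != tnth v j.
  by apply: contra => /eqP /tuple_uniqP; move/(_ v_uniq) => ->.
have Stlt e : e \in St -> (e.1 < e.2)%N.
  move=> /imsetP[j]; rewrite !inE => jm ->; rewrite /F /pr.
  case: ifPn => //=; rewrite -leqNgt leq_eqVlt => /orP[/eqP/val_inj h|//].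
  by move: (vI _ _ jm); rewrite h eqxx.
have [_ _ H] := girg_edges G Stlt.
have -> : (\int[P]_(t in A) (\prod_(j < k | j != m)
     edge_pr tau w0 gamma n (W m t) (W j t) (X m t) (X j t))%:E =
   \int[P]_(t in A) (\prod_(e in St) E e.1 e.2 t)%:E)%E.
  apply: eq_integral => t _; rewrite /St big_imset/=.
    congr EFin; apply: eq_big => j; first by rewrite !inE.
    move=> jm; rewrite /F /pr /E; case: ifP => //= _.
    by rewrite edge_prC.
  move=> i j; rewrite !inE => im jm; rewrite /F /pr.
  case: ifP => h1; case: ifP => h2 [].
  - by move=> /tuple_uniqP; exact.
  - by move=> h; have := vI _ _ jm; rewrite h eqxx.
  - by move=> _ h; have := vI _ _ jm; rewrite -h eqxx.
  - by move=> /tuple_uniqP; exact.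
rewrite -H//; apply: le_measure; rewrite ?inE.
- apply: measurableI; first exact: vertices_sigma_measurable.
  exact: measurable_clique.
- apply: measurableI; first exact: vertices_sigma_measurable.
  by apply: measurable_forall => e _; exact: measurable_adj.
- move=> t [At ct]; split => // e /imsetP[j]; rewrite !inE => jm ->.
  rewrite /F /pr; case: ifP => _ /=; last rewrite adj_sym.
    by apply: ct; rewrite eq_sym.
  by apply: ct; rewrite eq_sym.
Qed.

(** An event on which all connection probabilities are [1] is almost surely
    contained in the clique event. *)
Lemma clique_ge (A : set T) :
  vertices_sigma (weight G) (pos G) A ->
  (forall t i j, A t -> edge_pr tau w0 gamma n (W i t) (W j t) (X i t) (X j t) = 1) ->
  (P A <= P (clique G v))%E.
Proof.
move=> sA A1.
pose St : {set 'I_n * 'I_n} :=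
  [set e : 'I_n * 'I_n | [&& (e.1 < e.2)%N, e.1 \in v & e.2 \in v]]%SET.
have Stlt e : e \in St -> (e.1 < e.2)%N by rewrite inE => /and3P[].
have [_ _ H] := girg_edges G Stlt.
have -> : P A = (\int[P]_(t in A) (\prod_(e in St) E e.1 e.2 t)%:E)%E.
  rewrite (eq_integral (cst 1%E)); first by rewrite integral_cst ?mul1e//; exact: vertices_sigma_measurable.
  move=> t /set_mem At; congr EFin; rewrite big1// => e; rewrite inE.
  by move=> /and3P[_ /tnthP[i ->] /tnthP[j ->]]; exact: A1.
rewrite -H//; apply: le_measure; rewrite ?inE.
- apply: measurableI; first exact: vertices_sigma_measurable.
  by apply: measurable_forall => e _; exact: measurable_adj.
- exact: measurable_clique.
- move=> t [At ct] i j ij.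
  have vij : tnth v i != tnth v j.
    by apply: contra ij => /eqP /tuple_uniqP; move/(_ v_uniq) => ->.
  move: vij; rewrite neq_ltn => /orP[h|h].
    by apply: (ct (tnth v i, tnth v j)); rewrite inE h !mem_tnth.
  rewrite adj_sym.
  by apply: (ct (tnth v j, tnth v i)); rewrite inE h !mem_tnth.
Qed.

End girg_vertices.

(** * The star of the vertex of smallest weight *)

(** The constant in the bound [star_cst * w ^ (3 - tau) / M] for an edge to a
    vertex of weight at least [w]. *)
Definition star_cst {R : realType} (tau w0 gamma : R) (dim : nat) : R :=
  edge_cst gamma dim * dyadic_cst (tau - 1) 1 * w0 `^ (tau - 1).

Section star.
Context (R : realType) (disp : measure_display) (T : measurableType disp)
  (P : probability T R) (tau w0 gamma : R) (n dim : nat)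
  (G : girg P tau w0 gamma n dim) (k : nat) (v : k.-tuple 'I_n).
Hypotheses (w0_gt0 : 0 < w0) (tau23 : 2 < tau < 3) (gamma_gt1 : 1 < gamma)
  (dim_gt0 : (0 < dim)%N) (n_gt0 : (0 < n)%N) (v_uniq : uniq v).

Local Notation S := (R * dim.-tuple R)%type.
Local Notation W i := (weight G (tnth v i)).
Local Notation X i := (pos G (tnth v i)).
Local Notation Zt := (marks G v).
Let M : R := n%:R * pareto_mean tau w0.

(** The probability of an edge from the centre [z.1] of the star to [z.2],
    restricted to the case where the centre has the smaller weight and this
    weight exceeds [w0]. *)
Definition star_edge (z : S * S) : R :=
  edge_pr tau w0 gamma n z.1.1 z.2.1 z.1.2 z.2.2 *
  \1_[set z : S * S | w0 < z.1.1 <= z.2.1] z.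

Lemma star_edge_ge0 z : 0 <= star_edge z.
Proof. by rewrite mulr_ge0// edge_pr_ge0. Qed.

Lemma measurable_star_edge : measurable_fun [set: S * S] star_edge.
Proof.
have m11 : measurable_fun [set: S * S] (fun z : S * S => z.1.1).
  exact: (measurableT_comp measurable_fst measurable_fst).
have m12 : measurable_fun [set: S * S] (fun z : S * S => z.1.2).
  exact: (measurableT_comp measurable_snd measurable_fst).
have m21 : measurable_fun [set: S * S] (fun z : S * S => z.2.1).
  exact: (measurableT_comp measurable_fst measurable_snd).
have m22 : measurable_fun [set: S * S] (fun z : S * S => z.2.2).
  exact: (measurableT_comp measurable_snd measurable_snd).
apply: measurable_funM; first exact: measurable_edge_pr.
apply: measurable_indic.
have mb : measurable_fun [set: S * S] (fun z : S * S => w0 < z.1.1 <= z.2.1).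
  apply: measurable_and; first by apply: measurable_fun_ltr => //; exact: measurable_cst.
  exact: measurable_fun_ler.
have -> : [set z : S * S | w0 < z.1.1 <= z.2.1] =
    (fun z : S * S => w0 < z.1.1 <= z.2.1) @^-1` [set true].
  by [].
by rewrite -[Y in measurable Y]setTI; exact: mb.
Qed.

Let pos01 t i h : 0 <= tnth (X i t) h < 1.
Proof. exact: pos_torus. Qed.

Let mW i : measurable_fun [set: T] (W i). Proof. exact: measurable_funPT. Qed.
Let mX i : measurable_fun [set: T] (X i). Proof. exact: measurable_funPT. Qed.

Let mean_gt0 : 0 < pareto_mean tau w0.
Proof. exact: pareto_mean_gt0. Qed.

Let M0 : 0 < M. Proof. by rewrite mulr_gt0// ltr0n. Qed.

Lemma star_cst_gt0 : 0 < star_cst tau w0 gamma dim.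
Proof.
move: tau23 => /andP[t2 t3].
apply: mulr_gt0; last exact: powR_gt0.
apply: mulr_gt0; last by apply: dyadic_cst_gt0; rewrite lt_eqF//; lra.
apply: mulr_gt0; first exact: exprn_gt0.
by rewrite addr_gt0// dyadic_cst_gt0// gt_eqF.
Qed.

Lemma integral_star_edge_le (m j : 'I_k) t :
  (\int[P]_s (star_edge (tnth (Zt t) m, tnth (Zt s) j))%:E <=
   (star_cst tau w0 gamma dim / M * (W m t) `^ (3 - tau) *
    \1_[set w | w0 < w] (W m t))%:E)%E.
Proof.
have [h|h] := ltP w0 (W m t); last first.
  rewrite integral0_eq; last first.
    move=> s _; rewrite tnth_marks /star_edge indicE memNset ?mulr0//=.
    by rewrite ltNge h.
  rewrite lee_fin mulr_ge0// mulr_ge0 ?powR_ge0//.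
  by rewrite divr_ge0// ltW// star_cst_gt0.
have wm0 : 0 < W m t by exact: lt_trans h.
rewrite [\1_[set w | w0 < w] _]indicE mem_set// mulr1.
have H := integral_vertex_ge_le w0_gt0 tau23 gamma_gt1 dim_gt0 n_gt0
  (mW j) (mX j) (@weight_pareto _ _ _ _ _ _ _ _ _ G (tnth v j))
  (@pos_uniform _ _ _ _ _ _ _ _ _ G (tnth v j))
  (weight_pos_indep G (tnth v j)) h (fun i => pos01 t m i) wm0.
apply: le_trans (le_trans H _).
  rewrite le_eqVlt; apply/orP; left; apply/eqP/eq_integral => s _.
  rewrite !tnth_marks /star_edge/=; congr (_ * _)%:E.
  rewrite !indicE; congr (nat_of_bool _)%:R.
  by apply/idP/idP => /set_mem /= hh; apply/mem_set => /=; move: hh; rewrite h.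
rewrite lee_fin le_eqVlt; apply/orP; left; apply/eqP.
have -> : W m t `^ (3 - tau) = W m t * W m t `^ (1 - (tau - 1)).
  have -> : 3 - tau = 1 + (1 - (tau - 1)) by ring.
  rewrite powRD; last by rewrite (gt_eqF wm0) implybT.
  by rewrite (powRr1 (ltW wm0)).
by rewrite /star_cst /M; ring.
Qed.

(** The vertex [m] has the smallest weight, this weight exceeds [w0] and lies in
    [B], and the weights and positions satisfy [Ex]. *)
Definition star_event (m : 'I_k) (B : set R) (Ex : set (k.-tuple S)) : set T :=
  [set t | [/\ B (W m t), w0 < W m t, forall j, W m t <= W j t & Ex (Zt t)]].

Let mcoord i : measurable_fun [set: k.-tuple S] (fun u : k.-tuple S => (tnth u i).1).
Proof. exact: (measurableT_comp measurable_fst (measurable_tnth i)). Qed.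

Let mgt : measurable [set w : R | w0 < w].
Proof.
exact: (measurable_set_gt _ (@measurable_id _ _ _)).
Qed.

Lemma star_event_sigma (m : 'I_k) (B : set R) (Ex : set (k.-tuple S)) :
  measurable B -> measurable Ex ->
  vertices_sigma (weight G) (pos G) (star_event m B Ex).
Proof.
move=> mB mEx.
pose A' : set (k.-tuple S) := [set u | [/\ B (tnth u m).1, w0 < (tnth u m).1,
   forall j, (tnth u m).1 <= (tnth u j).1 & Ex u]].
have -> : star_event m B Ex = Zt @^-1` A'.
  by apply/seteqP; split => t; rewrite /star_event /A' /= !tnth_marks => -[h1 h2 h3 h4];
    split => // j; have := h3 j; rewrite !tnth_marks.
apply: vertices_sigma_marks.
have -> : A' = ((fun u => (tnth u m).1) @^-1` (B `&` [set w | w0 < w])) `&`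
    ([set u : k.-tuple S | forall j : 'I_k, true ->
       [set u : k.-tuple S | (tnth u m).1 <= (tnth u j).1] u] `&` Ex).
  apply/seteqP; split => u /=; first by move=> [h1 h2 h3 h4]; split => //; split.
  by move=> [[h1 h2] [h3 h4]]; split => // j; exact: h3.
apply: measurableI.
  by rewrite -[Y in measurable Y]setTI; apply: mcoord => //; exact: measurableI.
apply: measurableI => //.
apply: (measurable_forall (D := xpredT)) => j _.
have mb : measurable_fun [set: k.-tuple S]
    (fun u : k.-tuple S => (tnth u m).1 <= (tnth u j).1).
  by apply: measurable_fun_ler; exact: mcoord.
have -> : [set u : k.-tuple S | (tnth u m).1 <= (tnth u j).1] =
    (fun u : k.-tuple S => (tnth u m).1 <= (tnth u j).1) @^-1` [set true] by [].
by rewrite -[Y in measurable Y]setTI; exact: mb.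
Qed.

(** The vertex [j0], which may enter the additional event [Ex], is integrated
    out first; the other [k - 2] vertices then contribute the same factor. *)
Lemma clique_star_bound (m j0 : 'I_k) (B : set R) (Ex : set (k.-tuple S))
    (c0 e0 : R) :
  m != j0 -> measurable B -> measurable Ex -> 0 <= c0 ->
  (forall t, w0 < W m t ->
    (\int[P]_s (star_edge (tnth (Zt t) m, tnth (Zt s) j0) *
        \1_Ex (upd j0 (Zt t) (tnth (Zt s) j0)))%:E <=
     (c0 * (W m t) `^ e0)%:E)%E) ->
  (P (star_event m B Ex `&` clique G v) <=
   (c0 * (star_cst tau w0 gamma dim / M) ^+ k.-2)%:E *
   \int[P]_t ((W m t) `^ (e0 + k.-2%:R * (3 - tau)) *
     \1_(B `&` [set w | (w0 < w)%R]) (W m t))%:E)%E.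
Proof.
move=> mj0 mB mEx c00 H0.
have mBg : measurable (B `&` [set w : R | w0 < w]) by exact: measurableI.
set A := star_event m B Ex.
have sA : vertices_sigma (weight G) (pos G) A by exact: star_event_sigma.
have mA : measurable A by exact: (vertices_sigma_measurable sA).
pose s := enum ([set~ m] :\ j0)%SET.
have memS i : (i \in s) = (i != j0) && (i != m) by rewrite mem_enum !inE.
have size_s : size s = k.-2.
  rewrite -cardE; have /(congr1 predn) := cardsD1 j0 [set~ m]%SET.
  by rewrite in_setC1 eq_sym mj0 cardsC1 card_ord add1n /= => <-.
pose Phi (u : k.-tuple S) := \1_B (tnth u m).1 *
  \prod_(j <- s) star_edge (tnth u m, tnth u j).
pose F (u : k.-tuple S) := star_edge (tnth u m, tnth u j0) * \1_Ex u.
have mse i : measurable_fun [set: k.-tuple S]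
    (fun u => star_edge (tnth u m, tnth u i)).
  have mp : measurable_fun [set: k.-tuple S] (fun u => (tnth u m, tnth u i)).
    by apply: measurable_fun_pair; exact: measurable_tnth.
  exact: (measurableT_comp measurable_star_edge mp).
have mIB : measurable_fun [set: R] (\1_B : R -> R) by exact: measurable_indic.
have mPhi : measurable_fun setT Phi.
  apply: measurable_funM; first exact: (measurableT_comp mIB (mcoord m)).
  by apply: measurable_prod => i _; exact: mse.
have mF : measurable_fun setT F.
  by apply: measurable_funM => //; exact: measurable_indic.
have Phi0 u : 0 <= Phi u.
  by rewrite mulr_ge0// prodr_ge0// => i _; exact: star_edge_ge0.
have F0 u : 0 <= F u by rewrite mulr_ge0// star_edge_ge0.
pose gt0 : R -> R := \1_[set w | w0 < w].
have mgt0 : measurable_fun [set: R] gt0 by exact: measurable_indic.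
have mpow r : measurable_fun [set: k.-tuple S] (fun u => (tnth u m).1 `^ r).
  exact: (measurableT_comp (measurable_powR r) (mcoord m)).
pose h (u : k.-tuple S) := c0 * (tnth u m).1 `^ e0 * gt0 (tnth u m).1.
have mh : measurable_fun setT h.
  apply: measurable_funM; last exact: (measurableT_comp mgt0 (mcoord m)).
  by apply: measurable_funM => //; exact: measurable_cst.
have mZ := measurable_marks G v.
pose ee j t := edge_pr tau w0 gamma n (W m t) (W j t) (X m t) (X j t).
have prodE t : \prod_(j < k | j != m) ee j t = ee j0 t * \prod_(j <- s) ee j t.
  rewrite (bigD1 j0)/= 1?eq_sym//; congr (_ * _).
  by rewrite big_enum; apply: eq_bigl => j; rewrite !inE andbC.
have mee j : measurable_fun [set: T] (ee j) by exact: measurable_edge_pr.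
have mprod : measurable_fun [set: T] (fun t => (\prod_(j < k | j != m) ee j t)%:E).
  under eq_fun do rewrite prodE.
  apply/measurable_EFinP; apply: measurable_funM; first exact: mee.
  by apply: measurable_prod => j _; exact: mee.
apply: (le_trans (clique_star_le v_uniq m sA)).
apply: (@le_trans _ _ (\int[P]_t (Phi (Zt t) * F (Zt t))%:E)%E).
  rewrite integral_mkcond; apply: ge0_le_integral => //.
  - by move=> t _; rewrite patchE; case: ifP => // _; rewrite lee_fin; apply: prodr_ge0 => j _; exact: edge_pr_ge0.
  - exact: ((measurable_restrictT _ mA).1 (measurable_funTS mprod)).
  - apply/measurable_EFinP; apply: measurable_funM.
      exact: (measurableT_comp mPhi mZ).
    exact: (measurableT_comp mF mZ).
  - move=> t _; rewrite patchE; case: ifP => [/set_mem At|_]; last first.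
      by rewrite lee_fin mulr_ge0.
    have [h1 h2 h3 h4] := At.
    rewrite lee_fin le_eqVlt; apply/orP; left; apply/eqP.
    have se j : star_edge (tnth (Zt t) m, tnth (Zt t) j) = ee j t.
      rewrite !tnth_marks /star_edge indicE mem_set ?mulr1//=.
      by rewrite h2 h3.
    rewrite /Phi /F se !indicE mem_set; last by rewrite tnth_marks.
    rewrite mem_set// mul1r mulr1 mulrC -/(ee _ _) prodE; congr (_ * _).
    by apply: eq_bigr => j _; rewrite se.
have PhiE u y : Phi (upd j0 u y) = Phi u.
  rewrite /Phi !tnth_upd (negbTE mj0); congr (_ * _).
  apply: eq_big_seq => j; rewrite memS => /andP[jj0 _].
  by rewrite tnth_upd (negbTE jj0).
have h0' u : 0 <= h u by rewrite !mulr_ge0 ?powR_ge0.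
have Hh t : (\int[P]_s (F (upd j0 (Zt t) (tnth (Zt s) j0)))%:E <= (h (Zt t))%:E)%E.
  rewrite /h tnth_marks /= /gt0 indicE; have [wm|wm] := boolP (w0 < W m t).
    rewrite mem_set// mulr1; apply: le_trans (H0 _ wm).
    rewrite le_eqVlt; apply/orP; left; apply/eqP/eq_integral => s' _.
    by rewrite /F !tnth_upd eqxx (negbTE mj0).
  rewrite integral0_eq; last first.
    move=> s' _; rewrite /F !tnth_upd eqxx (negbTE mj0) /star_edge !tnth_marks.
    rewrite indicE memNset; first by rewrite mulr0 mul0r.
    by move=> /= /andP[hh _]; rewrite hh in wm.
  by rewrite memNset//= ?mulr0//; exact/negP.
apply: (le_trans (integral_resample_le mZ (marks_indep G v_uniq) mPhi mF mh Phi0 F0 h0' PhiE Hh)).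
pose g (z : S) := \1_B z.1 * (c0 * z.1 `^ e0 * gt0 z.1).
pose h1 (z : S) := star_cst tau w0 gamma dim / M * z.1 `^ (3 - tau) * gt0 z.1.
have mfst : measurable_fun [set: S] (fun z : S => z.1) by exact: measurable_fst.
have mpow1 r : measurable_fun [set: S] (fun z : S => z.1 `^ r).
  exact: (measurableT_comp (measurable_powR r) mfst).
have mgt1 : measurable_fun [set: S] (fun z : S => gt0 z.1).
  exact: (measurableT_comp mgt0 mfst).
have mg : measurable_fun setT g.
  apply: measurable_funM; first exact: (measurableT_comp mIB mfst).
  by apply: measurable_funM => //; apply: measurable_funM => //; exact: measurable_cst.
have mh1 : measurable_fun setT h1.
  by apply: measurable_funM => //; apply: measurable_funM => //; exact: measurable_cst.
have g0 z : 0 <= g z by rewrite !mulr_ge0 ?powR_ge0.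
have sc0 : 0 <= star_cst tau w0 gamma dim / M.
  by rewrite divr_ge0// ltW// star_cst_gt0.
have h10 z : 0 <= h1 z by rewrite mulr_ge0// mulr_ge0 ?powR_ge0.
have ms : m \notin s by rewrite memS eqxx andbF.
have fh j t : j \in s -> (\int[P]_t' (star_edge (tnth (Zt t) m, tnth (Zt t') j))%:E <=
   (h1 (tnth (Zt t) m))%:E)%E.
  by move=> _; apply: (le_trans (integral_star_edge_le m j t)); rewrite /h1 tnth_marks.
have := integral_star_le mZ (marks_indep G v_uniq) (enum_uniq _ : uniq s) ms
   mg mh1 measurable_star_edge g0 h10 star_edge_ge0 fh.
rewrite size_s => HS.
rewrite (eq_integral (fun t => (g (tnth (Zt t) m) *
   \prod_(j <- s) star_edge (tnth (Zt t) m, tnth (Zt t) j))%:E)); last first.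
  by move=> t _; rewrite /Phi /g /h mulrAC.
apply: (le_trans HS).
rewrite -ge0_integralZl; last 4 first.
- exact: measurableT.
- apply/measurable_EFinP; apply: measurable_funM.
    exact: (measurableT_comp (measurable_powR _) (mW m)).
  have mI : measurable_fun [set: R] (\1_(B `&` [set w | w0 < w]) : R -> R).
    exact: measurable_indic.
  exact: (measurableT_comp mI (mW m)).
- by move=> t _; rewrite lee_fin mulr_ge0 ?powR_ge0.
- by rewrite lee_fin mulr_ge0// exprn_ge0.
rewrite le_eqVlt; apply/orP; left; apply/eqP/eq_integral => t _.
rewrite -EFinM tnth_marks /g /h1 /gt0 indicI/=; congr EFin.
rewrite [\1_[set w | _] _]indicE.
have [wm|wm] := boolP (w0 < W m t); last first.
  by rewrite memNset; [rewrite !(mulr0, mul0r)|exact/negP].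
rewrite mem_set// !mulr1 exprMn.
have wm0 : 0 < W m t by exact: lt_trans wm.
rewrite -[(W m t `^ (3 - tau)) ^+ _]powR_mulrn ?powR_ge0// -powRrM.
rewrite [W m t `^ (e0 + _)]powRD; last by rewrite (gt_eqF wm0) implybT.
by rewrite [(3 - tau) * _]mulrC; ring.
Qed.

End star.

(** * Lower bounds for the probability of a clique *)

Lemma mutually_independent_inj (R : realType) (disp : measure_display)
    (T : measurableType disp) (P : probability T R) (I K : finType)
    (F : I -> set_system T) (f : K -> I) (A : K -> set T) :
  mutually_independent P F -> injective f -> (forall i, F (f i) (A i)) ->
  P [set t | forall i, A i t] = (\prod_i fine (P (A i)))%:E.
Proof.
move=> FI fI FA.
pose A' j : set T := [set t | forall i, f i = j -> A i t].
have A'f i : A' (f i) = A i.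
  by apply/seteqP; split => t /=; [exact|move=> At i' /fI ->].
have := FI [set f i | i in K]%SET A'.
rewrite big_imset/=; last by move=> i j _ _; exact: fI.
under eq_bigr do rewrite A'f.
move=> <-; last by move=> _ /imsetP[i _ ->]; rewrite A'f.
congr (P _); apply/seteqP; split => t /= h.
  by move=> _ /imsetP[i _ ->]; rewrite A'f.
by move=> i; rewrite -A'f; apply: h; exact: imset_f.
Qed.

Lemma edge_pr_eq1 (R : realType) (tau w0 gamma : R) n dim (u v : R)
    (x y : dim.-tuple R) :
  0 <= gamma -> 0 < n%:R * pareto_mean tau w0 ->
  n%:R * pareto_mean tau w0 * torus_dist x y ^+ dim <= u * v ->
  edge_pr tau w0 gamma n u v x y = 1.
Proof.
move=> g0 M0 h; rewrite /edge_pr; case: eqVneq => // D0.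
have D1 : 0 < n%:R * pareto_mean tau w0 * torus_dist x y ^+ dim.
  by rewrite mulr_gt0// exprn_gt0// lt_neqAle eq_sym D0 torus_dist_ge0.
apply/min_idPr; have E1 : (1 : R) `^ gamma = 1 by rewrite powR1.
rewrite -[leLHS]E1 ge0_ler_powR ?nnegrE//.
- by rewrite (le_trans ler01)// ler_pdivlMr// mul1r.
- by rewrite ler_pdivlMr// mul1r.
Qed.

Section lower_bounds.
Context (R : realType) (disp : measure_display) (T : measurableType disp)
  (P : probability T R) (tau w0 gamma : R) (n dim : nat)
  (G : girg P tau w0 gamma n dim) (k : nat) (v : k.-tuple 'I_n).
Hypotheses (w0_gt0 : 0 < w0) (tau23 : 2 < tau < 3) (gamma_gt1 : 1 < gamma)
  (dim_gt0 : (0 < dim)%N) (n_gt0 : (0 < n)%N) (v_uniq : uniq v).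

Local Notation S := (R * dim.-tuple R)%type.
Local Notation W i := (weight G (tnth v i)).
Local Notation X i := (pos G (tnth v i)).
Local Notation VS := (vertex_sigma (weight G) (pos G)).
Let M : R := n%:R * pareto_mean tau w0.

Let mean_gt0 : 0 < pareto_mean tau w0.
Proof. exact: pareto_mean_gt0. Qed.

Let M0 : 0 < M. Proof. by rewrite mulr_gt0// ltr0n. Qed.

Let v_inj i j : tnth v i = tnth v j -> i = j.
Proof. by move/tuple_uniqP : v_uniq; exact. Qed.

Let sigma_gt (b : R) i : VS (inl (tnth v i)) [set t | b < W i t].
Proof.
exists `]b, +oo[%classic; first exact: measurable_itv.
by rewrite setTI; apply/seteqP; split => t /=; rewrite in_itv/= andbT.
Qed.

Lemma pr_all_weights_gt (b : 'I_k -> R) : (forall i, w0 <= b i) ->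
  P [set t | forall i, (b i < W i t)%R] =
  (\prod_(i < k) (w0 / b i) `^ (tau - 1))%:E.
Proof.
move=> wb.
rewrite (mutually_independent_inj (f := fun i => inl (tnth v i))
  (A := fun i => [set t | b i < W i t]) (@girg_independent _ _ _ _ _ _ _ _ _ G)).
- by congr EFin; apply: eq_bigr => i _; rewrite weight_pareto.
- by move=> i j [/v_inj].
- by move=> i; exact: sigma_gt.
Qed.

(** Vertices of weight above [Num.sqrt M] are joined with probability [1],
    since distances on the torus are at most [1]. *)
Lemma clique_pr_ge_hubs : w0 <= Num.sqrt M ->
  (((w0 / Num.sqrt M) `^ (tau - 1) ^+ k)%:E <= P (clique G v))%E.
Proof.
move=> wM.
have := pr_all_weights_gt (b := fun=> Num.sqrt M) (fun=> wM).
rewrite prodr_const card_ord => <-.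
apply: (clique_ge v_uniq).
  have -> : [set t | forall i, Num.sqrt M < W i t] =
     marks G v @^-1` [set u : k.-tuple S | forall i : 'I_k, true ->
       [set u : k.-tuple S | Num.sqrt M < (tnth u i).1] u].
    apply/seteqP; split => t /= h i; last by have := h i isT; rewrite tnth_marks.
    by move=> _; rewrite /= tnth_marks; exact: h.
  apply: vertices_sigma_marks; apply: (measurable_forall (D := xpredT)) => i _.
  have m1 : measurable_fun [set: k.-tuple S] (fun u : k.-tuple S => (tnth u i).1).
    exact: (measurableT_comp measurable_fst (measurable_tnth i)).
  exact: (measurable_set_gt _ m1).
move=> t i j h; apply: edge_pr_eq1 => //; first by rewrite (le_trans ler01)// ltW.
have D1 : torus_dist (X i t) (X j t) <= 1.
  apply: bigmax_le => // l _; apply: (le_trans (circle_dist_le_norm _ _)).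
  have /andP[? ?] := pos_torus G (tnth v i) t l.
  have /andP[? ?] := pos_torus G (tnth v j) t l.
  by rewrite ler_norml; apply/andP; split; lra.
apply: (@le_trans _ _ M).
  by rewrite -[leRHS]mulr1 ler_wpM2l ?(ltW M0)// exprn_ile1// torus_dist_ge0.
rewrite -[leLHS](sqr_sqrtr (ltW M0)) expr2.
by apply: ler_pM; rewrite ?sqrtr_ge0// ltW.
Qed.

Section grid.
Variables (q : nat) (q_gt0 : (0 < q)%N).

(* the sides of the half-open cube of side 1 / q with lower corner c / q *)
Let cell (c : {ffun 'I_dim -> 'I_q}) (h : 'I_dim) : set R :=
  `[(c h)%:R / q%:R, (c h).+1%:R / q%:R[%classic.

Let q0 : 0 < q%:R :> R. Proof. by rewrite ltr0n. Qed.

Let mcell c h : measurable (cell c h). Proof. exact: measurable_itv. Qed.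

Let in_cell (c : {ffun 'I_dim -> 'I_q}) i :=
  [set t | forall h, cell c h (tnth (X i t) h)].

Let sigma_cell c i : VS (inr (tnth v i)) (in_cell c i).
Proof.
exists [set y : dim.-tuple R | forall h, cell c h (tnth y h)].
  exact: (measurable_box (X := fun y : dim.-tuple R => y) (@measurable_id _ _ setT) (mcell c)).
by rewrite setTI.
Qed.

Let pr_cell c i : fine (P (in_cell c i)) = q%:R ^- dim.
Proof.
rewrite /in_cell (pos_uniform G (tnth v i) (mcell c))/=.
rewrite (eq_bigr (fun=> q%:R^-1)) ?prodr_const ?card_ord ?exprVn// => h _.
have lt1 : (c h).+1%:R / q%:R <= 1 :> R by rewrite ler_pdivrMr// mul1r ler_nat.
have -> : cell c h `&` `[0, 1[%classic = cell c h.
  apply/setIidl => y; rewrite /cell /= !in_itv/= => /andP[h1 h2].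
  apply/andP; split; last exact: lt_le_trans lt1.
  by apply: le_trans h1; rewrite divr_ge0.
rewrite /cell lebesgue_measure_itv/= lte_fin ltr_pM2r ?invr_gt0// ltr_nat ltnSn.
by rewrite /= -mulrBl -natrB// subSnn mul1r.
Qed.

Let clump (c : {ffun 'I_dim -> 'I_q}) : set T :=
  [set t | forall i, w0 < W i t /\ in_cell c i t].

Let pr_clump c : P (clump c) = ((q%:R ^- dim) ^+ k)%:E.
Proof.
pose f (i : 'I_k + 'I_k) : 'I_n + 'I_n :=
  match i with inl i => inl (tnth v i) | inr i => inr (tnth v i) end.
pose A (i : 'I_k + 'I_k) : set T :=
  match i with inl i => [set t | w0 < W i t] | inr i => in_cell c i end.
have -> : clump c = [set t | forall i, A i t].
  apply/seteqP; split => t /= h; first by move=> [i|i]; have [] := h i.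
  by move=> i; split; [exact: (h (inl i))|exact: (h (inr i))].
rewrite (mutually_independent_inj (f := f) (@girg_independent _ _ _ _ _ _ _ _ _ G)).
- congr EFin; rewrite big_sumType/= [Y in Y * _]big1; last first.
    by move=> i _; rewrite weight_pareto// divff ?gt_eqF// powR1.
  rewrite mul1r (eq_bigr (fun=> q%:R ^- dim)); last by move=> i _; exact: pr_cell.
  by rewrite prodr_const card_ord.
- by move=> [i|i] [j|j] //= [/v_inj ->].
- by move=> [i|i]; [exact: sigma_gt|exact: sigma_cell].
Qed.

Let msig (c : {ffun 'I_dim -> 'I_q}) :
  vertices_sigma (weight G) (pos G) (clump c).
Proof.
have -> : clump c = marks G v @^-1` [set u : k.-tuple S | forall i : 'I_k, true ->
  ([set u : k.-tuple S | w0 < (tnth u i).1] `&`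
   [set u : k.-tuple S | forall h, cell c h (tnth (tnth u i).2 h)]) u].
  apply/seteqP; split => t /= h i; last by have := h i isT; rewrite tnth_marks.
  by move=> _; rewrite tnth_marks; exact: h.
apply: vertices_sigma_marks; apply: (measurable_forall (D := xpredT)) => i _.
apply: measurableI.
  have m1 : measurable_fun [set: k.-tuple S] (fun u : k.-tuple S => (tnth u i).1).
    exact: (measurableT_comp measurable_fst (measurable_tnth i)).
  exact: (measurable_set_gt _ m1).
have m2 : measurable_fun [set: k.-tuple S] (fun u : k.-tuple S => (tnth u i).2).
  exact: (measurableT_comp measurable_snd (measurable_tnth i)).
exact: (measurable_box m2 (mcell c)).
Qed.

(** The vertices are joined as soon as they all lie in the same cube.  There
    are [q ^ dim] cubes, and the events for distinct cubes are disjoint. *)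
Lemma clique_pr_ge_grid : (0 < k)%N -> M <= w0 ^+ 2 * q%:R ^+ dim ->
  (((q%:R ^- dim) ^+ k.-1)%:E <= P (clique G v))%E.
Proof.
move=> k0 Mq.
pose A := \bigcup_(c in [set: {ffun 'I_dim -> 'I_q}]) clump c.
have -> : (((q%:R ^- dim) ^+ k.-1)%:E = P A)%E.
  rewrite /A measure_fin_bigcup; first last.
  - by move=> c _; apply: vertices_sigma_measurable; exact: msig.
  - move=> c c' _ _ [t [h1 h2]].
    have [_ {}h1] := h1 (Ordinal k0); have [_ {}h2] := h2 (Ordinal k0).
    apply/ffunP => h; have := h1 h; have := h2 h.
    rewrite /cell /= !in_itv/= !ler_pdivrMr// !ltr_pdivlMr//.
    move=> /andP[a1 a2] /andP[a3 a4]; apply/val_inj/eqP.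
    have := le_lt_trans a1 a4; have := le_lt_trans a3 a2; rewrite !ltr_nat !ltnS.
    by rewrite eqn_leq => -> ->.
  - exact: finite_finset.
  - rewrite (fsbigE (index_enum _)) ?index_enum_uniq//; last first.
      by move=> c _; rewrite mem_index_enum.
    rewrite (eq_bigl xpredT); last by move=> c; exact: mem_set.
    rewrite (eq_bigr (fun=> ((q%:R ^- dim) ^+ k)%:E)); last by move=> c _; exact: pr_clump.
    rewrite sumEFin sumr_const card_ffun !card_ord; congr EFin.
    rewrite -[in RHS](prednK k0) exprS -[_ *+ (q ^ dim)]mulr_natl mulrA natrX divff ?mul1r//.
    by rewrite expf_neq0// gt_eqF.
apply: (clique_ge v_uniq).
  apply: (@fin_bigcup_measurable _ (g_sigma_algebraType (\bigcup_i VS i))) => //.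
  by move=> c _; exact: msig.
move=> t i j [c _ ct]; apply: edge_pr_eq1 => //; first by rewrite (le_trans ler01)// ltW.
have [wi ci] := ct i; have [wj cj] := ct j.
have D1 : torus_dist (X i t) (X j t) <= q%:R^-1.
  apply: bigmax_le => [|h _]; first by rewrite invr_ge0 ltW.
  apply: (le_trans (circle_dist_le_norm _ _)).
  have := ci h; have := cj h; rewrite /cell /= !in_itv/= -natr1 mulrDl mul1r.
  move=> /andP[? ?] /andP[? ?].
  by rewrite ler_norml; apply/andP; split; lra.
apply: (@le_trans _ _ (M * q%:R^-1 ^+ dim)).
  by rewrite ler_wpM2l ?(ltW M0)// lerXn2r ?nnegrE ?torus_dist_ge0 ?invr_ge0 ?(ltW q0).
rewrite exprVn ler_pdivrMr ?exprn_gt0//; apply: (le_trans Mq).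
by rewrite ler_wpM2r ?exprn_ge0 ?(ltW q0)// expr2; apply: ler_pM; rewrite ?(ltW w0_gt0)// ltW.
Qed.

End grid.

(** The grid has mesh [1 / q], where [q] is the first integer above
    [(M / w0 ^ 2) ^ (1 / dim)]. *)
Lemma clique_pr_ge_near : (0 < k)%N -> w0 ^+ 2 <= M ->
  (((w0 ^+ 2 / (2 ^+ dim * M)) ^+ k.-1)%:E <= P (clique G v))%E.
Proof.
move=> k0 wM; have w20 : 0 < w0 ^+ 2 by rewrite exprn_gt0.
have dn0 : dim%:R != 0 :> R by rewrite pnatr_eq0 -lt0n.
pose y := (M / w0 ^+ 2) `^ dim%:R^-1.
have Mw : 1 <= M / w0 ^+ 2 by rewrite ler_pdivlMr// mul1r.
have y1 : 1 <= y.
  rewrite -(powRr0 (M / w0 ^+ 2)) ler_powR// invr_ge0 ler0n.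
have yd : y ^+ dim = M / w0 ^+ 2.
  rewrite -powR_mulrn ?powR_ge0// -powRrM mulVf// powRr1//.
  by rewrite (le_trans ler01).
pose q := (Num.truncn y).+1.
have qy : y <= q%:R by rewrite ltW// truncnS_gt.
have q2y : q%:R <= 2 * y.
  have : (Num.truncn y)%:R <= y by rewrite truncn_le// (le_trans ler01).
  rewrite /q -natr1; lra.
have y0 : 0 < y by rewrite (lt_le_trans ltr01).
have q0 : 0 < q%:R :> R by rewrite ltr0n.
have Mq : M <= w0 ^+ 2 * q%:R ^+ dim.
  rewrite -ler_pdivrMl// mulrC -yd lerXn2r ?nnegrE ?(ltW y0) ?(ltW q0)//.
apply: le_trans (clique_pr_ge_grid (ltn0Sn _) k0 Mq).
rewrite lee_fin lerXn2r ?nnegrE ?invr_ge0 ?exprn_ge0 ?(ltW q0)//.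
  by rewrite divr_ge0 ?(ltW w20)// mulr_ge0 ?(ltW M0)// exprn_ge0.
have -> : w0 ^+ 2 / (2 ^+ dim * M) = ((2 * y) ^+ dim)^-1.
  by rewrite exprMn yd; field; rewrite ?gt_eqF// expf_neq0.
by rewrite lef_pV2 ?posrE ?exprn_gt0 ?mulr_gt0// lerXn2r ?nnegrE ?(ltW q0) ?mulr_ge0 ?(ltW y0).
Qed.

End lower_bounds.

(** * Upper bounds for the atypical cliques *)

Section bad_events.
Context (R : realType) (disp : measure_display) (T : measurableType disp)
  (P : probability T R) (tau w0 gamma : R) (n dim : nat)
  (G : girg P tau w0 gamma n dim) (k : nat) (v : k.-tuple 'I_n).
Hypotheses (w0_gt0 : 0 < w0) (tau23 : 2 < tau < 3) (gamma_gt1 : 1 < gamma)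
  (dim_gt0 : (0 < dim)%N) (n_gt0 : (0 < n)%N) (v_uniq : uniq v)
  (k_ge2 : (2 <= k)%N).

Local Notation S := (R * dim.-tuple R)%type.
Local Notation W i := (weight G (tnth v i)).
Local Notation X i := (pos G (tnth v i)).
Local Notation Zt := (marks G v).
Let M : R := n%:R * pareto_mean tau w0.
Let sc := star_cst tau w0 gamma dim.

Let mean_gt0 : 0 < pareto_mean tau w0.
Proof. exact: pareto_mean_gt0. Qed.

Let M0 : 0 < M. Proof. by rewrite mulr_gt0// ltr0n. Qed.
Let Q := Num.sqrt M.
Let Q0 : 0 < Q. Proof. by rewrite sqrtr_gt0. Qed.
Let tau_gt1 : 1 < tau. Proof. by move: tau23 => /andP[? ?]; lra. Qed.
Let sc0 : 0 < sc. Proof. exact: star_cst_gt0. Qed.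
Let mW i : measurable_fun [set: T] (W i). Proof. exact: measurable_funPT. Qed.
Let mX i : measurable_fun [set: T] (X i). Proof. exact: measurable_funPT. Qed.

Let mI (B : set R) i : measurable B -> measurable_fun [set: T] (fun t => \1_B (W i t) : R).
Proof.
move=> mB; have m1 : measurable_fun [set: R] (\1_B : R -> R) by exact: measurable_indic.
exact: (measurableT_comp m1 (mW i)).
Qed.

Let mWs s i : measurable_fun [set: T] (fun t => W i t `^ s).
Proof. exact: (measurableT_comp (measurable_powR s) (mW i)). Qed.

Lemma min_weight_moment_below (m : 'I_k) (B : set R) (s b : R) :
  measurable B -> tau - 1 < s -> 0 < b -> (forall w, B w -> w <= b) ->
  (\int[P]_t (W m t `^ s * \1_(B `&` [set w | (w0 < w)%R]) (W m t))%:E <=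
   (dyadic_cst (tau - 1) s * w0 `^ (tau - 1) * b `^ (s - (tau - 1)))%:E)%E.
Proof.
move=> mB ts b0 Bb.
have mgt : measurable [set w : R | w0 < w].
  exact: (measurable_set_gt _ (@measurable_id _ _ _)).
have mle : measurable [set t | 0 < W m t <= b].
  exact: (measurable_set_oc _ _ (mW _)).
apply: le_trans (pareto_moment_below w0_gt0 tau_gt1 (mW m)
  (@weight_pareto _ _ _ _ _ _ _ _ _ G (tnth v m)) ts b0).
apply: ge0_le_integral => //.
- by move=> t _; rewrite lee_fin mulr_ge0 ?powR_ge0.
- by apply/measurable_EFinP; apply: measurable_funM => //; apply: mI; exact: measurableI.
- by apply/measurable_EFinP; apply: measurable_funM => //; exact: measurable_indic.
- move=> t _; rewrite lee_fin ler_wpM2l ?powR_ge0// !indicE ler_nat.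
  case: (boolP (_ \in B `&` _)) => // /set_mem[/= h1 h2].
  by rewrite mem_set//= (lt_trans w0_gt0 h2) Bb.
Qed.

Lemma min_weight_moment_above (m : 'I_k) (s : R) : 0 <= s < tau - 1 ->
  (\int[P]_t (W m t `^ s * \1_([set: R] `&` [set w | (w0 < w)%R]) (W m t))%:E <=
   (dyadic_cst (tau - 1) s * w0 `^ s)%:E)%E.
Proof.
move=> st.
have mgt : measurable [set w : R | w0 < w].
  exact: (measurable_set_gt _ (@measurable_id _ _ _)).
have mle : measurable [set t | w0 <= W m t].
  exact: (measurable_set_ge _ (mW _)).
have E : dyadic_cst (tau - 1) s * w0 `^ s =
   dyadic_cst (tau - 1) s * w0 `^ (tau - 1) * w0 `^ (s - (tau - 1)).
  rewrite -mulrA -powRD; last by rewrite (gt_eqF w0_gt0) implybT.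
  by congr (_ * _ `^ _); ring.
rewrite E; apply: le_trans (pareto_moment_above w0_gt0 tau_gt1 (mW m)
  (@weight_pareto _ _ _ _ _ _ _ _ _ G (tnth v m)) st w0_gt0).
apply: ge0_le_integral => //.
- by move=> t _; rewrite lee_fin mulr_ge0 ?powR_ge0.
- by apply/measurable_EFinP; apply: measurable_funM => //; apply: mI; exact: measurableI.
- by apply/measurable_EFinP; apply: measurable_funM => //; exact: measurable_indic.
- move=> t _; rewrite lee_fin ler_wpM2l ?powR_ge0// !indicE ler_nat.
  case: (boolP (_ \in _ `&` _)) => // /set_mem[/= h1 h2].
  by rewrite mem_set//= ltW.
Qed.

Let k1E : k.-2.+1 = k.-1. Proof. by case: (k) k_ge2 => [|[]]. Qed.
Let k2E : k.-2%:R = k.-1%:R - 1 :> R.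
Proof. by rewrite -k1E -natr1 addrK. Qed.
Let kE : k%:R = k.-1%:R + 1 :> R.
Proof. by rewrite natr1 prednK// ltnW. Qed.

Let tk_gt (hk : 2 < k%:R * (3 - tau)) : tau - 1 < k.-1%:R * (3 - tau).
Proof. by move: hk; rewrite kE; lra. Qed.

(* the power of [M] in the star bounds is that of the lower bound *)
Let scaleQ : (sc / M) ^+ k.-1 * Q `^ (k.-1%:R * (3 - tau) - (tau - 1)) =
  sc ^+ k.-1 * Q `^ (- (k%:R * (tau - 1))).
Proof.
rewrite exprMn -mulrA; congr (_ * _).
have QE : M = Q `^ 2 by rewrite powR_mulrn ?sqrtr_ge0// sqr_sqrtr// ltW.
have -> : M^-1 ^+ k.-1 = Q `^ (- (2 * k.-1%:R)).
  by rewrite -powR_mulrn ?invr_ge0 ?(ltW M0)// -(powR_inv1 (ltW M0)) -powRrM QE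
    -powRrM; congr powR; ring.
rewrite -powRD; last by rewrite (gt_eqF Q0) implybT.
by congr powR; rewrite kE; ring.
Qed.

(** The smallest weight is below [eps * Q]. *)
Lemma small_weight_bound (m : 'I_k) (eps : R) :
  2 < k%:R * (3 - tau) -> 0 < eps ->
  (P (star_event G v m [set w | (w < eps * Q)%R] setT `&` clique G v) <=
   (sc ^+ k.-1 * (dyadic_cst (tau - 1) (k.-1%:R * (3 - tau)) * w0 `^ (tau - 1)) *
    eps `^ (k.-1%:R * (3 - tau) - (tau - 1)) * Q `^ (- (k%:R * (tau - 1))))%:E)%E.
Proof.
move=> hk eps0.
set e := k.-1%:R * (3 - tau).
have te : tau - 1 < e by exact: tk_gt.
have [j0 mj0] : exists j0, m != j0.
  exists (if m == 0%N :> nat then Ordinal k_ge2 else Ordinal (ltnW k_ge2)).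
  by apply/negP => /eqP; case: ifPn => [/eqP|] h /(congr1 val)/=; rewrite ?h//; move/eqP: h.
have mB : measurable [set w : R | w < eps * Q].
  exact: (measurable_set_lt _ (@measurable_id _ _ _)).
have b0 : 0 < eps * Q by rewrite mulr_gt0.
have scM : 0 <= sc / M by rewrite divr_ge0// ltW.
have H t : w0 < W m t ->
    (\int[P]_s (star_edge tau w0 gamma n (tnth (Zt t) m, tnth (Zt s) j0) *
        \1_(setT : set (k.-tuple S)) (upd j0 (Zt t) (tnth (Zt s) j0)))%:E <=
     (sc / M * (W m t) `^ (3 - tau))%:E)%E.
  move=> wm; under eq_integral do rewrite indicT mulr1.
  apply: (le_trans (integral_star_edge_le G v w0_gt0 tau23 gamma_gt1 dim_gt0 n_gt0 m j0 t)).
  by rewrite indicE mem_set// mulr1.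
have B1 := clique_star_bound w0_gt0 tau23 gamma_gt1 dim_gt0 n_gt0 v_uniq mj0 mB
  (@measurableT _ _) scM H.
apply: (le_trans B1); rewrite -/sc -exprS k1E.
have -> : 3 - tau + k.-2%:R * (3 - tau) = e by rewrite /e -k1E -natr1; ring.
have B2 := min_weight_moment_below m mB te b0 (fun w => @ltW _ _ w _).
apply: (@le_trans _ _ (((sc / M) ^+ k.-1)%:E * (dyadic_cst (tau - 1) e *
    w0 `^ (tau - 1) * (eps * Q) `^ (e - (tau - 1)))%:E)%E).
  by apply: lee_wpmul2l => //; rewrite lee_fin exprn_ge0.
rewrite -EFinM lee_fin powRM ?(ltW eps0) ?(ltW Q0)//.
rewrite [leRHS](_ : _ = dyadic_cst (tau - 1) e * w0 `^ (tau - 1) *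
    eps `^ (e - (tau - 1)) * (sc ^+ k.-1 * Q `^ (- (k%:R * (tau - 1))))); last by ring.
by rewrite -scaleQ -/e le_eqVlt; apply/orP; left; apply/eqP; ring.
Qed.

Lemma integral_star_edge_ext (m j0 : 'I_k) (Ex : set (k.-tuple S)) (E : set S) t :
  m != j0 -> measurable Ex -> measurable E ->
  (forall z : S, W m t <= z.1 -> Ex (upd j0 (Zt t) z) -> E z) ->
  (\int[P]_s (star_edge tau w0 gamma n (tnth (Zt t) m, tnth (Zt s) j0) *
      \1_Ex (upd j0 (Zt t) (tnth (Zt s) j0)))%:E <=
   \int[P]_s (edge_pr tau w0 gamma n (W m t) (W j0 s) (X m t) (X j0 s) *
      \1_E (W j0 s, X j0 s))%:E)%E.
Proof.
move=> mj0 mEx mE ExE.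
have mZj : measurable_fun [set: T] (fun s => tnth (Zt s) j0).
  exact: (measurableT_comp (measurable_tnth j0) (measurable_marks G v)).
apply: ge0_le_integral => //.
- by move=> s _; rewrite lee_fin mulr_ge0// star_edge_ge0.
- apply/measurable_EFinP; apply: measurable_funM.
    have mp : measurable_fun [set: T] (fun s => (tnth (Zt t) m, tnth (Zt s) j0)).
      exact: measurable_fun_pair.
    exact: (measurableT_comp (@measurable_star_edge _ tau w0 gamma n dim) mp).
  have mI' : measurable_fun [set: k.-tuple S] (\1_Ex : _ -> R).
    exact: measurable_indic.
  have mp : measurable_fun [set: T] (fun s => (Zt t, tnth (Zt s) j0)).
    exact: measurable_fun_pair.
  exact: (measurableT_comp mI' (measurableT_comp (measurable_upd j0) mp)).
- apply/measurable_EFinP; apply: measurable_funM.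
    by apply: measurable_edge_pr => //; exact: measurable_cst.
  have mI' : measurable_fun [set: S] (\1_E : _ -> R) by exact: measurable_indic.
  have mp : measurable_fun [set: T] (fun s => (W j0 s, X j0 s)).
    exact: measurable_fun_pair.
  exact: (measurableT_comp mI' mp).
- move=> s _; rewrite lee_fin !tnth_marks /star_edge/= -mulrA.
  apply: ler_wpM2l; first exact: edge_pr_ge0.
  rewrite !indicE/= -natrM ler_nat.
  case: (boolP (_ \in Ex)) => [/set_mem h|]; last by rewrite muln0.
  case: (boolP (_ \in [set z : S * S | _])) => // /set_mem/= /andP[_ h'].
  by rewrite mem_set//; exact: ExE.
Qed.

(** The smallest weight is at most [Q], and the weight of [j0] is above
    [Q / eps]. *)
Lemma large_weight_bound (m j0 : 'I_k) (eps : R) :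
  m != j0 -> 2 < k%:R * (3 - tau) -> 0 < eps ->
  (P (star_event G v m [set w | (w <= Q)%R]
        [set u | (Q / eps < (tnth u j0).1)%R] `&` clique G v) <=
   (sc ^+ k.-1 * (dyadic_cst (tau - 1) (1 + k.-2%:R * (3 - tau)) * w0 `^ (tau - 1)) *
    eps `^ (tau - 2) * Q `^ (- (k%:R * (tau - 1))))%:E)%E.
Proof.
move=> mj0 hk eps0.
set e := 1 + k.-2%:R * (3 - tau).
have te : tau - 1 < e.
  have := tk_gt hk; move: tau23 => /andP[? ?].
  by rewrite /e k2E; lra.
have mB : measurable [set w : R | w <= Q].
  exact: (measurable_set_le _ (@measurable_id _ _ _)).
have v0 : 0 < Q / eps by rewrite divr_gt0.
have mEx : measurable [set u : k.-tuple S | Q / eps < (tnth u j0).1].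
  have m1 : measurable_fun [set: k.-tuple S] (fun u : k.-tuple S => (tnth u j0).1).
    exact: (measurableT_comp measurable_fst (measurable_tnth j0)).
  exact: (measurable_set_gt _ m1).
have c00 : 0 <= sc / M * (Q / eps) `^ (2 - tau).
  by rewrite mulr_ge0 ?powR_ge0// divr_ge0// ltW.
have H t : w0 < W m t ->
    (\int[P]_s (star_edge tau w0 gamma n (tnth (Zt t) m, tnth (Zt s) j0) *
        \1_[set u : k.-tuple S | (Q / eps < (tnth u j0).1)%R]
           (upd j0 (Zt t) (tnth (Zt s) j0)))%:E <=
     (sc / M * (Q / eps) `^ (2 - tau) * (W m t) `^ 1)%:E)%E.
  move=> wm; have wm0 : 0 < W m t by exact: lt_trans wm.
  have H1 := integral_vertex_ge_le w0_gt0 tau23 gamma_gt1 dim_gt0 n_gt0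
    (mW j0) (mX j0) (@weight_pareto _ _ _ _ _ _ _ _ _ G (tnth v j0))
    (@pos_uniform _ _ _ _ _ _ _ _ _ G (tnth v j0))
    (weight_pos_indep G (tnth v j0)) wm (fun i => pos_torus G (tnth v m) t i) v0.
  have mE : measurable [set z : S | Q / eps <= z.1].
    exact: (measurable_set_ge _ measurable_fst).
  apply: le_trans (le_trans H1 _).
    apply: integral_star_edge_ext => // z _ /=.
    by rewrite tnth_upd eqxx => /ltW.
  rewrite lee_fin (powRr1 (ltW wm0)) /sc /star_cst le_eqVlt; apply/orP; left; apply/eqP.
  have -> : 1 - (tau - 1) = 2 - tau by ring.
  by rewrite /M; ring.
have B1 := clique_star_bound w0_gt0 tau23 gamma_gt1 dim_gt0 n_gt0 v_uniq mj0 mB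
  mEx c00 H.
apply: (le_trans B1); rewrite -/sc -/M -/e.
have B2 := min_weight_moment_below m mB te Q0 (fun w => id).
apply: (@le_trans _ _ ((sc / M * (Q / eps) `^ (2 - tau) * (sc / M) ^+ k.-2)%:E *
   (dyadic_cst (tau - 1) e * w0 `^ (tau - 1) * Q `^ (e - (tau - 1)))%:E)%E).
  apply: lee_wpmul2l => //; rewrite lee_fin mulr_ge0// exprn_ge0//.
  by rewrite divr_ge0// ltW.
rewrite -EFinM lee_fin.
have -> : (Q / eps) `^ (2 - tau) = Q `^ (2 - tau) * eps `^ (tau - 2).
  rewrite powRM ?invr_ge0 ?(ltW eps0) ?(ltW Q0)//; congr (_ * _).
  by rewrite -(powR_inv1 (ltW eps0)) -powRrM; congr powR; ring.
have -> : sc / M * (Q `^ (2 - tau) * eps `^ (tau - 2)) * (sc / M) ^+ k.-2 *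
   (dyadic_cst (tau - 1) e * w0 `^ (tau - 1) * Q `^ (e - (tau - 1))) =
   dyadic_cst (tau - 1) e * w0 `^ (tau - 1) * eps `^ (tau - 2) *
   ((sc / M) ^+ k.-2.+1 * (Q `^ (2 - tau) * Q `^ (e - (tau - 1)))).
  by rewrite exprS; ring.
rewrite -powRD; last by rewrite (gt_eqF Q0) implybT.
have -> : 2 - tau + (e - (tau - 1)) = k.-1%:R * (3 - tau) - (tau - 1).
  by rewrite /e k2E; ring.
rewrite k1E scaleQ le_eqVlt; apply/orP; left; apply/eqP; ring.
Qed.

(** All weights are above [Q], and the weight of [i] is above [Q / eps]. *)
Lemma huge_weight_bound (i : 'I_k) (eps : R) : w0 <= Q -> 0 < eps < 1 ->
  (P [set t | forall j, ((if j == i then Q / eps else Q) < W j t)%R] <=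
   (eps `^ (tau - 1) * ((w0 / Q) `^ (tau - 1)) ^+ k)%:E)%E.
Proof.
move=> wQ /andP[eps0 eps1].
have QQ : Q <= Q / eps by rewrite ler_pdivlMr// ler_piMr// ltW.
rewrite (pr_all_weights_gt G v_uniq (b := fun j => if j == i then Q / eps else Q)).
  rewrite lee_fin (bigD1 i)//= eqxx (eq_bigr (fun=> (w0 / Q) `^ (tau - 1))); last first.
    by move=> j /negbTE ->.
  rewrite prodr_const cardC1 card_ord le_eqVlt; apply/orP; left; apply/eqP.
  have -> : w0 / (Q / eps) = eps * (w0 / Q) by field; rewrite !gt_eqF.
  rewrite powRM ?(ltW eps0) ?divr_ge0 ?(ltW w0_gt0) ?(ltW Q0)//.
  by rewrite -[k in RHS]prednK ?(ltnW k_ge2)// exprS mulrA.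
by move=> j; case: ifP => // _; exact: le_trans QQ.
Qed.

Let Mk c0 : c0 / M * (sc / M) ^+ k.-2 = c0 * sc ^+ k.-2 * M^-1 ^+ k.-1.
Proof. by rewrite exprMn -k1E [M^-1 ^+ _.+1]exprS; ring. Qed.

(** The vertices [o] and [j0] are close in direction [h].  The vertex [o] may be
    the centre [m] of the star or another leaf. *)
Lemma near_bound (m j0 o : 'I_k) (h : 'I_dim) (eps : R) :
  m != j0 -> o != j0 -> k%:R * (3 - tau) < 2 -> 0 <= eps ->
  (P (star_event G v m setT [set u |
        (circle_dist (tnth (tnth u o).2 h) (tnth (tnth u j0).2 h) <=
           eps * (n%:R * pareto_mean tau w0) `^ (- dim%:R^-1))%R] `&` clique G v) <=
   (near_cst w0 gamma dim * (dyadic_cst (tau - 1) 1 * w0 `^ (tau - 1)) * sc ^+ k.-2 *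
    (dyadic_cst (tau - 1) (k.-1%:R * (3 - tau)) * w0 `^ (k.-1%:R * (3 - tau))) *
    eps * M^-1 ^+ k.-1)%:E)%E.
Proof.
move=> mj0 oj0 hk eps0.
set e := k.-1%:R * (3 - tau).
have te : 0 <= e < tau - 1.
  rewrite /e mulr_ge0//=; last by move: tau23 => /andP[? ?]; lra.
  by move: hk; rewrite kE; lra.
set Ex := [set u : k.-tuple S | _].
have mS i : measurable_fun [set: k.-tuple S] (fun u : k.-tuple S => tnth (tnth u i).2 h).
  exact: (measurableT_comp (measurable_tnth h)
    (measurableT_comp measurable_snd (measurable_tnth i))).
have mEx : measurable Ex.
  have -> : Ex = (fun u : k.-tuple S => circle_dist (tnth (tnth u o).2 h)
     (tnth (tnth u j0).2 h)) @^-1` `]-oo, (eps * M `^ (- dim%:R^-1))].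
    by apply/seteqP; split => u /=; rewrite in_itv.
  by rewrite -[Y in measurable Y]setTI; apply: measurable_circle_dist.
pose c1 := near_cst w0 gamma dim * (dyadic_cst (tau - 1) 1 * w0 `^ (tau - 1)) * eps.
have c10 : 0 <= c1.
  rewrite /c1 mulr_ge0// mulr_ge0//.
    rewrite /near_cst mulr_ge0 ?powR_ge0// mulr_ge0 ?exprn_ge0// addr_ge0//.
    rewrite ltW// dyadic_cst_gt0// gt_eqF// (le_lt_trans _ gamma_gt1)//.
    by rewrite ler_pdivrMr ?ltr0n// mul1r ler_nat leq_pred.
  rewrite mulr_ge0 ?powR_ge0// ltW// dyadic_cst_gt0// lt_eqF//.
  by move: tau23 => /andP[? ?]; lra.
have c00 : 0 <= c1 / M by rewrite divr_ge0// ltW.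
have H t : w0 < W m t ->
    (\int[P]_s (star_edge tau w0 gamma n (tnth (Zt t) m, tnth (Zt s) j0) *
        \1_Ex (upd j0 (Zt t) (tnth (Zt s) j0)))%:E <=
     (c1 / M * (W m t) `^ (3 - tau))%:E)%E.
  move=> wm; have wm0 : 0 < W m t by exact: lt_trans wm.
  have H1 := integral_vertex_near_le w0_gt0 tau23 gamma_gt1 dim_gt0 n_gt0
    (mW j0) (mX j0) (@weight_pareto _ _ _ _ _ _ _ _ _ G (tnth v j0))
    (@pos_uniform _ _ _ _ _ _ _ _ _ G (tnth v j0))
    (weight_pos_indep G (tnth v j0)) wm (fun i => pos_torus G (tnth v m) t i)
    h (pos_torus G (tnth v o) t h) eps0.
  apply: le_trans (le_trans H1 _).
    apply: integral_star_edge_ext => //.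
      apply: measurableI.
        exact: (measurable_set_ge _ measurable_fst).
      set E := [set z : S | _].
      have -> : E = (fun z : S => circle_dist (tnth (X o t) h) (tnth z.2 h)) @^-1`
          `]-oo, (eps * M `^ (- dim%:R^-1))].
        by apply/seteqP; split => u /=; rewrite in_itv.
      rewrite -[Y in measurable Y]setTI.
      apply: measurable_circle_dist => //.
      exact: (measurableT_comp (measurable_tnth h) measurable_snd).
    move=> z wz; rewrite /Ex /= !tnth_upd eqxx (negbTE oj0) tnth_marks/= => hz.
    by split.
  rewrite lee_fin le_eqVlt /c1 -/M; apply/orP; left; apply/eqP.
  have -> : W m t `^ (3 - tau) = W m t * W m t `^ (1 - (tau - 1)).
    have -> : 3 - tau = 1 + (1 - (tau - 1)) by ring.
    rewrite powRD; last by rewrite (gt_eqF wm0) implybT.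
    by rewrite (powRr1 (ltW wm0)).
  ring.
have B1 := clique_star_bound w0_gt0 tau23 gamma_gt1 dim_gt0 n_gt0 v_uniq mj0
  (@measurableT _ _) mEx c00 H.
apply: (le_trans B1); rewrite -/sc -/M.
have -> : 3 - tau + k.-2%:R * (3 - tau) = e by rewrite /e -k1E -natr1; ring.
have B2 := min_weight_moment_above m te.
rewrite Mk.
have K0 : 0 <= c1 * sc ^+ k.-2 * M^-1 ^+ k.-1.
  apply: mulr_ge0; last by apply: exprn_ge0; rewrite invr_ge0 ltW.
  by apply: mulr_ge0 => //; exact/exprn_ge0/ltW.
apply: le_trans (lee_wpmul2l _ B2) _; first by rewrite lee_fin.
rewrite -EFinM lee_fin le_eqVlt /c1; apply/orP; left; apply/eqP; ring.
Qed.

(** The vertices [m] and [j0] are far apart; the exponent [s] replaces [gamma]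
    and is small enough for all moments to be finite. *)
Lemma far_bound (m j0 : 'I_k) (s l : R) :
  m != j0 -> 0 < l -> 1 < s <= gamma -> s < tau - 1 ->
  2 * s - (tau - 1) + k.-2%:R * (3 - tau) < tau - 1 ->
  (P (star_event G v m setT [set u |
        (l * (n%:R * pareto_mean tau w0) `^ (- dim%:R^-1) <
          torus_dist (tnth u m).2 (tnth u j0).2)%R] `&` clique G v) <=
   (4 ^+ dim * dyadic_cst 1 s * (dyadic_cst (tau - 1) s * w0 `^ (tau - 1)) * sc ^+ k.-2 *
    (dyadic_cst (tau - 1) (2 * s - (tau - 1) + k.-2%:R * (3 - tau)) *
     w0 `^ (2 * s - (tau - 1) + k.-2%:R * (3 - tau))) *
    (l ^+ dim) `^ (1 - s) * M^-1 ^+ k.-1)%:E)%E.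
Proof.
move=> mj0 l0 s1 st; set e := _ + _ => et.
have te : 0 <= e < tau - 1.
  rewrite et andbT /e addr_ge0//; last first.
    by rewrite mulr_ge0//; move: tau23 => /andP[? ?]; lra.
  by move: tau23 s1 => /andP[? ?] /andP[? ?]; lra.
set Ex := [set u : k.-tuple S | _].
have mS i : measurable_fun [set: k.-tuple S] (fun u : k.-tuple S => (tnth u i).2).
  exact: (measurableT_comp measurable_snd (measurable_tnth i)).
have mEx : measurable Ex.
  have -> : Ex = (fun u : k.-tuple S => torus_dist (tnth u m).2 (tnth u j0).2) @^-1`
      `](l * M `^ (- dim%:R^-1)), +oo[.
    by apply/seteqP; split => u /=; rewrite in_itv/= andbT.
  by rewrite -[Y in measurable Y]setTI; apply: measurable_torus_dist.
pose c1 := 4 ^+ dim * dyadic_cst 1 s * (dyadic_cst (tau - 1) s * w0 `^ (tau - 1)) *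
  (l ^+ dim) `^ (1 - s).
have c10 : 0 <= c1.
  rewrite /c1 mulr_ge0 ?powR_ge0// mulr_ge0//.
    rewrite mulr_ge0 ?exprn_ge0// ltW// dyadic_cst_gt0//.
    by move: s1 => /andP[? _]; rewrite gt_eqF.
  by rewrite mulr_ge0 ?powR_ge0// ltW// dyadic_cst_gt0// lt_eqF.
have c00 : 0 <= c1 / M by rewrite divr_ge0// ltW.
have H t : w0 < W m t ->
    (\int[P]_s (star_edge tau w0 gamma n (tnth (Zt t) m, tnth (Zt s) j0) *
        \1_Ex (upd j0 (Zt t) (tnth (Zt s) j0)))%:E <=
     (c1 / M * (W m t) `^ (2 * s - (tau - 1)))%:E)%E.
  move=> wm; have wm0 : 0 < W m t by exact: lt_trans wm.
  have H1 := integral_vertex_far_le w0_gt0 tau23 dim_gt0 n_gt0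
    (mW j0) (mX j0) (@weight_pareto _ _ _ _ _ _ _ _ _ G (tnth v j0))
    (@pos_uniform _ _ _ _ _ _ _ _ _ G (tnth v j0))
    (weight_pos_indep G (tnth v j0)) wm (fun i => pos_torus G (tnth v m) t i)
    l0 s1 st.
  apply: le_trans (le_trans H1 _).
    apply: integral_star_edge_ext => //.
      apply: measurableI.
        exact: (measurable_set_ge _ measurable_fst).
      set E := [set z : S | _].
      have -> : E = (fun z : S => torus_dist (X m t) z.2) @^-1`
          `](l * M `^ (- dim%:R^-1)), +oo[.
        by apply/seteqP; split => u /=; rewrite in_itv/= andbT.
      rewrite -[Y in measurable Y]setTI.
      by apply: measurable_torus_dist => //; exact: measurable_snd.
    move=> z wz; rewrite /Ex /= !tnth_upd eqxx (negbTE mj0) tnth_marks/= => hz.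
    by split.
  rewrite lee_fin le_eqVlt /c1 -/M; apply/orP; left; apply/eqP.
  have -> : W m t `^ (2 * s - (tau - 1)) = W m t `^ s * W m t `^ (s - (tau - 1)).
    rewrite -powRD; last by rewrite (gt_eqF wm0) implybT.
    by congr powR; ring.
  ring.
have B1 := clique_star_bound w0_gt0 tau23 gamma_gt1 dim_gt0 n_gt0 v_uniq mj0
  (@measurableT _ _) mEx c00 H.
apply: (le_trans B1); rewrite -/sc -/M -/e.
have B2 := min_weight_moment_above m te.
rewrite Mk.
have K0 : 0 <= c1 * sc ^+ k.-2 * M^-1 ^+ k.-1.
  apply: mulr_ge0; last by apply: exprn_ge0; rewrite invr_ge0 ltW.
  by apply: mulr_ge0 => //; exact/exprn_ge0/ltW.
apply: le_trans (lee_wpmul2l _ B2) _; first by rewrite lee_fin.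
rewrite -EFinM lee_fin le_eqVlt /c1; apply/orP; left; apply/eqP; ring.
Qed.

End bad_events.

(** * Conditional probabilities *)

Lemma exists_small_powR (R : realType) (C r delta : R) :
  0 <= C -> 0 < r -> 0 < delta ->
  exists2 eps : R, 0 < eps < 1 & C * eps `^ r <= delta.
Proof.
move=> C0 r0 d0; have C1 : 0 < C + 1 by rewrite ltr_wpDl.
pose e := Num.min 2^-1 ((delta / (C + 1)) `^ r^-1).
have dC : 0 < delta / (C + 1) by rewrite divr_gt0.
have e0 : 0 < e by rewrite lt_min invr_gt0 ltr0n powR_gt0.
exists e; first by rewrite e0 gt_min invf_lt1// ltr1n.
have : e `^ r <= delta / (C + 1).
  have -> : delta / (C + 1) = ((delta / (C + 1)) `^ r^-1) `^ r.
    by rewrite -powRrM mulVf ?gt_eqF// powRr1// ltW.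
  apply: ge0_ler_powR; rewrite ?nnegrE ?powR_ge0 ?(ltW r0) ?(ltW e0)//.
  by rewrite ge_min lexx orbT.
move=> h; apply: (@le_trans _ _ (C * (delta / (C + 1)))).
  by rewrite ler_wpM2l.
rewrite mulrCA ger_pMr// ler_pdivrMr// mul1r; lra.
Qed.

Section elementary.
Context (R : realType) (disp : measure_display) (T : measurableType disp)
  (P : probability T R).

Lemma pr_union_le (I : finType) (A : I -> set T) (B : set T) (b : R) :
  (forall i, measurable (A i)) -> measurable B ->
  (forall t, B t -> exists i, A i t) -> (forall i, (P (A i) <= b%:E)%E) ->
  (P B <= (#|I|%:R * b)%:E)%E.
Proof.
move=> mA mB BA Ab.
have H (s : seq I) : measurable (\big[setU/set0]_(i <- s) A i) /\
    (P (\big[setU/set0]_(i <- s) A i) <= ((size s)%:R * b)%:E)%E.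
  elim: s => [|i s [m ih]]; first by rewrite big_nil measure0 mul0r.
  rewrite big_cons; split; first exact: measurableU.
  apply: le_trans; first exact: measureU2.
  by rewrite /= -natr1 mulrDl mul1r addrC EFinD; apply: leeD.
have [m le] := H (enum I); rewrite cardE; apply: le_trans le.
apply: le_measure; rewrite ?inE// => t /BA[i Ait].
by rewrite -bigcup_seq; exists i => //=; rewrite mem_enum.
Qed.

Lemma cond_pr_ge (W C : set T) (L p : R) :
  measurable W -> measurable C -> 0 < L -> p <= 1 ->
  (L%:E <= P C)%E -> (P (C `\` W) <= ((1 - p) * L)%:E)%E ->
  p <= cond_pr P W C.
Proof.
move=> mW mC L0 p1 LC CW; rewrite /cond_pr.
have mWC : measurable (W `&` C) by exact: measurableI.
have mCW : measurable (C `\` W) by exact: measurableD.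
have f1 : P C \is a fin_num by exact: fin_num_measure.
have f2 : P (W `&` C) \is a fin_num by exact: fin_num_measure.
have f3 : P (C `\` W) \is a fin_num by exact: fin_num_measure.
have E : fine (P C) = fine (P (C `\` W)) + fine (P (W `&` C)).
  by rewrite -fineD// setIC -measureDI.
have LC' : L <= fine (P C) by rewrite -lee_fin fineK.
have CW' : fine (P (C `\` W)) <= (1 - p) * L by rewrite -lee_fin fineK.
rewrite ler_pdivlMr; last exact: lt_le_trans LC'.
have : (1 - p) * L <= (1 - p) * fine (P C) by rewrite ler_wpM2l// subr_ge0.
lra.
Qed.

End elementary.

(** * Typical weights and distances of a clique *)

(** The sum of the constants for the cliques with a small, a large or a huge
    weight. *)
Definition hub_cst {R : realType} (tau w0 gamma : R) (dim k : nat) : R :=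
  star_cst tau w0 gamma dim ^+ k.-1 *
    (dyadic_cst (tau - 1) (k.-1%:R * (3 - tau)) * w0 `^ (tau - 1)) +
  star_cst tau w0 gamma dim ^+ k.-1 *
    (dyadic_cst (tau - 1) (1 + k.-2%:R * (3 - tau)) * w0 `^ (tau - 1)) +
  (w0 `^ (tau - 1)) ^+ k.

(** The sum of the constants for the cliques with two vertices that are too close
    or too far apart. *)
Definition near_far_cst {R : realType} (tau w0 gamma s : R) (dim k : nat) : R :=
  near_cst w0 gamma dim * (dyadic_cst (tau - 1) 1 * w0 `^ (tau - 1)) *
    star_cst tau w0 gamma dim ^+ k.-2 *
    (dyadic_cst (tau - 1) (k.-1%:R * (3 - tau)) * w0 `^ (k.-1%:R * (3 - tau))) +
  4 ^+ dim * dyadic_cst 1 s * (dyadic_cst (tau - 1) s * w0 `^ (tau - 1)) *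
    star_cst tau w0 gamma dim ^+ k.-2 *
    (dyadic_cst (tau - 1) (2 * s - (tau - 1) + k.-2%:R * (3 - tau)) *
     w0 `^ (2 * s - (tau - 1) + k.-2%:R * (3 - tau))) * (2 ^+ dim) `^ (s - 1).

Section assembly.
Context (R : realType) (disp : measure_display) (T : measurableType disp)
  (P : probability T R) (tau w0 gamma : R) (n dim : nat)
  (G : girg P tau w0 gamma n dim) (k : nat) (v : k.-tuple 'I_n).
Hypotheses (w0_gt0 : 0 < w0) (tau23 : 2 < tau < 3) (gamma_gt1 : 1 < gamma)
  (dim_gt0 : (0 < dim)%N) (n_gt0 : (0 < n)%N) (v_uniq : uniq v)
  (k_ge2 : (2 <= k)%N).

Local Notation S := (R * dim.-tuple R)%type.
Local Notation W i := (weight G (tnth v i)).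
Local Notation X i := (pos G (tnth v i)).
Let M : R := n%:R * pareto_mean tau w0.
Hypothesis w0M : w0 ^+ 2 <= M.

Let mean_gt0 : 0 < pareto_mean tau w0.
Proof. exact: pareto_mean_gt0. Qed.

Let M0 : 0 < M. Proof. by rewrite mulr_gt0// ltr0n. Qed.
Let Q := Num.sqrt M.
Let Q0 : 0 < Q. Proof. by rewrite sqrtr_gt0. Qed.
Let w0Q : w0 <= Q.
Proof.
by rewrite -[w0]ger0_norm ?(ltW w0_gt0)// -sqrtr_sqr ler_wsqrtr.
Qed.
Let tau_gt1 : 1 < tau. Proof. by move: tau23 => /andP[? ?]; lra. Qed.
Let sc0 : 0 < star_cst tau w0 gamma dim. Proof. exact: star_cst_gt0. Qed.
Let k_gt0 : (0 < k)%N. Proof. exact: ltnW. Qed.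
Let mW i : measurable_fun [set: T] (W i). Proof. exact: measurable_funPT. Qed.
Let mX i : measurable_fun [set: T] (X i). Proof. exact: measurable_funPT. Qed.
Let mC : measurable (clique G v). Proof. exact: measurable_clique. Qed.

Let light i : set T := ~` [set t | w0 < W i t].

Let mgt i b : measurable [set t | b < W i t].
Proof.
exact: (measurable_set_gt _ (mW _)).
Qed.

Let mlight i : measurable (light i). Proof. exact: measurableC. Qed.

Let pr_light i : P (light i) = 0%E.
Proof.
rewrite /light probability_setC// weight_pareto// divff ?gt_eqF// powR1.
by rewrite subee.
Qed.

Let min_weight t : exists m : 'I_k, forall j, W m t <= W j t.
Proof.
have [m _ h] := arg_minP (fun i : 'I_k => W i t) (i0 := Ordinal k_gt0) (P := xpredT) isT.
by exists m => j; exact: h.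
Qed.

(** The index type enumerates the exceptional events: a vertex of weight at most
    [w0], which has probability [0], and the events for a small, a large and a
    huge weight. *)
Lemma hub_clique (eps r p : R) :
  2 < k%:R * (3 - tau) -> 0 < eps < 1 -> p <= 1 ->
  r <= tau - 2 -> r <= k.-1%:R * (3 - tau) - (tau - 1) ->
  #|{: ('I_k + 'I_k) + ('I_k * 'I_k + 'I_k)}|%:R *
    (hub_cst tau w0 gamma dim k * eps `^ r) <=
    (1 - p) * (w0 `^ (tau - 1)) ^+ k ->
  p <= cond_pr P [set t | W_NG G eps t v] (clique G v).
Proof.
move=> hk eps01 p1 r1 r2 Heps; have /andP[eps0 eps1] := eps01.
pose D := Q `^ (- (k%:R * (tau - 1))).
have D0 : 0 < D by exact: powR_gt0.
have DE : ((w0 / Q) `^ (tau - 1)) ^+ k = (w0 `^ (tau - 1)) ^+ k * D.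
  rewrite powRM ?invr_ge0 ?(ltW Q0) ?(ltW w0_gt0)// exprMn; congr (_ * _).
  rewrite -powR_mulrn ?powR_ge0// -powRrM -(powR_inv1 (ltW Q0)) -powRrM.
  by congr powR; ring.
have EW : [set t | W_NG G eps t v] =
   [set t | forall i : 'I_k, true -> (W i @^-1` `[(eps * Q), (Q / eps)]) t].
  have ME : pareto_mean tau w0 * n%:R = M by rewrite /M mulrC.
  apply/seteqP; split => t /=.
    move=> [_ h] i _; have := h i; rewrite /scale_itv/= ME powR12_sqrt//.
    exact: ltW.
  move=> h; split => // i; rewrite /scale_itv/= ME powR12_sqrt ?(ltW M0)//.
  exact: h.
have mWNG : measurable [set t | W_NG G eps t v].
  rewrite EW; apply: (measurable_forall (D := xpredT)) => i _.
  by rewrite -[Y in measurable Y]setTI; exact: mW.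
have pw k' : 0 < (w0 `^ (tau - 1)) ^+ k' by rewrite exprn_gt0// powR_gt0.
apply: (@cond_pr_ge _ _ _ _ _ _ (((w0 / Q) `^ (tau - 1)) ^+ k)) => //.
- by rewrite DE mulr_gt0.
- exact: clique_pr_ge_hubs.
pose A (i : ('I_k + 'I_k) + ('I_k * 'I_k + 'I_k)) : set T :=
  match i with
  | inl (inl i) => light i
  | inl (inr m) => star_event G v m [set w | w < eps * Q] setT `&` clique G v
  | inr (inl (m, j)) => if m == j then set0 else
      star_event G v m [set w | w <= Q] [set u | Q / eps < (tnth u j).1] `&` clique G v
  | inr (inr i) => [set t | forall j : 'I_k, true ->
      [set t | (if j == i then Q / eps else Q) < W j t] t]
  end.
have mltw b : measurable [set w : R | w < b].
  exact: (measurable_set_lt _ (@measurable_id _ _ _)).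
have mlew b : measurable [set w : R | w <= b].
  exact: (measurable_set_le _ (@measurable_id _ _ _)).
have mgtu b (j : 'I_k) : measurable [set u : k.-tuple S | b < (tnth u j).1].
  have m1 : measurable_fun [set: k.-tuple S] (fun u : k.-tuple S => (tnth u j).1).
    exact: (measurableT_comp measurable_fst (measurable_tnth j)).
  exact: (measurable_set_gt _ m1).
have mA i : measurable (A i).
  case: i => [[i|m]|[[m j]|i]] /=.
  - exact: mlight.
  - apply: measurableI => //; apply: vertices_sigma_measurable.
    exact: star_event_sigma.
  - case: ifP => // _; apply: measurableI => //; apply: vertices_sigma_measurable.
    exact: star_event_sigma.
  - by apply: (measurable_forall (D := xpredT)) => j _; exact: mgt.
apply: le_trans (pr_union_le (b := hub_cst tau w0 gamma dim k * eps `^ r * D) mA _ _ _) _.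
- exact: measurableD.
- move=> t [Ct nW].
  have [[i li]|all_heavy] := pselect (exists i, light i t).
    by exists (inl (inl i)).
  have heavy i : w0 < W i t.
    by apply: contrapT => h; apply: all_heavy; exists i.
  have [m mmin] := min_weight t.
  have [i /negP hi] : exists i, ~ (eps * Q <= W i t <= Q / eps).
    apply: contrapT => h; apply: nW; rewrite EW => i _.
    apply: contrapT => h2; apply: h; exists i; move: h2.
    by rewrite /= in_itv.
  move: hi; rewrite negb_and -!ltNge => /orP[hi|hi].
    exists (inl (inr m)); split => //; split => //.
    exact: le_lt_trans (mmin i) hi.
  have QQ : Q < Q / eps by rewrite ltr_pdivlMr// gtr_pMr.
  have [mQ|Qm] := leP (W m t) Q.
    exists (inr (inl (m, i))) => /=; case: eqVneq => [mi|_].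
      by move: hi; rewrite -mi => /(lt_trans QQ); rewrite ltNge mQ.
    by split => //; split => //=; rewrite tnth_marks.
  exists (inr (inr i)) => j _ /=; case: eqVneq => [->//|_].
  exact: lt_le_trans Qm (mmin j).
- have epsr a : r <= a -> eps `^ a <= eps `^ r.
    by move=> ra; rewrite ger_powR// eps0 ltW.
  have dc a : a != tau - 1 -> 0 <= dyadic_cst (tau - 1) a.
    by move=> h; rewrite ltW// dyadic_cst_gt0.
  have kE : k%:R = k.-1%:R + 1 :> R by rewrite natr1 prednK.
  have k2E : k.-2%:R = k.-1%:R - 1 :> R.
    by rewrite -[in RHS](_ : k.-2.+1 = k.-1) -?natr1 ?addrK//; case: (k) k_ge2 => [|[]].
  have [t2 t3] := andP tau23.
  have te1 : tau - 1 < k.-1%:R * (3 - tau) by move: hk; rewrite kE; lra.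
  have te2 : tau - 1 < 1 + k.-2%:R * (3 - tau) by rewrite k2E; lra.
  set c1 := star_cst tau w0 gamma dim ^+ k.-1 *
    (dyadic_cst (tau - 1) (k.-1%:R * (3 - tau)) * w0 `^ (tau - 1)).
  set c2 := star_cst tau w0 gamma dim ^+ k.-1 *
    (dyadic_cst (tau - 1) (1 + k.-2%:R * (3 - tau)) * w0 `^ (tau - 1)).
  set c3 := (w0 `^ (tau - 1)) ^+ k.
  have c10 : 0 <= c1.
    by rewrite /c1 mulr_ge0 ?exprn_ge0 ?(ltW sc0)// mulr_ge0 ?powR_ge0// dc// gt_eqF.
  have c20 : 0 <= c2.
    by rewrite /c2 mulr_ge0 ?exprn_ge0 ?(ltW sc0)// mulr_ge0 ?powR_ge0// dc// gt_eqF.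
  have c30 : 0 <= c3 by exact/ltW/pw.
  have hE : hub_cst tau w0 gamma dim k = c1 + c2 + c3 by [].
  have step c a : 0 <= c -> c <= c1 + c2 + c3 -> r <= a ->
      c * eps `^ a * D <= (c1 + c2 + c3) * eps `^ r * D.
    move=> c0 cc ra; rewrite ler_wpM2r ?(ltW D0)//.
    by apply: ler_pM => //; [exact: powR_ge0|exact: epsr].
  rewrite hE => -[[i|m]|[[m j]|i]] /=.
  + by rewrite pr_light lee_fin !mulr_ge0 ?powR_ge0 ?(ltW D0)// !addr_ge0.
  + apply: (le_trans (small_weight_bound G w0_gt0 tau23 gamma_gt1 dim_gt0
      n_gt0 v_uniq k_ge2 m hk eps0)).
    by rewrite lee_fin -/c1 -/M -/Q -/D step//; lra.
  + case: (eqVneq m j) => [_|mj].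
      by rewrite measure0 lee_fin !mulr_ge0 ?powR_ge0 ?(ltW D0)// !addr_ge0.
    apply: (le_trans (large_weight_bound G w0_gt0 tau23 gamma_gt1 dim_gt0
      n_gt0 v_uniq k_ge2 mj hk eps0)).
    by rewrite lee_fin -/c2 -/M -/Q -/D step//; lra.
  + have -> : [set t | forall j : 'I_k, true -> (if j == i then Q / eps else Q) < W j t] =
       [set t | forall j, (if j == i then Q / eps else Q) < W j t].
      by apply/seteqP; split => t h j; [exact: h|move=> _; exact: h].
    apply: (le_trans (huge_weight_bound G w0_gt0 tau23 n_gt0 v_uniq k_ge2 i w0Q eps01)).
    by rewrite lee_fin -/M -/Q DE -/c3 mulrA [eps `^ _ * _]mulrC step//; lra.
- by rewrite lee_fin DE !mulrA ler_wpM2r ?(ltW D0)// -!mulrA.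
Qed.

Let circle_distxx (a : R) : circle_dist a a = 0.
Proof. by rewrite /circle_dist subrr normr0 subr0; apply/min_idPl; exact: ler01. Qed.

(** If two vertices are far apart in some direction, then by the triangle
    inequality one of them is at least half as far from the vertex of smallest
    weight; this is the case of [far_bound] with [l = 1 / (2 * eps)]. *)
Lemma local_clique (eps r s p : R) :
  k%:R * (3 - tau) < 2 -> 0 < eps < 1 -> p <= 1 ->
  1 < s <= gamma -> s < tau - 1 ->
  2 * s - (tau - 1) + k.-2%:R * (3 - tau) < tau - 1 ->
  r <= 1 -> r <= s - 1 ->
  #|{: 'I_k + (('I_k * 'I_k) * ('I_k * 'I_dim) + 'I_k * 'I_k)}|%:R *
    (near_far_cst tau w0 gamma s dim k * eps `^ r) <=
    (1 - p) * (w0 ^+ 2 / 2 ^+ dim) ^+ k.-1 ->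
  p <= cond_pr P [set t | W_G G eps t v] (clique G v).
Proof.
move=> hk eps01 p1 s1 st et r1 rs Heps; have /andP[eps0 eps1] := eps01.
pose D := M^-1 ^+ k.-1.
have D0 : 0 < D by rewrite exprn_gt0// invr_gt0.
have DE : (w0 ^+ 2 / (2 ^+ dim * M)) ^+ k.-1 = (w0 ^+ 2 / 2 ^+ dim) ^+ k.-1 * D.
  by rewrite -exprMn; congr (_ ^+ _); rewrite invfM mulrA.
pose N := M `^ (- dim%:R^-1).
have N0 : 0 < N by exact: powR_gt0.
pose J (i1 i : 'I_k) (h : 'I_dim) : set T :=
  (fun t => circle_dist (tnth (X i t) h) (tnth (X i1 t) h)) @^-1`
    `[(eps * N), (N / eps)].
have mcd i j h : measurable_fun [set: T]
    (fun t => circle_dist (tnth (X i t) h) (tnth (X j t) h)).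
  apply: measurable_circle_dist.
    exact: (measurableT_comp (measurable_tnth h) (mX i)).
  exact: (measurableT_comp (measurable_tnth h) (mX j)).
have EW : [set t | W_G G eps t v] =
   [set t | forall q : 'I_k * ('I_k * 'I_dim),
      (q.1 == 0%N :> nat) && (0 < q.2.1)%N -> J q.1 q.2.1 q.2.2 t].
  have ME : pareto_mean tau w0 * n%:R = M by rewrite /M mulrC.
  apply/seteqP; split => t /=.
    move=> [_ h] [i1 [i l]] /=; move=> /andP[/eqP i10 i0]; have := h i1 i l i10 i0.
    by rewrite /scale_itv/= ME.
  move=> h; split => // i1 i l i10 i0; have := h (i1, (i, l)).
  by rewrite /= i10 eqxx i0 /= /scale_itv/= ME; exact.
have mWG : measurable [set t | W_G G eps t v].
  rewrite EW; apply: measurable_forall => q _.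
  by rewrite -[Y in measurable Y]setTI; exact: mcd.
have w2 : 0 < w0 ^+ 2 / 2 ^+ dim by rewrite divr_gt0 ?exprn_gt0.
apply: (@cond_pr_ge _ _ _ _ _ _ ((w0 ^+ 2 / (2 ^+ dim * M)) ^+ k.-1)) => //.
- by rewrite DE mulr_gt0// exprn_gt0.
- exact: clique_pr_ge_near.
pose l := (2 * eps)^-1.
have l0 : 0 < l by rewrite invr_gt0 mulr_gt0.
pose near_set (o j : 'I_k) (h : 'I_dim) : set (k.-tuple S) :=
  [set u | circle_dist (tnth (tnth u o).2 h) (tnth (tnth u j).2 h) <= eps * N].
pose far_set (m j : 'I_k) : set (k.-tuple S) :=
  [set u | l * N < torus_dist (tnth u m).2 (tnth u j).2].
pose A (i : 'I_k + (('I_k * 'I_k) * ('I_k * 'I_dim) + 'I_k * 'I_k)) : set T :=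
  match i with
  | inl i => light i
  | inr (inl ((m, j), (o, h))) => if (m != j) && (o != j) then
      star_event G v m setT (near_set o j h) `&` clique G v else set0
  | inr (inr (m, j)) => if m != j then
      star_event G v m setT (far_set m j) `&` clique G v else set0
  end.
have m2 i : measurable_fun [set: k.-tuple S] (fun u : k.-tuple S => (tnth u i).2).
  exact: (measurableT_comp measurable_snd (measurable_tnth i)).
have mnear o j h : measurable (near_set o j h).
  have -> : near_set o j h = (fun u : k.-tuple S => circle_dist (tnth (tnth u o).2 h)
     (tnth (tnth u j).2 h)) @^-1` `]-oo, (eps * N)].
    by apply/seteqP; split => u /=; rewrite in_itv.
  rewrite -[Y in measurable Y]setTI; apply: measurable_circle_dist => //.
    exact: (measurableT_comp (measurable_tnth h) (m2 o)).
  exact: (measurableT_comp (measurable_tnth h) (m2 j)).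
have mfar m j : measurable (far_set m j).
  have -> : far_set m j = (fun u : k.-tuple S => torus_dist (tnth u m).2
     (tnth u j).2) @^-1` `](l * N), +oo[.
    by apply/seteqP; split => u /=; rewrite in_itv/= andbT.
  by rewrite -[Y in measurable Y]setTI; apply: measurable_torus_dist.
have mA i : measurable (A i).
  case: i => [i | [ [ [m j] [q h] ] | [m j] ] ] /=.
  - exact: mlight.
  - case: ifP => // _; apply: measurableI => //; apply: vertices_sigma_measurable.
    exact: star_event_sigma.
  - case: ifP => // _; apply: measurableI => //; apply: vertices_sigma_measurable.
    exact: star_event_sigma.
have x01 t i h : 0 <= tnth (X i t) h < 1 by exact: pos_torus.
apply: le_trans (pr_union_le (b := near_far_cst tau w0 gamma s dim k * eps `^ r * D) mA _ _ _) _.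
- exact: measurableD.
- move=> t [Ct nW].
  have [[i li]|all_heavy] := pselect (exists i, light i t).
    by exists (inl i).
  have heavy i : w0 < W i t.
    by apply: contrapT => h; apply: all_heavy; exists i.
  have [m mmin] := min_weight t.
  have [[i1 [i h]] [hi1 nJ]] : exists q : 'I_k * ('I_k * 'I_dim),
      (q.1 == 0%N :> nat) && (0 < q.2.1)%N /\ ~ J q.1 q.2.1 q.2.2 t.
    apply: contrapT => H; apply: nW; rewrite EW => q hq.
    by apply: contrapT => H2; apply: H; exists q.
  have /andP[/eqP/= i10 i0] := hi1.
  have ii1 : i1 != i.
    by apply/eqP => E; move: i0; rewrite -E /= i10.
  have far_ex j : l * N < circle_dist (tnth (X m t) h) (tnth (X j t) h) ->
      exists a, A a t.
    move=> hj; have mj : m != j.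
      by apply/eqP => E; move: hj; rewrite E circle_distxx ltNge mulr_ge0// ltW.
    exists (inr (inr (m, j))); rewrite /= mj; split => //; split => //.
    by rewrite /far_set /= !tnth_marks; exact: lt_le_trans (circle_dist_le_torus _ _ h).
  move: nJ => /negP; rewrite in_itv/= negb_and -!ltNge => /orP[hn|hf].
    have [im|im] := eqVneq m i.
      have mi1 : m != i1 by rewrite im eq_sym.
      exists (inr (inl ((m, i1), (i, h)))); rewrite /= mi1 (eq_sym i) ii1.
      by split => //; split => //; rewrite /near_set /= !tnth_marks ltW.
    exists (inr (inl ((m, i), (i1, h)))); rewrite /= im ii1.
    by split => //; split => //; rewrite /near_set /= !tnth_marks circle_distC ltW.
  have tri := circle_dist_triangle (x01 t i h) (x01 t m h) (x01 t i1 h).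
  have lN : N / eps = l * N + l * N.
    by rewrite /l; field; rewrite gt_eqF.
  have [h1|h1] := ltP (l * N) (circle_dist (tnth (X m t) h) (tnth (X i t) h)).
    exact: far_ex h1.
  apply: (far_ex i1); move: h1 tri hf; rewrite circle_distC lN; lra.
- have epsr a : r <= a -> eps `^ a <= eps `^ r.
    by move=> ra; rewrite ger_powR// eps0 ltW.
  have [t2 t3] := andP tau23; have [s1a s1b] := andP s1.
  have kE : k%:R = k.-1%:R + 1 :> R by rewrite natr1 prednK.
  have te : k.-1%:R * (3 - tau) < tau - 1 by move: hk; rewrite kE; lra.
  have dcp a b : a != b -> 0 <= dyadic_cst b a :> R.
    by move=> h; rewrite ltW// dyadic_cst_gt0.
  set c1 := near_cst w0 gamma dim * (dyadic_cst (tau - 1) 1 * w0 `^ (tau - 1)) *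
    star_cst tau w0 gamma dim ^+ k.-2 *
    (dyadic_cst (tau - 1) (k.-1%:R * (3 - tau)) * w0 `^ (k.-1%:R * (3 - tau))).
  set c2 := 4 ^+ dim * dyadic_cst 1 s * (dyadic_cst (tau - 1) s * w0 `^ (tau - 1)) *
    star_cst tau w0 gamma dim ^+ k.-2 *
    (dyadic_cst (tau - 1) (2 * s - (tau - 1) + k.-2%:R * (3 - tau)) *
     w0 `^ (2 * s - (tau - 1) + k.-2%:R * (3 - tau))).
  set c3 := (2 ^+ dim) `^ (s - 1).
  have c10 : 0 <= c1.
    apply: mulr_ge0; last by apply: mulr_ge0; [apply: dcp; rewrite lt_eqF|exact: powR_ge0].
    apply: mulr_ge0; last exact/exprn_ge0/ltW.
    apply: mulr_ge0; last first.
      by apply: mulr_ge0; [apply: dcp; rewrite lt_eqF//; lra|exact: powR_ge0].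
    apply: mulr_ge0; last exact: powR_ge0.
    apply: mulr_ge0; first exact: exprn_ge0.
    apply: addr_ge0 => //; apply: dcp; rewrite gt_eqF// (le_lt_trans _ gamma_gt1)//.
    by rewrite ler_pdivrMr ?ltr0n// mul1r ler_nat leq_pred.
  have c20 : 0 <= c2.
    apply: mulr_ge0; last by apply: mulr_ge0; [apply: dcp; rewrite lt_eqF|exact: powR_ge0].
    apply: mulr_ge0; last exact/exprn_ge0/ltW.
    apply: mulr_ge0; last first.
      by apply: mulr_ge0; [apply: dcp; rewrite lt_eqF|exact: powR_ge0].
    by apply: mulr_ge0; [exact: exprn_ge0|apply: dcp; rewrite gt_eqF].
  have c30 : 0 <= c3 by exact: powR_ge0.
  have hE : near_far_cst tau w0 gamma s dim k = c1 + c2 * c3 by [].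
  have c23 : 0 <= c2 * c3 by exact: mulr_ge0.
  have R0 : 0 <= (c1 + c2 * c3) * eps `^ r * D.
    by rewrite !mulr_ge0 ?powR_ge0 ?(ltW D0)// addr_ge0.
  rewrite hE => -[i | [ [ [m j] [q h] ] | [m j] ] ] /=.
  + by rewrite pr_light lee_fin.
  + case: ifP => [/andP[mj oj]|_]; last by rewrite measure0 lee_fin.
    apply: (le_trans (near_bound G w0_gt0 tau23 gamma_gt1 dim_gt0 n_gt0 v_uniq k_ge2
      h mj oj hk (ltW eps0))).
    rewrite lee_fin -/c1 -/M -/D ler_wpM2r ?(ltW D0)//.
    apply: ler_pM => //; first exact: ltW.
      by rewrite lerDl.
    by rewrite -[leLHS](powRr1 (ltW eps0)); exact: epsr.
  + case: ifP => [mj|_]; last by rewrite measure0 lee_fin.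
    apply: (le_trans (far_bound G w0_gt0 tau23 gamma_gt1 dim_gt0 n_gt0 v_uniq k_ge2
      mj l0 s1 st et)).
    rewrite lee_fin -/c2 -/M -/D ler_wpM2r ?(ltW D0)//.
    apply: (@le_trans _ _ (c2 * c3 * eps `^ r)); last first.
      by rewrite ler_wpM2r ?powR_ge0// lerDr.
    rewrite -mulrA ler_wpM2l//.
    have -> : (l ^+ dim) `^ (1 - s) = c3 * (eps ^+ dim) `^ (s - 1).
      rewrite /l exprVn -powR_inv1 ?exprn_ge0 ?mulr_ge0 ?(ltW eps0)// -powRrM.
      rewrite (_ : -1 * (1 - s) = s - 1); last by ring.
      by rewrite exprMn powRM ?exprn_ge0 ?(ltW eps0).
    rewrite ler_wpM2l//; apply: le_trans (epsr _ rs).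
    apply: ge0_ler_powR; rewrite ?nnegrE ?exprn_ge0 ?(ltW eps0) ?subr_ge0 ?(ltW s1a)//.
    by rewrite -[leRHS]expr1 ler_wiXn2l ?(ltW eps0) ?(ltW eps1).
- rewrite lee_fin DE; have := ler_wpM2r (ltW D0) Heps; rewrite !mulrA; exact.
Qed.

End assembly.

Theorem theorem3 (R : realType) (tau w0 gamma : R) (dim k : nat)
    (tau23 : 2 < tau < 3) (w0_gt0 : 0 < w0) (gamma_gt1 : 1 < gamma)
    (dim_ge1 : (1 <= dim)%N) (k_ge2 : (2 <= k)%N)
    (p : R) (p01 : 0 < p < 1) :
  exists2 eps : R, 0 < eps < 1 &
  exists N : nat, forall n : nat, (N <= n)%N ->
  forall (disp : measure_display) (T : measurableType disp)
    (P : probability T R) (G : girg P tau w0 gamma n dim)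
    (v : k.-tuple 'I_n), uniq v ->
    (2 / (3 - tau) < k%:R ->
      p <= cond_pr P [set t | W_NG G eps t v] (clique G v)) /\
    (k%:R < 2 / (3 - tau) ->
      p <= cond_pr P [set t | W_G G eps t v] (clique G v)).
Proof.
have [t2 t3] := andP tau23; have /andP[p0 p1] := p01.
have t3' : 0 < 3 - tau by rewrite subr_gt0.
have mean_gt0 := pareto_mean_gt0 w0_gt0 tau23.
pose N := (Num.truncn (w0 ^+ 2 / pareto_mean tau w0)).+1.
have NM n : (N <= n)%N -> w0 ^+ 2 <= n%:R * pareto_mean tau w0.
  move=> Nn; rewrite -ler_pdivrMr//; apply: (le_trans (ltW (truncnS_gt _))).
  by rewrite ler_nat.
have kE : k%:R = k.-1%:R + 1 :> R by rewrite natr1 prednK// ltnW.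
have k2E : k.-2%:R = k.-1%:R - 1 :> R.
  by rewrite -[in RHS](_ : k.-2.+1 = k.-1) -?natr1 ?addrK//; case: (k) k_ge2 => [|[]].
have [hk|hk|hk] := ltgtP (2 / (3 - tau)) k%:R.
- have hk' : 2 < k%:R * (3 - tau) by rewrite -ltr_pdivrMr.
  pose r := Num.min (tau - 2) (k.-1%:R * (3 - tau) - (tau - 1)).
  have r0 : 0 < r by rewrite lt_min; apply/andP; split; move: hk'; rewrite kE; lra.
  pose c := #|{: ('I_k + 'I_k) + ('I_k * 'I_k + 'I_k)}|%:R *
     `|hub_cst tau w0 gamma dim k|.
  have c0 : 0 <= c by rewrite mulr_ge0.
  have d0 : 0 < (1 - p) * (w0 `^ (tau - 1)) ^+ k.
    by rewrite mulr_gt0 ?subr_gt0// exprn_gt0// powR_gt0.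
  have [eps eps01 epsP] := exists_small_powR c0 r0 d0.
  exists eps => //; exists N => n Nn disp T P G v v_uniq; split => // _.
  have n0 : (0 < n)%N by exact: leq_trans Nn.
  apply: (@hub_clique _ _ _ _ _ _ _ _ _ G _ _ w0_gt0 tau23 gamma_gt1 dim_ge1
    n0 v_uniq k_ge2 (NM n Nn) eps r) => //; first exact: ltW.
  + by rewrite ge_min lexx.
  + by rewrite ge_min lexx orbT.
  + apply: le_trans epsP; rewrite mulrA ler_wpM2r ?powR_ge0// ler_wpM2l//.
    exact: ler_norm.
- have hk' : k%:R * (3 - tau) < 2 by rewrite -ltr_pdivlMr.
  pose s := Num.min gamma ((1 + (tau - 1 - k.-2%:R * (3 - tau) / 2)) / 2).
  have k20 : 0 <= k.-2%:R * (3 - tau) by rewrite mulr_ge0// ltW.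
  have star1 : 1 < tau - 1 - k.-2%:R * (3 - tau) / 2.
    by move: hk'; rewrite kE k2E; lra.
  have s1 : 1 < s by rewrite lt_min gamma_gt1/=; lra.
  have sg : s <= gamma by rewrite ge_min lexx.
  have sle : s <= (1 + (tau - 1 - k.-2%:R * (3 - tau) / 2)) / 2.
    by rewrite ge_min lexx orbT.
  pose r := Num.min 1 (s - 1).
  have r0 : 0 < r by rewrite lt_min ltr01 subr_gt0.
  pose c := #|{: 'I_k + (('I_k * 'I_k) * ('I_k * 'I_dim) + 'I_k * 'I_k)}|%:R *
     `|near_far_cst tau w0 gamma s dim k|.
  have c0 : 0 <= c by rewrite mulr_ge0.
  have d0 : 0 < (1 - p) * (w0 ^+ 2 / 2 ^+ dim) ^+ k.-1.
    by rewrite mulr_gt0 ?subr_gt0// exprn_gt0// divr_gt0// exprn_gt0.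
  have [eps eps01 epsP] := exists_small_powR c0 r0 d0.
  exists eps => //; exists N => n Nn disp T P G v v_uniq; split => // _.
  have n0 : (0 < n)%N by exact: leq_trans Nn.
  apply: (@local_clique _ _ _ _ _ _ _ _ _ G _ _ w0_gt0 tau23 gamma_gt1 dim_ge1
    n0 v_uniq k_ge2 (NM n Nn) eps r s) => //.
  + exact: ltW.
  + by rewrite s1.
  + by lra.
  + by lra.
  + by rewrite ge_min lexx.
  + by rewrite ge_min lexx orbT.
  + apply: le_trans epsP; rewrite mulrA ler_wpM2r ?powR_ge0// ler_wpM2l//.
    exact: ler_norm.
(* At the critical value both implications are void. *)
- exists 2^-1; first by rewrite invr_gt0 ltr0n invf_lt1// ltr1n.
  by exists 0%N => n _ disp T P G v _; split.
Qed.
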